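(* Let $N\ge 1$. Suppose $a,b$ are analytic on $I=[-1,1]$ with common regularity ellipse $E\supset I$. Let $e^\eta=S+s>1$ be the sum of the semiaxes $S,s$ of $E$. Let $A_E=\max_{z\in E}\left|\int_{-1}^z a(\zeta)\,d\zeta\right|$ and $B_E=\max_{z\in E}\left|\int_{-1}^z b(\zeta)\,d\zeta\right|$. Suppose $\mu\in\mathbb{C}$ is an eigenvalue of $U$ (equivalently of $\hat U$) such that $|\mu|\ge\delta>0$. For integers $k\ge 1$ let $$\epsilon_k=\left(8(\sinh\eta)^{-1}e^{A_E+B_E/\delta}\right)k\,e^{-k\eta}.$$ Assume $U_N=V\Lambda V^{-1}$ is diagonalizable, with $\Lambda=\operatorname{diag}(\lambda_1,\dots,\lambda_{N+1})$ and eigenvalues ordered by decreasing magnitude, $|\lambda_1|\ge|\lambda_2|\ge\cdots$. Let $\hat V:l^2\to H^1$ be the bounded invertible operator associated to $V$ as described in the context, for which $\hat U_N=\hat V\hat\Lambda\hat V^{-1}$, and let $\operatorname{cond}(\hat V)=\|\hat V\|\,\|\hat V^{-1}\|$. Suppose $\|\hat U\tilde T_j-\hat U_N\tilde T_j\|_{H^1}\le\nu_j$ for $j=0,\dots,N$ and let $\xi_k=\left(\sum_{j=0}^k\nu_j^2\right)^{1/2}$ for $k=1,\dots,N$. Define $$\omega_k=\epsilon_k\left(\|\hat U\|+|\lambda_1|\operatorname{cond}(\hat V)\right)+(1+\epsilon_k)\xi_k.$$ Then $$\min_{j=1,\dots,N+1}|\mu-\lambda_j|\le\min\{\omega_1,\dots,\omega_N\}\operatorname{cond}(\hat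 V).$$
   Context: $I=[-1,1]$; $C(I)$ is the space of continuous complex-valued functions on $I$. A regularity ellipse $E\subset\mathbb{C}$ for given functions is a closed (filled) elliptical region with foci $\pm1$, semimajor and semiminor axes $S,s$, contained in an open set on which the functions are analytic. The scalar delay differential equation considered is $\dot x(t)=a(t)x(t)+b(t)x(t-2)$, where $a,b$ are given on $I$ and extended with period $2$. Let $\Phi_a(t)=\exp\left(\int_{-1}^t a(s)\,ds\right)$. The monodromy operator is $U:C(I)\to C(I)$, $$(Uf)(t)=\Phi_a(t)\left[f(1)+\int_{-1}^t\Phi_a(s)^{-1}b(s)f(s)\,ds\right].$$ Hilbert space $H^1$: $L^2$ is the space of measurable $f:I\to\mathbb{C}$ with $\int_{-1}^1|f(t)|^2(1-t^2)^{-1/2}dt<\infty$ and $\langle f,g\rangle_{L^2}=\int_{-1}^1\overline{f}g(1-t^2)^{-1/2}dt$. With $T_k(t)=\cos(k\arccos t)$, let $\hat T_0=\sqrt{1/\pi}\,T_0$, $\hat T_k=\sqrt{2/\pi}\,T_k$ ($k\ge1$), an orthonormal basis of $L^2$, and $\hat f_k=\langle\hat T_k,f\rangle_{L^2}$. $H^1=\{f\in L^2:\sum_{k\ge0}(1+k)^2|\hat f_k|^2<\infty\}$ with inner product $\langle f,g\rangle_{H^1}=\sum_k(1+k)^2\overline{\hat f_k}\hat g_k$. The functions $\tilde T_k=(1+k)^{-1}\hat T_k$, $k\ge0$, form an orthonormal basis of $H^1$. Elements of $H^1$ have continuous representatives, so $H^1\subset C(I)$, and $\hat U\in\mathcal{L}(H^1)$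 (bounded operators on $H^1$) is defined by the same formula as $U$. $\|\hat U\|$ is its operator norm on $H^1$. Collocation: $t_j=\cos(\pi j/N)$, $j=0,\dots,N$. $\mathcal{P}_N$ is the space of complex polynomials of degree $\le N$; $E_N:\mathcal{P}_N\to\mathbb{C}^{N+1}$, $(E_Np)_j=p(t_j)$, $j=0,\dots,N$; $P_N=E_N^{-1}$; $D_N=E_N\frac{d}{dt}P_N$, an $(N+1)\times(N+1)$ matrix. $\hat D_N$ is $D_N$ with its last row replaced by $(0,\dots,0,1)$. $\hat M_a$ is diagonal with entries $(\hat M_a)_{ii}=a(t_{i-1})$ for $1\le i\le N$ and $(\hat M_a)_{N+1,N+1}=0$. $\hat M_b$ is given by $(\hat M_bw)_i=b(t_{i-1})w_i$ for $1\le i\le N$ and $(\hat M_bw)_{N+1}=w_1$. $U_N=(\hat D_N-\hat M_a)^{-1}\hat M_b$ (the inverse is assumed to exist). $\Pi_N$ is the orthogonal projection of $H^1$ onto $\mathcal{P}_N$ and $\hat U_N=P_NU_NE_N\Pi_N\in\mathcal{L}(H^1)$. Operator $\hat V$: given $U_N=V\Lambda V^{-1}$, let $v_k$ be the $k$th column of $V$ and $p_k=P_Nv_k$, $k=1,\dots,N+1$. Define $\hat V:l^2\to H^1$ by $\hat Va=\sum_{k=1}^{N+1}a_kp_k+\sum_{k>N+1}a_k\tilde T_{k-1}$, and $\hat\Lambda\in\mathcal{L}(l^2)$ by $(\hat\Lambda a)_j=\lambda_ja_j$ for $j\le N+1$, $(\hat\Lambda a)_j=0$ for $j>N+1$. 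*)

(* Defs.v *)
From HB Require Import structures.
From mathcomp Require Import all_boot all_order all_algebra.
From mathcomp Require Import all_classical all_reals all_analysis.
From mathcomp Require Import complex.

Set Implicit Arguments.
Unset Strict Implicit.
Unset Printing Implicit Defensive.

Import Order.TTheory GRing.Theory Num.Theory numFieldNormedType.Exports.

Local Open Scope classical_set_scope.
Local Open Scope complex_scope.
Local Open Scope ring_scope.

(* R[i] carries its topology through the regular module R[i]^o; every limit,
   continuity or openness statement below is cast to that type. *)

(* modulus, with values in R (the library's `|z| lives in R[i]) *)
Definition cabs {R : realType} (z : R[i]) : R := Normc.normc z.

Definition cexp {R : realType} (z : R[i]) : R[i] :=
  (expR (complex.Re z))%:C * (cos (complex.Im z) +i* sin (complex.Im z)).

Definition sinh {R : realType} (x : R) : R := (expR x - expR (- x)) / 2.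

Definition cint {R : realType} (D : set R) (f : R -> R[i]) : R[i] :=
  (\int[lebesgue_measure]_(t in D) complex.Re (f t))
  +i* (\int[lebesgue_measure]_(t in D) complex.Im (f t)).

Definition analytic_at {R : realType} (f : R[i] -> R[i]) (z0 : R[i]) : Prop :=
  exists (c : nat -> R[i]) (r : R), 0 < r /\
    forall z, cabs (z - z0) < r ->
      (series (fun n => c n * (z - z0) ^+ n) : nat -> R[i]^o) @ \oo
        --> (f z : R[i]^o).

Definition analytic_on {R : realType} (f : R[i] -> R[i]) (Om : set R[i]) :
  Prop := forall z, Om z -> analytic_at f z.

(* closed filled ellipse centred at 0 with semiaxes S (along the real axis)
   and s; the foci are -1 and 1 when S ^ 2 = s ^ 2 + 1 *)
Definition ellipse {R : realType} (S s : R) : set R[i] :=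
  [set z | (complex.Re z / S) ^+ 2 + (complex.Im z / s) ^+ 2 <= 1].

(* integral of f from -1 to z along the straight segment; any other path in a
   convex domain of analyticity gives the same value *)
Definition cprim {R : realType} (f : R[i] -> R[i]) (z : R[i]) : R[i] :=
  (z + 1) * cint `[0, 1] (fun u : R => f (- 1 + u%:C * (z + 1))).

Definition is_max {R : realType} (X : set R) (m : R) : Prop :=
  X m /\ ubound X m.

(* I = [-1, 1]. A function on I is represented by a function on R of which
   only the values on I matter. *)
Definition Iset {R : realType} : set R := `[(-1 : R), 1].

Definition eqI {R : realType} (f g : R -> R[i]) : Prop :=
  forall t, Iset t -> f t = g t.

Definition CI {R : realType} : set (R -> R[i]) :=
  [set f | {within Iset, continuous (f : R -> R[i]^o)}].

Definition Phi {R : realType} (a : R[i] -> R[i]) (t : R) : R[i] :=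
  cexp (cint `[-1, t] (fun s : R => a s%:C)).

(* the coefficients a, b are functions of a complex variable; the operator
   only sees their restrictions to I *)
Definition monodromy {R : realType} (a b : R[i] -> R[i]) (f : R -> R[i]) :
  R -> R[i] := fun t =>
  Phi a t * (f 1 + cint `[-1, t] (fun s : R => (Phi a s)^-1 * b s%:C * f s)).

Definition is_eigenvalue_CI {R : realType}
    (T : (R -> R[i]) -> (R -> R[i])) (mu : R[i]) : Prop :=
  exists f : R -> R[i], CI f /\ ~ eqI f (fun=> 0) /\
    eqI (T f) (fun t => mu * f t).

Definition weight {R : realType} (t : R) : R := (Num.sqrt (1 - t ^+ 2))^-1.

Definition L2w {R : realType} : set (R -> R[i]) :=
  [set f | [/\ measurable_fun Iset (fun t => complex.Re (f t)),
     measurable_fun Iset (fun t => complex.Im (f t)) &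
     (\int[lebesgue_measure]_(t in Iset)
        ((cabs (f t)) ^+ 2 * weight t)%:E < +oo)%E]].

Definition L2inner {R : realType} (f g : R -> R[i]) : R[i] :=
  cint Iset (fun t => conjc (f t) * g t * (weight t)%:C).

Definition chebT {R : realType} (k : nat) (t : R) : R := cos (k%:R * acos t).

Definition That {R : realType} (k : nat) (t : R) : R[i] :=
  (Num.sqrt ((if k == 0%N then 1 else 2) / pi) * chebT k t)%:C.

Definition coefT {R : realType} (f : R -> R[i]) (k : nat) : R[i] :=
  L2inner (That k) f.

(* Each class in H^1 is represented by its continuous representative, which is
   the one to which point evaluations apply. *)
Definition H1 {R : realType} : set (R -> R[i]) :=
  [set f | [/\ CI f, L2w f &
     cvgn (series (fun k => k.+1%:R ^+ 2 * (cabs (coefT f k)) ^+ 2 : R))]].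

Definition H1inner {R : realType} (f g : R -> R[i]) : R[i] :=
  limn (series (fun k => k.+1%:R ^+ 2 * (conjc (coefT f k) * coefT g k))
        : nat -> R[i]^o).

Definition H1norm {R : realType} (f : R -> R[i]) : R :=
  Num.sqrt (complex.Re (H1inner f f)).

Definition Ttilde {R : realType} (k : nat) (t : R) : R[i] :=
  (k.+1%:R)^-1 * That k t.

Definition l2 {R : realType} : set (nat -> R[i]) :=
  [set c | cvgn (series (fun k => (cabs (c k)) ^+ 2 : R))].

Definition l2norm {R : realType} (c : nat -> R[i]) : R :=
  Num.sqrt (limn (series (fun k => (cabs (c k)) ^+ 2 : R))).

(* norm of an operator from (X, nX) to (Y, nY), where the space X is the
   subset D of the type TX; a genuine supremum for bounded operators *)
Definition opnorm {R : realType} {TX TY : Type} (D : set TX)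
    (nX : TX -> R) (nY : TY -> R) (T : TX -> TY) : R :=
  sup [set nY (T x) | x in [set x | D x /\ nX x <= 1]].

Definition H1opnorm {R : realType} (T : (R -> R[i]) -> (R -> R[i])) : R :=
  opnorm H1 H1norm H1norm T.

(* limit of a sequence in H^1, for the H^1 norm *)
Definition H1lim {R : realType} (u : nat -> (R -> R[i])) : R -> R[i] :=
  xget (fun=> 0) [set g | H1 g /\
    H1norm (fun t => u n t - g t) @[n --> \oo] --> (0 : R)].

Definition polfun {R : realType} (p : {poly R[i]}) (t : R) : R[i] := p.[t%:C].

(* P_N as a set of polynomials: size is degree + 1 *)
Definition polyN {R : realType} (N : nat) : set {poly R[i]} :=
  [set p | (size p <= N.+1)%N].

Definition node {R : realType} (N : nat) (j : nat) : R :=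
  cos (pi * j%:R / N%:R).

Definition EN {R : realType} (N : nat) (p : {poly R[i]}) : 'cV[R[i]]_N.+1 :=
  \col_j polfun p (node N j).

(* inverse of EN restricted to polyN (interpolation at the nodes) *)
Definition PN {R : realType} (N : nat) (w : 'cV[R[i]]_N.+1) : {poly R[i]} :=
  xget 0 [set p | polyN N p /\ EN N p = w].

Definition DN {R : realType} (N : nat) : 'M[R[i]]_N.+1 :=
  \matrix_(i, j) EN N (deriv (PN (delta_mx j 0 : 'cV[R[i]]_N.+1))) i 0.

Definition DNhat {R : realType} (N : nat) : 'M[R[i]]_N.+1 :=
  \matrix_(i, j) (if i == ord_max then (j == ord_max)%:R else DN N i j).

Definition Mahat {R : realType} (N : nat) (a : R[i] -> R[i]) :
  'M[R[i]]_N.+1 :=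
  \matrix_(i, j)
    (if (i == j) && (i != ord_max) then a (node N i)%:C else 0).

Definition Mbhat {R : realType} (N : nat) (b : R[i] -> R[i]) :
  'M[R[i]]_N.+1 :=
  \matrix_(i, j) (if i == ord_max then (j == ord0)%:R
                  else if i == j then b (node N i)%:C else 0).

(* meaningful when DNhat N - Mahat N a is invertible *)
Definition UN {R : realType} (N : nat) (a b : R[i] -> R[i]) :
  'M[R[i]]_N.+1 := invmx (DNhat N - Mahat N a) *m Mbhat N b.

(* the p in P_N such that f - p is orthogonal to P_N *)
Definition PiN {R : realType} (N : nat) (f : R -> R[i]) : {poly R[i]} :=
  xget 0 [set p | polyN N p /\ forall q, polyN N q ->
    H1inner (polfun q) (fun t => f t - polfun p t) = 0].

Definition UNhat {R : realType} (N : nat) (a b : R[i] -> R[i])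
    (f : R -> R[i]) : R -> R[i] :=
  polfun (PN (UN N a b *m EN N (PiN N f))).

(* sequences in l^2 are indexed from 0, so c k stands for a_{k+1} and
   multiplies p_{k+1} if k <= N and Ttilde k if k > N *)
Definition Vhat {R : realType} (N : nat) (V : 'M[R[i]]_N.+1)
    (c : nat -> R[i]) : R -> R[i] :=
  H1lim (fun n t => \sum_(k < N.+1) c k * polfun (PN (col k V)) t
                    + \sum_(N.+1 <= k < n) c k * Ttilde k t).

Definition Vhat_inv {R : realType} (N : nat) (V : 'M[R[i]]_N.+1)
    (f : R -> R[i]) : nat -> R[i] :=
  xget (fun=> 0) [set c | l2 c /\ eqI (Vhat V c) f].

Definition condVhat {R : realType} (N : nat) (V : 'M[R[i]]_N.+1) : R :=
  opnorm l2 l2norm H1norm (Vhat V) * opnorm H1 H1norm l2norm (Vhat_inv V).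

Definition eps {R : realType} (eta AE BE delta : R) (k : nat) : R :=
  (8 * (sinh eta)^-1 * expR (AE + BE / delta)) * k%:R * expR (- (k%:R * eta)).

Definition xi {R : realType} (nu : nat -> R) (k : nat) : R :=
  Num.sqrt (\sum_(j < k.+1) nu j ^+ 2).

Definition omega {R : realType} (N : nat) (a b : R[i] -> R[i])
    (V : 'M[R[i]]_N.+1) (lam1 : R[i]) (eta AE BE delta : R) (nu : nat -> R)
    (k : nat) : R :=
  eps eta AE BE delta k
    * (H1opnorm (monodromy a b) + cabs lam1 * condVhat V)
  + (1 + eps eta AE BE delta k) * xi nu k.

(* Main.v *)
Require Import Defs.
From HB Require Import structures.
From mathcomp Require Import all_boot all_order all_algebra.
From mathcomp Require Import all_classical all_reals all_analysis.
From mathcomp Require Import measurable_realfun complex ring lra.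

Set Implicit Arguments.
Unset Strict Implicit.
Unset Printing Implicit Defensive.

Import Order.TTheory GRing.Theory Num.Theory numFieldNormedType.Exports.

Local Open Scope classical_set_scope.
Local Open Scope complex_scope.
Local Open Scope ring_scope.

(** An eigenfunction [x] of the monodromy operator [U] for the eigenvalue [mu]
    solves [mu x' = (mu a + b) x]; hence it is [x (-1) exp (A + B / mu)] with [A]
    and [B] the primitives of [a] and [b] that vanish at -1
    ([eigenfunction_exp]), and it extends analytically to the ellipse, where it
    is bounded by [|x (-1)| exp (AE + BE / delta)]. After [t = cos th] its
    Chebyshev coefficients are Fourier coefficients of a function analytic in a
    strip of height [eta], and moving the contour to the edge of the strip makes
    the [j]-th one decay like [exp (- j eta)] ([coef_decay]). As [|x (-1)|] is
    controlled by the H1 norm of [x] ([H1_sup]), the part of [x] of degree larger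
    than [k] is at most [eps k] times the part [x_k] of degree at most [k], as
    soon as [eps k < 1] ([eigen_tail], [pythagoras_absorb]).

    Let [P] be the projection of [x] on the polynomials of degree at most [N].
    The discretised operator [UNhat] sees only [P] and has values in these
    polynomials, so [UNhat P - mu P] is the truncation of [UNhat x - U x]
    ([residual]). The latter is small: on [x_k] by the hypotheses on the basis
    functions and the Cauchy-Schwarz inequality ([lin_op_CS]), on [x - x_k] by
    the norms of the two operators. In the other direction [UNhat] is diagonal
    in the basis of the columns of [V], so that the distance from [mu] to the
    closest eigenvalue, times the norm of [P], is at most [condVhat V] times the
    norm of [UNhat P - mu P] ([gap_polynomial]), as in the Bauer-Fike theorem.
    Since the norm of [P] is at least that of [x_k], the two estimates give the
    bound [omega k * condVhat V] ([main_case]). If [1 <= eps k] that bound is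
    larger than [|mu| + |lam_1|] and there is nothing to prove ([small_case]).

    The rest is the analysis behind these steps. The space H1 is handled through
    the coordinates [kap] in the basis [Ttilde], which identify it with l2
    ([H1P], [H1normE], [H1_synth]); that they determine the function is the
    completeness of the Chebyshev polynomials ([cheb_complete]). An operator norm
    is a supremum, which says something only about a bounded operator
    ([opnorm_bound]); so boundedness on H1 is established for [U], which maps
    continuous functions to continuously differentiable ones ([monodromy_H1]),
    and for [Vhat V] and its inverse, which differ from the identity on finitely
    many coordinates only ([Vhat_bounded], [Vhat_inv_bounded]). Finally,
    holomorphy is used in the form of a local bound on second divided
    differences ([hol]): this property passes to sums, products, composites and
    integrals depending on a parameter, and it gives at once that the mean of a
    periodic function over a vertical period is independent of the abscissa
    ([mean_shift]). *)

(** * The modulus and the topology of the complex numbers *)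

Section complex_basics.
Context {R : realType}.
Implicit Types z w : R[i].

Lemma normE z : `|z| = (cabs z)%:C. Proof. by []. Qed.

Lemma cabs_ge0 z : 0 <= cabs z.
Proof. by case: z => a b; exact: sqrtr_ge0. Qed.

Lemma cabsM z w : cabs (z * w) = cabs z * cabs w.
Proof. exact: Normc.normcM. Qed.

Lemma cabsV z : cabs z^-1 = (cabs z)^-1.
Proof. exact: Normc.normcV. Qed.

Lemma cabs0 : cabs (0 : R[i]) = 0.
Proof. exact: Normc.normc0. Qed.

Lemma cabs1 : cabs (1 : R[i]) = 1.
Proof. exact: Normc.normc1. Qed.

Lemma cabs0_eq0 z : cabs z = 0 -> z = 0.
Proof. exact: Normc.eq0_normc. Qed.

Lemma cabs_gt0 z : z != 0 -> 0 < cabs z.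
Proof.
move=> z0; rewrite lt_def cabs_ge0 andbT; apply: contra z0 => /eqP/cabs0_eq0 ->.
by [].
Qed.

Lemma cabsD z w : cabs (z + w) <= cabs z + cabs w.
Proof. by rewrite -lecR [X in _ <= X]rmorphD /= -!normE ler_normD. Qed.

Lemma cabsN z : cabs (- z) = cabs z.
Proof. by case: z => a b; rewrite /cabs /= !sqrrN. Qed.

Lemma cabsB z w : cabs (z - w) = cabs (w - z).
Proof. by rewrite -cabsN opprB. Qed.

Lemma cabs_sub z w : cabs (z - w) <= cabs z + cabs w.
Proof. by rewrite (le_trans (cabsD _ _))// cabsN. Qed.

Lemma cabs_dist z w t : cabs (z - t) <= cabs (z - w) + cabs (w - t).
Proof. by apply: le_trans (cabsD _ _); rewrite addrA subrK. Qed.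

Lemma cabs_le_dist z w : cabs z <= cabs w + cabs (z - w).
Proof. by apply: le_trans (cabsD _ _); rewrite addrC subrK. Qed.

Lemma cabsX z n : cabs (z ^+ n) = cabs z ^+ n.
Proof. by elim: n => [|n IH]; rewrite ?expr0 ?cabs1// !exprS cabsM IH. Qed.

Lemma cabs_real (x : R) : cabs x%:C = `|x|.
Proof. by rewrite /cabs /= expr0n addr0 sqrtr_sqr. Qed.

Lemma cabs_nat (n : nat) : cabs (n%:R : R[i]) = n%:R.
Proof. by rewrite -(rmorph_nat (real_complex R)) cabs_real ger0_norm. Qed.

Lemma cabs_sqr z : cabs z ^+ 2 = complex.Re z ^+ 2 + complex.Im z ^+ 2.
Proof. by case: z => a b; rewrite /cabs/= sqr_sqrtr// addr_ge0// sqr_ge0. Qed.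

Lemma Re_le_cabs z : `|complex.Re z| <= cabs z.
Proof.
by case: z => a b /=; rewrite -sqrtr_sqr ler_wsqrtr// lerDl sqr_ge0.
Qed.

Lemma Im_le_cabs z : `|complex.Im z| <= cabs z.
Proof.
by case: z => a b /=; rewrite -sqrtr_sqr ler_wsqrtr// lerDr sqr_ge0.
Qed.

Lemma cabs_le_ReIm z : cabs z <= `|complex.Re z| + `|complex.Im z|.
Proof.
have -> : z = (complex.Re z)%:C + 'i * (complex.Im z)%:C by exact: complexE.
apply: le_trans (cabsD _ _) _; rewrite cabsM !cabs_real /=.
rewrite /cabs /= expr0n expr1n add0r sqrtr1 mul1r.
by rewrite !(mul0r, mul1r, mulr0, subr0, addr0, add0r).
Qed.

Lemma cabs_sum (I : Type) (r : seq I) (P : pred I) (F : I -> R[i]) :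
  cabs (\sum_(i <- r | P i) F i) <= \sum_(i <- r | P i) cabs (F i).
Proof.
apply: (big_ind2 (fun x y => cabs x <= y)) => // [|x1 x2 y1 y2 h1 h2].
  by rewrite cabs0.
by rewrite (le_trans (cabsD _ _))// lerD.
Qed.

Lemma ReD z w : complex.Re (z + w) = complex.Re z + complex.Re w.
Proof. by case: z; case: w. Qed.
Lemma ImD z w : complex.Im (z + w) = complex.Im z + complex.Im w.
Proof. by case: z; case: w. Qed.
Lemma ReN z : complex.Re (- z) = - complex.Re z. Proof. by case: z. Qed.
Lemma ImN z : complex.Im (- z) = - complex.Im z. Proof. by case: z. Qed.
Lemma ReB z w : complex.Re (z - w) = complex.Re z - complex.Re w.
Proof. by rewrite ReD ReN. Qed.
Lemma ImB z w : complex.Im (z - w) = complex.Im z - complex.Im w.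
Proof. by rewrite ImD ImN. Qed.
Lemma ReM z w : complex.Re (z * w) =
  complex.Re z * complex.Re w - complex.Im z * complex.Im w.
Proof. by case: z; case: w. Qed.
Lemma ImM z w : complex.Im (z * w) =
  complex.Re z * complex.Im w + complex.Im z * complex.Re w.
Proof. by case: z; case: w. Qed.
Lemma ReZ (x : R) w : complex.Re (x%:C * w) = x * complex.Re w.
Proof. by rewrite ReM /= mul0r subr0. Qed.
Lemma ImZ (x : R) w : complex.Im (x%:C * w) = x * complex.Im w.
Proof. by rewrite ImM /= mul0r addr0. Qed.

Lemma complex_ext z w :
  complex.Re z = complex.Re w -> complex.Im z = complex.Im w -> z = w.
Proof. by case: z => a b; case: w => c d /= -> ->. Qed.

Lemma Re_sum (I : Type) (r : seq I) (P : pred I) (F : I -> R[i]) :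
  complex.Re (\sum_(i <- r | P i) F i) = \sum_(i <- r | P i) complex.Re (F i).
Proof. by apply: (big_morph _ ReD). Qed.

Lemma Im_sum (I : Type) (r : seq I) (P : pred I) (F : I -> R[i]) :
  complex.Im (\sum_(i <- r | P i) F i) = \sum_(i <- r | P i) complex.Im (F i).
Proof. by apply: (big_morph _ ImD). Qed.

(** Neighbourhoods of [R[i]^o] are given by balls whose radius is a positive
    element of [R[i]], that is, a positive real; this is what lets limits be
    read on the real-valued modulus. *)
Lemma cvg_cabsP (T : Type) (F : set_system T) (FF : Filter F)
    (u : T -> R[i]^o) (l : R[i]) :
  u @ F --> (l : R[i]^o) <-> cabs (u x - l) @[x --> F] --> (0 : R).
Proof.
split=> h.
  apply/cvgrPdist_lt => e e0.
  have e0' : 0 < (e%:C : R[i]) by rewrite ltcR.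
  move/cvgrPdist_lt : h => /(_ _ e0'); apply: filterS => x.
  by rewrite normE ltcR cabsB sub0r normrN ger0_norm ?cabs_ge0.
apply/cvgrPdist_lt => e; case: e => er ei.
rewrite ltcE /= => /andP[/eqP -> e0].
move/cvgrPdist_lt : h => /(_ _ e0); apply: filterS => x.
by rewrite sub0r normrN ger0_norm ?cabs_ge0// cabsB normE ltcR.
Qed.

Lemma cvg_ReImP (T : Type) (F : set_system T) (FF : Filter F)
    (u : T -> R[i]^o) (l : R[i]) :
  u @ F --> (l : R[i]^o) <->
  (complex.Re (u x) @[x --> F] --> complex.Re l /\
   complex.Im (u x) @[x --> F] --> complex.Im l).
Proof.
rewrite cvg_cabsP; split=> [h|[h1 h2]].
  split; apply/cvgrPdist_lt => e e0; move/cvgrPdist_lt : h => /(_ _ e0);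
    apply: filterS => x; rewrite sub0r normrN ger0_norm ?cabs_ge0//;
    apply: le_lt_trans; rewrite distrC -?ReB -?ImB.
    exact: Re_le_cabs.
  exact: Im_le_cabs.
have h3 : `|complex.Re (u x - l)| + `|complex.Im (u x - l)| @[x --> F] --> (0 : R).
  rewrite -[X in _ --> X](addr0 0); apply: cvgD; rewrite -[X in _ --> X](normr0 R);
    apply: cvg_norm.
    under eq_fun do rewrite ReB; rewrite -(subrr (complex.Re l)).
    by apply: cvgB => //; exact: cvg_cst.
  under eq_fun do rewrite ImB; rewrite -(subrr (complex.Im l)).
  by apply: cvgB => //; exact: cvg_cst.
apply: (squeeze_cvgr _ (cvg_cst 0) h3).
by apply: nearW => x; rewrite cabs_ge0 cabs_le_ReIm.
Qed.

Lemma within_cont_ReIm (A : set R) (f : R -> R[i]) :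
  {within A, continuous (f : R -> R[i]^o)} <->
  ({within A, continuous (fun t => complex.Re (f t))} /\
   {within A, continuous (fun t => complex.Im (f t))}).
Proof.
split=> [h|[h1 h2] x].
  by split=> x; have /cvg_ReImP[] := h x.
by apply/cvg_ReImP; split; [exact: h1|exact: h2].
Qed.

End complex_basics.

(** * Integrals of continuous functions *)

Section real_integral.
Context {R : realType}.
Local Notation mu := (@lebesgue_measure R).
Implicit Types (f g F : R -> R) (a b : R).

Lemma cont_integrable f a b : continuous f ->
  mu.-integrable `[a, b] (EFin \o f).
Proof.
move=> cf; apply: continuous_compact_integrable; first exact: segment_compact.
exact: continuous_subspaceT.
Qed.

Lemma cont_RintD f g a b : continuous f -> continuous g ->
  \int[mu]_(x in `[a, b]) (f x + g x) =
  \int[mu]_(x in `[a, b]) f x + \int[mu]_(x in `[a, b]) g x.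
Proof. by move=> cf cg; rewrite RintegralD//; exact: cont_integrable. Qed.

Lemma cont_RintB f g a b : continuous f -> continuous g ->
  \int[mu]_(x in `[a, b]) (f x - g x) =
  \int[mu]_(x in `[a, b]) f x - \int[mu]_(x in `[a, b]) g x.
Proof. by move=> cf cg; rewrite RintegralB//; exact: cont_integrable. Qed.

Lemma cont_RintZ f (r : R) a b : continuous f ->
  \int[mu]_(x in `[a, b]) (r * f x) = r * \int[mu]_(x in `[a, b]) f x.
Proof. by move=> cf; rewrite RintegralZl//; exact: cont_integrable. Qed.

Lemma cont_Rint_le f g a b : continuous f -> continuous g ->
  (forall x, a <= x <= b -> f x <= g x) ->
  \int[mu]_(x in `[a, b]) f x <= \int[mu]_(x in `[a, b]) g x.
Proof.
move=> cf cg fg; apply: le_Rintegral; try exact: cont_integrable; first exact: measurable_itv.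
by move=> x /=; rewrite in_itv/=; exact: fg.
Qed.

Lemma Rint_cst (r : R) a b : a <= b -> \int[mu]_(x in `[a, b]) r = r * (b - a).
Proof.
move=> ab; rewrite Rintegral_cst//= lebesgue_measure_itv/= lte_fin.
case: ifPn => [//|]; rewrite -leNgt => ba.
by rewrite (_ : b = a) ?subrr//; apply/eqP; rewrite eq_le ab ba.
Qed.

Lemma eq_Rint f g a b : (forall x, a <= x <= b -> f x = g x) ->
  \int[mu]_(x in `[a, b]) f x = \int[mu]_(x in `[a, b]) g x.
Proof.
by move=> fg; apply: eq_Rintegral => x; rewrite inE/= in_itv/=; exact: fg.
Qed.

Lemma cont_sum (I : Type) (r : seq I) (P : pred I) (f : I -> R -> R) :
  (forall i, continuous (f i)) ->
  continuous (fun x => \sum_(i <- r | P i) f i x).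
Proof.
move=> cf; elim: r => [|i r IH] x.
  by under eq_fun do rewrite big_nil; exact: cvg_cst.
under eq_fun do rewrite big_cons.
by case: (P i); [apply: cvgD; [exact: cf|exact: IH]|exact: IH].
Qed.

Lemma cont_Rint_sum (I : Type) (r : seq I) (P : pred I) (f : I -> R -> R) a b :
  (forall i, continuous (f i)) ->
  \int[mu]_(x in `[a, b]) (\sum_(i <- r | P i) f i x) =
  \sum_(i <- r | P i) \int[mu]_(x in `[a, b]) f i x.
Proof.
move=> cf; elim: r => [|i r IH].
  under eq_Rint do rewrite big_nil.
  by rewrite big_nil Rintegral_cst// mul0r.
under eq_Rint do rewrite big_cons.
rewrite big_cons; case: (P i) => //.
rewrite cont_RintD ?IH//.
exact: cont_sum.
Qed.

Lemma is_derive_cont f (df : R -> R) :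
  (forall x, is_derive (x : R) (1 : R) f (df x)) -> continuous f.
Proof.
by move=> h x; apply/differentiable_continuous/derivable1_diffP; case: (h x).
Qed.

(** The second fundamental theorem, with differentiability asked only in the
    interior: the integrands below come from functions on a closed interval. *)
Lemma Rint_FTC2 F f a b : a <= b ->
  {within `[a, b], continuous F} -> {within `[a, b], continuous f} ->
  (forall x, a < x < b -> is_derive (x : R) (1 : R) F (f x)) ->
  \int[mu]_(x in `[a, b]) f x = F b - F a.
Proof.
rewrite le_eqVlt => /predU1P[<- _ _ _|ab cF cf dF].
  by rewrite set_itv1 Rintegral_set1 subrr.
rewrite /Rintegral (@continuous_FTC2 _ f F)//.
- split; last 2 first.
  - by case/(continuous_within_itvP _ ab): cF.
  - by case/(continuous_within_itvP _ ab): cF.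
  by move=> x; rewrite in_itv/= => /dF[].
- by move=> x; rewrite in_itv/= => /dF dFx; rewrite derive1E; apply: derive_val.
Qed.

Lemma Rint_FTC2T F f a b : a <= b -> continuous f ->
  (forall x, is_derive (x : R) (1 : R) F (f x)) ->
  \int[mu]_(x in `[a, b]) f x = F b - F a.
Proof.
move=> ab cf dF; apply: Rint_FTC2; [by []| |].
  by apply: continuous_subspaceT; exact: is_derive_cont dF.
exact: continuous_subspaceT.
Qed.

Lemma Rint_derive f a x : continuous f -> a < x ->
  is_derive x 1 (fun y => \int[mu]_(t in `[a, y]) f t) (f x).
Proof.
move=> cf ax.
have [] := @continuous_FTC1_closed R f a x (x + 1) (ltac:(by rewrite ltrDl))
   (cont_integrable _ _ cf) ax (cf x).
by move=> d e; apply: DeriveDef; [exact: d|rewrite -derive1E; exact: e].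
Qed.

Lemma cont_Rint_cont f a b : a <= b -> continuous f ->
  {within `[a, b], continuous (fun y => \int[mu]_(t in `[a, y]) f t)}.
Proof.
by move=> ab cf; apply: parameterized_integral_continuous => //;
  exact: cont_integrable.
Qed.

End real_integral.

Section complex_integral.
Context {R : realType}.
Local Notation mu := (@lebesgue_measure R).
Implicit Types (f g F : R -> R[i]) (a b : R).

Lemma ccontP f : continuous (f : R -> R[i]^o) <->
  (continuous (fun t => complex.Re (f t)) /\
   continuous (fun t => complex.Im (f t))).
Proof.
split=> [h|[h1 h2] x].
  by split=> x; have /cvg_ReImP[] := h x.
by apply/cvg_ReImP; split; [exact: h1|exact: h2].
Qed.

Lemma eq_cint f g a b : (forall x, a <= x <= b -> f x = g x) ->
  cint `[a, b] f = cint `[a, b] g.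
Proof. by move=> fg; congr (_ +i* _); apply: eq_Rint => x /fg ->. Qed.

Lemma ccontD f g : continuous (f : R -> R[i]^o) -> continuous (g : R -> R[i]^o) ->
  continuous ((fun t => f t + g t) : R -> R[i]^o).
Proof. by move=> cf cg x; exact: cvgD (cf x) (cg x). Qed.

Lemma ccontB f g : continuous (f : R -> R[i]^o) -> continuous (g : R -> R[i]^o) ->
  continuous ((fun t => f t - g t) : R -> R[i]^o).
Proof. by move=> cf cg x; exact: cvgB (cf x) (cg x). Qed.

Lemma ccontM f g : continuous (f : R -> R[i]^o) -> continuous (g : R -> R[i]^o) ->
  continuous ((fun t => f t * g t) : R -> R[i]^o).
Proof.
move=> /ccontP[f1 f2] /ccontP[g1 g2]; apply/ccontP; split=> x.
  under eq_fun do rewrite ReM.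
  apply: cvgB; apply: cvgM; by [exact: f1|exact: g1|exact: f2|exact: g2].
under eq_fun do rewrite ImM.
apply: cvgD; apply: cvgM; by [exact: f1|exact: g1|exact: f2|exact: g2].
Qed.

Lemma ccont_cst {c : R[i]} : continuous ((fun=> c) : R -> R[i]^o).
Proof. by move=> x; exact: cvg_cst. Qed.

Lemma ccont_real (u : R -> R) : continuous u ->
  continuous ((fun t => (u t)%:C) : R -> R[i]^o).
Proof. by move=> cu; apply/ccontP; split => //= x; exact: cvg_cst. Qed.

Lemma cont_cintD f g a b :
  continuous (f : R -> R[i]^o) -> continuous (g : R -> R[i]^o) ->
  cint `[a, b] (fun t => f t + g t) = cint `[a, b] f + cint `[a, b] g.
Proof.
move=> /ccontP[f1 f2] /ccontP[g1 g2]; rewrite /cint.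
apply: complex_ext => /=.
  by under eq_Rint do rewrite ReD; rewrite cont_RintD.
by under eq_Rint do rewrite ImD; rewrite cont_RintD.
Qed.

Lemma cont_Z (c : R) (u : R -> R) : continuous u ->
  continuous (fun t => c * u t).
Proof. by move=> cu x; apply: cvgM; [exact: cvg_cst|exact: cu]. Qed.

Lemma cont_cintZ f (c : R[i]) a b : continuous (f : R -> R[i]^o) ->
  cint `[a, b] (fun t => c * f t) = c * cint `[a, b] f.
Proof.
move=> /ccontP[f1 f2]; rewrite /cint.
apply: complex_ext; rewrite /= ?ReM ?ImM /=.
  under eq_Rint do rewrite ReM.
  by rewrite cont_RintB ?cont_RintZ//; exact: cont_Z.
under eq_Rint do rewrite ImM.
by rewrite cont_RintD ?cont_RintZ//; exact: cont_Z.
Qed.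

Lemma cont_cintB f g a b :
  continuous (f : R -> R[i]^o) -> continuous (g : R -> R[i]^o) ->
  cint `[a, b] (fun t => f t - g t) = cint `[a, b] f - cint `[a, b] g.
Proof.
move=> cf cg.
under eq_cint do rewrite -mulN1r.
rewrite (cont_cintD _ _ cf (ccontM (ccont_cst (c := -1)) cg)) (cont_cintZ _ _ _ cg).
by rewrite mulN1r.
Qed.

Lemma cont_cint_cst (c : R[i]) a b : a <= b ->
  cint `[a, b] (fun=> c) = (b - a)%:C * c.
Proof.
by move=> ab; apply: complex_ext; rewrite ?ReZ ?ImZ /= Rint_cst// mulrC.
Qed.

(** The usual rotation argument: the square of the modulus of the integral is
    the integral of the real part of [f] times the conjugate of the integral. *)
Lemma cont_cint_abs f (M : R) a b : a <= b -> continuous (f : R -> R[i]^o) ->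
  (forall x, a <= x <= b -> cabs (f x) <= M) ->
  cabs (cint `[a, b] f) <= M * (b - a).
Proof.
move=> ab cf fM; set I := cint `[a, b] f.
have [I0|I0] := eqVneq I 0.
  rewrite I0 cabs0 mulr_ge0 ?subr_ge0//.
  by apply: le_trans (fM a _); rewrite ?cabs_ge0// lexx.
have cI := cabs_gt0 I0; rewrite -(ler_pM2l cI) -expr2.
have -> : cabs I ^+ 2 = complex.Re (cint `[a, b] (fun t => conjc I * f t)).
  by rewrite cont_cintZ// -/I cabs_sqr; case: (I) => x y /=; ring.
rewrite /= mulrA -Rint_cst//; apply: cont_Rint_le => //.
- have /ccontP[] := ccontM (ccont_cst (c := conjc I)) cf.
  by [].
- by move=> x; exact: cvg_cst.
move=> x hx; apply: le_trans (ler_norm _) _; apply: le_trans (Re_le_cabs _) _.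
rewrite cabsM (_ : cabs (conjc I) = cabs I); last first.
  by case: (I) => u v; rewrite /cabs /= sqrrN.
by rewrite ler_wpM2l ?cabs_ge0// fM.
Qed.

Definition cderiv (F f : R -> R[i]) (x : R) : Prop :=
  is_derive x (1 : R) (fun t => complex.Re (F t)) (complex.Re (f x)) /\
  is_derive x (1 : R) (fun t => complex.Im (F t)) (complex.Im (f x)).

Lemma cint_FTC2 F f a b : a <= b -> continuous (f : R -> R[i]^o) ->
  (forall x, a <= x <= b -> cderiv F f x) -> cint `[a, b] f = F b - F a.
Proof.
move=> ab cf dF; have /ccontP[c1 c2] := cf.
have cF (u v : R -> R) : (forall x, a <= x <= b -> is_derive x (1 : R) u (v x)) ->
    {within `[a, b], continuous u}.
  move=> du; apply: continuous_in_subspaceT => x; rewrite inE/= in_itv/= => hx.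
  have [d _] := du x hx; exact/differentiable_continuous/derivable1_diffP.
have d1 x : a <= x <= b -> is_derive x (1 : R) (fun t => complex.Re (F t)) (complex.Re (f x)).
  by case/dF.
have d2 x : a <= x <= b -> is_derive x (1 : R) (fun t => complex.Im (F t)) (complex.Im (f x)).
  by case/dF.
have e1 : \int[lebesgue_measure]_(t in `[a, b]) complex.Re (f t) =
    complex.Re (F b) - complex.Re (F a).
  apply: (@Rint_FTC2 _ (fun t => complex.Re (F t)) (fun t => complex.Re (f t)) _ _ ab).
  - exact: (cF _ _ d1).
  - exact: continuous_subspaceT c1.
  - by move=> x /andP[x1 x2]; apply: d1; rewrite !ltW.
have e2 : \int[lebesgue_measure]_(t in `[a, b]) complex.Im (f t) =
    complex.Im (F b) - complex.Im (F a).
  apply: (@Rint_FTC2 _ (fun t => complex.Im (F t)) (fun t => complex.Im (f t)) _ _ ab).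
  - exact: (cF _ _ d2).
  - exact: continuous_subspaceT c2.
  - by move=> x /andP[x1 x2]; apply: d2; rewrite !ltW.
by apply: complex_ext; rewrite ?ReB ?ImB.
Qed.

Lemma cint_deriv f a x : continuous (f : R -> R[i]^o) -> a < x ->
  cderiv (fun y => cint `[a, y] f) f x.
Proof. by move=> /ccontP[f1 f2] ax; split; exact: Rint_derive. Qed.

Lemma cderivM F f G g x : cderiv F f x -> cderiv G g x ->
  cderiv (fun t => F t * G t) (fun t => f t * G t + F t * g t) x.
Proof.
move=> [F1 F2] [G1 G2]; split.
  under eq_fun do rewrite ReM.
  have h := is_deriveB (is_deriveM F1 G1) (is_deriveM F2 G2).
  apply: is_derive_eq; rewrite !ReD !ReM /GRing.scale /=; ring.
under eq_fun do rewrite ImM.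
have h := is_deriveD (is_deriveM F1 G2) (is_deriveM F2 G1).
apply: is_derive_eq; rewrite !ImD !ImM /GRing.scale /=; ring.
Qed.

Lemma cderivD F f G g x : cderiv F f x -> cderiv G g x ->
  cderiv (fun t => F t + G t) (fun t => f t + g t) x.
Proof.
move=> [F1 F2] [G1 G2]; split.
  under eq_fun do rewrite ReD.
  by have h := is_deriveD F1 G1; apply: is_derive_eq; rewrite ReD.
under eq_fun do rewrite ImD.
by have h := is_deriveD F2 G2; apply: is_derive_eq; rewrite ImD.
Qed.

Lemma cderiv_cst (c : R[i]) x : cderiv (fun=> c) (fun=> 0) x.
Proof. by split; exact: is_derive_cst. Qed.

Lemma cderiv_eq F f g x : cderiv F f x -> f x = g x -> cderiv F g x.
Proof. by rewrite /cderiv => h <-. Qed.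

Lemma cderivZ (c : R[i]) F f x : cderiv F f x ->
  cderiv (fun t => c * F t) (fun t => c * f t) x.
Proof.
move=> dF; have h := cderivM (cderiv_cst c x) dF.
by apply: cderiv_eq h _; rewrite mul0r add0r.
Qed.

Lemma cexpD (z w : R[i]) : cexp (z + w) = cexp z * cexp w.
Proof.
rewrite /cexp; apply: complex_ext; rewrite !(ReM, ImM, ReD, ImD) /=.
  by rewrite expRD cosD; ring.
by rewrite expRD sinD; ring.
Qed.

Lemma cexp0 : cexp (0 : R[i]) = 1.
Proof. by rewrite /cexp /= expR0 cos0 sin0 mul1r. Qed.

Lemma cexpNK (z : R[i]) : cexp z * cexp (- z) = 1.
Proof. by rewrite -cexpD subrr cexp0. Qed.

Lemma cexp_neq0 (z : R[i]) : cexp z != 0.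
Proof.
by apply/eqP => h; have /eqP := cexpNK z; rewrite h mul0r eq_sym oner_eq0.
Qed.

Lemma cexpN (z : R[i]) : cexp (- z) = (cexp z)^-1.
Proof.
by apply: (mulfI (cexp_neq0 z)); rewrite cexpNK mulfV// cexp_neq0.
Qed.

Lemma cabs_cexp (z : R[i]) : cabs (cexp z) = expR (complex.Re z).
Proof.
rewrite /cexp cabsM cabs_real ger0_norm ?expR_ge0//.
by rewrite /cabs/= cos2Dsin2 sqrtr1 mulr1.
Qed.

Lemma cexpE (z : R[i]) : cexp z =
  (expR (complex.Re z) * cos (complex.Im z)) +i*
  (expR (complex.Re z) * sin (complex.Im z)).
Proof. by apply: complex_ext; rewrite /cexp ?ReZ ?ImZ. Qed.

Lemma cderiv_cexp F f x : cderiv F f x ->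
  cderiv (fun t => cexp (F t)) (fun t => f t * cexp (F t)) x.
Proof.
move=> [F1 F2].
have e1 := is_derive1_comp (is_derive_expR (complex.Re (F x))) F1.
have c1 := is_derive1_comp (is_derive_cos (complex.Im (F x))) F2.
have s1 := is_derive1_comp (is_derive_sin (complex.Im (F x))) F2.
split.
  under eq_fun do rewrite cexpE/=.
  have h := is_deriveM e1 c1.
  apply: is_derive_eq; rewrite cexpE ReM /= /GRing.scale /=; ring.
under eq_fun do rewrite cexpE/=.
have h := is_deriveM e1 s1.
apply: is_derive_eq; rewrite cexpE ImM /= /GRing.scale /=; ring.
Qed.

Lemma ccont_cexp F : continuous (F : R -> R[i]^o) ->
  continuous ((fun t => cexp (F t)) : R -> R[i]^o).
Proof.
move=> /ccontP[h1 h2]; apply/ccontP; split => x.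
  under eq_fun do rewrite cexpE/=.
  apply: cvgM.
    exact: (continuous_comp (h1 x) (@continuous_expR R _)).
  exact: (continuous_comp (h2 x) (@continuous_cos R _)).
under eq_fun do rewrite cexpE/=.
apply: cvgM.
  exact: (continuous_comp (h1 x) (@continuous_expR R _)).
exact: (continuous_comp (h2 x) (@continuous_sin R _)).
Qed.

End complex_integral.

(** * Chebyshev coefficients as cosine coefficients *)

Section substitution.
Context {R : realType}.
Local Notation mu := (@lebesgue_measure R).
Implicit Types (u : R -> R).

Lemma Iset_cos (x : R) : Iset (cos x).
Proof. by rewrite /Iset/= in_itv/= cos_geN1 cos_le1. Qed.

Lemma within_comp (T : topologicalType) (u : R -> T) (phi : R -> R) :
  continuous phi -> (forall x, Iset (phi x)) ->
  {within Iset, continuous u} -> continuous (u \o phi).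
Proof.
move=> cphi Iphi cu x; have h := cu (phi x).
apply: cvg_trans h => /= A; rewrite /nbhs/=.
rewrite -(nbhs_subspace_in (Iphi x)) => hA.
have h2 : \forall y \near x, Iset (phi y) -> A (u (phi y)) := cphi x _ hA.
change (\forall y \near x, A (u (phi y))).
by apply: filterS h2 => y; apply; exact: Iphi.
Qed.

Lemma within_comp_cos (T : topologicalType) (u : R -> T) :
  {within Iset, continuous u} -> continuous (u \o cos).
Proof. exact: within_comp (@continuous_cos R) Iset_cos. Qed.

Lemma weight_cont (t : R) : -1 < t < 1 -> {for t, continuous (@weight R)}.
Proof.
move=> /andP[t1 t2]; rewrite /weight; apply: cvgV.
  by rewrite gt_eqF// sqrtr_gt0 subr_gt0 expr2; nra.
apply: (@continuous_comp _ _ _ (fun t : R => 1 - t ^+ 2) Num.sqrt).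
  by apply: cvgB; [exact: cvg_cst|exact: exprn_continuous].
exact: sqrt_continuous.
Qed.

Lemma weight_cos (t : R) : 0 < t < pi -> weight (cos t) * sin t = 1.
Proof.
move=> tpi; have s0 := sin_gt0_pi tpi.
rewrite /weight -sin2cos2 sqrtr_sqr gtr0_norm// mulVf// gt_eqF//.
Qed.

Lemma derive_cos : (@cos R)^`()%classic = (fun x => - sin x).
Proof.
by apply/funext => x; rewrite derive1E; apply: derive_val.
Qed.

Let d n : R := n.+1%:R^-1.

Let d01 n : 0 < d n <= 1.
Proof. by rewrite /d invr_gt0 ltr0n invf_le1 ?ltr0n// ler1n. Qed.

Let d_le n : d n <= pi - d n.
Proof. have := d01 n; have := @pi_ge2 R; lra. Qed.

Let mem0pi n (x : R) : d n <= x <= pi - d n -> x \in `[0, pi].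
Proof. by rewrite in_itv/=; have := d01 n; lra. Qed.

Let dhomo : {homo d : n m / (n <= m)%N >-> m <= n}.
Proof.
by move=> n m nm; rewrite /d lef_pV2 ?posrE ?ltr0n// ler_nat.
Qed.

Let d_small (e : R) : 0 < e -> exists n, d n < e.
Proof.
move=> e0; have [n _ /(_ n)/= h] := near_infty_natSinv_lt (PosNum e0).
by exists n; exact: h.
Qed.

Let B n : set R := `[d n, pi - d n].
Let A n : set R := `[cos (pi - d n), cos (d n)].

Let bigcupB : \bigcup_n B n = `]0, pi[%classic.
Proof.
apply/seteqP; split => x /=.
  move=> [n _]; rewrite /B/= !in_itv/=; have := d01 n; lra.
rewrite in_itv/= => /andP[x0 xp].
have m0 : 0 < Num.min x (pi - x) by rewrite lt_min x0 subr_gt0.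
have [n] := d_small m0; rewrite lt_min => /andP[h1 h2].
by exists n => //; rewrite /B/= in_itv/=; lra.
Qed.

Let AB n t : -1 <= t <= 1 -> A n t <-> B n (acos t).
Proof.
move=> t1; have ct : cos (acos t) = t by rewrite acosK// in_itv.
have at1 : acos t \in `[0, pi] by rewrite in_itv/= acos_ge0// acos_lepi.
have m1 : d n \in `[0, pi] by apply: (@mem0pi n); have := d_le n; lra.
have m2 : pi - d n \in `[0, pi] by apply: (@mem0pi n); have := d_le n; lra.
by rewrite /A /B/= !in_itv/= -{1 2}ct !leNgt !ltr_cos// -!leNgt andbC.
Qed.

Let A1 n t : A n t -> -1 <= t <= 1.
Proof.
rewrite /A/= in_itv/= => /andP[h1 h2].
by rewrite (le_trans (cos_geN1 _) h1) (le_trans h2 (cos_le1 _)).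
Qed.

Let acos_oo (t : R) : -1 <= t <= 1 -> (0 < acos t < pi) = (-1 < t < 1).
Proof.
move=> t1; have ct : cos (acos t) = t by rewrite acosK// in_itv.
have at1 : acos t \in `[0, pi] by rewrite in_itv/= acos_ge0// acos_lepi.
have m1 : (0 : R) \in `[0, pi] by rewrite in_itv/= lexx pi_ge0.
have m2 : (pi : R) \in `[0, pi] by rewrite in_itv/= lexx pi_ge0.
by rewrite -(ltr_cos m1 at1) -(ltr_cos at1 m2) ct cos0 cospi andbC.
Qed.

Let bigcupA : \bigcup_n A n = `]-1, 1[%classic.
Proof.
apply/seteqP; split => x /=.
  move=> [n _ h]; have x1 := A1 h; rewrite in_itv/= -acos_oo//.
  have /(_ n)/(_ _) : forall n, B n (acos x) -> `]0, pi[%classic (acos x).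
    by move=> k hk; rewrite -bigcupB; exists k.
  by rewrite /= in_itv/=; apply; apply/AB.
rewrite in_itv/= => x1; have x1' : -1 <= x <= 1 by lra.
have : `]0, pi[%classic (acos x) by rewrite /= in_itv/= acos_oo.
by rewrite -bigcupB => -[n _ h]; exists n => //; apply/AB.
Qed.

Let A_oo n t : A n t -> -1 < t < 1.
Proof.
move=> h; have : (\bigcup_n A n) t by exists n.
by rewrite bigcupA /= in_itv.
Qed.

Let uw_cont u t : {within Iset, continuous u} -> -1 < t < 1 ->
  {for t, continuous (fun t => u t * weight t)}.
Proof.
move=> cu t1; apply: cvgM; last exact: weight_cont.
by apply: (within_continuous_continuous _ cu); rewrite ?in_itv//; lra.
Qed.

Lemma subst_cos_trunc u n : {within Iset, continuous u} ->
  (\int[mu]_(t in A n) (u t * weight t)%:E =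
   \int[mu]_(x in B n) (u (cos x))%:E)%E.
Proof.
move=> cu.
rewrite /A (@integration_by_substitution_decreasing R cos
  (fun t => u t * weight t) (d n) (pi - d n)).
- apply: eq_integral => x; rewrite inE/= => Bx.
  rewrite derive_cos; congr (_%:E).
  change (u (cos x) * weight (cos x) * - - sin x = u (cos x)).
  rewrite opprK -mulrA weight_cos ?mulr1//.
  have : (\bigcup_n B n) x by exists n.
  by rewrite bigcupB /= in_itv.
- exact: d_le.
- move=> x y hx hy xy.
  by rewrite ltr_cos//; apply: (@mem0pi n); [move: hy|move: hx]; rewrite in_itv.
- by rewrite derive_cos => x _; apply: cvgN; exact: continuous_sin.
- rewrite derive_cos; apply/cvg_ex; exists (- sin (d n)).
  by apply: cvg_at_right_filter; apply: cvgN; exact: continuous_sin.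
- rewrite derive_cos; apply/cvg_ex; exists (- sin (pi - d n)).
  by apply: cvg_at_left_filter; apply: cvgN; exact: continuous_sin.
- split.
  + by move=> x _; case: (is_derive_cos x).
  + by apply: cvg_at_right_filter; exact: continuous_cos.
  + by apply: cvg_at_left_filter; exact: continuous_cos.
- apply: continuous_in_subspaceT => x; rewrite inE => hx.
  by apply: uw_cont => //; exact: A_oo hx.
Qed.

Let muw_oo u : {within Iset, continuous u} ->
  measurable_fun (`]-1, 1[ : set R) (fun t => u t * weight t).
Proof.
move=> cu; apply: subspace_continuous_measurable_fun => //.
apply: continuous_in_subspaceT => x; rewrite inE/= in_itv/= => hx.
exact: uw_cont.
Qed.

(** The weight blows up at the endpoints. On [cos @` B n] the substitution is
    regular; both sides increase to the full integrals by monotone convergence. *)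
Lemma subst_cos_ge0 u : {within Iset, continuous u} ->
  (forall t, Iset t -> 0 <= u t) ->
  (\int[mu]_(t in Iset) (u t * weight t)%:E =
   \int[mu]_(x in `[0%R, pi]) (u (cos x))%:E)%E.
Proof.
move=> cu u0.
have w0 t : 0 <= weight t :> R by rewrite /weight invr_ge0 sqrtr_ge0.
have mu1 : measurable_fun (`]-1, 1[ : set R) (fun t : R => (u t * weight t)%:E).
  by apply/measurable_EFinP; exact: muw_oo.
have mu2 (D : set R) : measurable D ->
    measurable_fun D (EFin \o (u \o cos)).
  move=> mD; apply/measurable_EFinP; apply: (measurable_funS _ (subsetT _)) => //.
  apply: continuous_measurable_fun; exact: within_comp_cos.
have homA : {homo A : n m / (n <= m)%N >-> (n <= m)%O}.
  move=> n m nm; apply/subsetPset => t hA; have t1 := A1 hA.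
  move/AB : (hA) => /(_ t1); rewrite AB// /B/= !in_itv/=.
  have := dhomo nm; lra.
have homB : {homo B : n m / (n <= m)%N >-> (n <= m)%O}.
  move=> n m nm; apply/subsetPset => t; rewrite /B/= !in_itv/=.
  have := dhomo nm; lra.
have cA : (\int[mu]_(t in A n) (u t * weight t)%:E)%E @[n --> \oo] -->
    (\int[mu]_(t in \bigcup_n A n) (u t * weight t)%:E)%E.
  apply: ge0_nondecreasing_set_cvg_integral => // [n|n|n t]; last first.
    move=> /(@A1 n t) ht.
    by rewrite lee_fin mulr_ge0// u0// /Iset/= in_itv.
  2: exact: measurable_itv.
  apply: (measurable_funS _ _ mu1); first exact: measurable_itv.
  by move=> t /(@A_oo n t) ht; rewrite /= in_itv.
have cB : (\int[mu]_(x in B n) (u (cos x))%:E)%E @[n --> \oo] -->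
    (\int[mu]_(x in \bigcup_n B n) (u (cos x))%:E)%E.
  apply: ge0_nondecreasing_set_cvg_integral => // [n|n|n x _].
    exact: measurable_itv.
    by apply: mu2; exact: measurable_itv.
  by rewrite lee_fin u0//; exact: Iset_cos.
have {}cA : (\int[mu]_(x in B n) (u (cos x))%:E)%E @[n --> \oo] -->
    (\int[mu]_(t in \bigcup_n A n) (u t * weight t)%:E)%E.
  by apply: cvg_trans cA; apply: near_eq_cvg; apply: nearW => n;
    rewrite subst_cos_trunc.
have := cvg_unique (@ereal_hausdorff R) cA cB; rewrite bigcupA bigcupB.
move=> cAB; rewrite /Iset integral_itv_bndoo// cAB [RHS]integral_itv_bndoo//.
by apply: mu2; exact: measurable_itv.
Qed.

Lemma weight_integrable_ge0 u : {within Iset, continuous u} ->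
  (forall t, Iset t -> 0 <= u t) ->
  mu.-integrable Iset (EFin \o (fun t => u t * weight t)).
Proof.
move=> cu u0; apply/integrableP; split.
  apply/measurable_EFinP.
  apply/measurable_fun_itv_bndo_bndcP.
  apply/measurable_fun_itv_obnd_cbndP.
  exact: muw_oo.
rewrite (_ : (\int[mu]_(x in Iset) _ = \int[mu]_(x in `[0%R, pi]) (u (cos x))%:E)%E).
  have := cont_integrable 0 pi (within_comp_cos cu).
  move=> /integrableP[_]; apply: le_lt_trans.
  rewrite le_eqVlt; apply/orP; left; apply/eqP; apply: eq_integral => x _ /=.
  by rewrite ger0_norm// u0//; exact: Iset_cos.
rewrite -subst_cos_ge0//; apply: eq_integral => x; rewrite inE => hx /=.
by rewrite ger0_norm// mulr_ge0 ?u0// /weight invr_ge0 sqrtr_ge0.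
Qed.

Lemma within_bounded u : {within Iset, continuous u} ->
  exists2 M, 0 < M & forall t, Iset t -> `|u t| <= M.
Proof.
move=> cu; have := continuous_compact cu (@segment_compact R (-1) 1).
move=> /compact_bounded [M [_ hM]].
exists (`|M| + 1); first by rewrite ltr_wpDl.
move=> t It; apply: (hM (`|M| + 1)); last by exists t.
by rewrite (le_lt_trans (ler_norm _))// ltrDl.
Qed.

(** Adding a constant to [u] reduces the statement to nonnegative integrands. *)
Lemma weight_integrable u : {within Iset, continuous u} ->
  mu.-integrable Iset (EFin \o (fun t => u t * weight t)).
Proof.
move=> cu; have [M M0 uM] := within_bounded cu.
have cM : {within @Iset R, continuous (fun=> M)} by move=> x; exact: cvg_cst.
have h1 : mu.-integrable Iset (EFin \o (fun t => (u t + M) * weight t)).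
  apply: (@weight_integrable_ge0 (fun t => u t + M)).
    by move=> x; apply: cvgD; [exact: cu|exact: cM].
  by move=> t /uM; rewrite ler_norml; lra.
have h2 := weight_integrable_ge0 cM (fun _ _ => ltW M0).
rewrite (_ : EFin \o _ = (fun t => ((u t + M) * weight t)%:E - (M * weight t)%:E)%E).
  by apply: integrableB => //; exact: measurable_itv.
by apply/funext => x /=; rewrite -EFinB; congr (_%:E); ring.
Qed.

Lemma subst_cos u : {within Iset, continuous u} ->
  \int[mu]_(t in Iset) (u t * weight t) = \int[mu]_(x in `[0, pi]) u (cos x).
Proof.
move=> cu; have [M M0 uM] := within_bounded cu.
have cM : {within @Iset R, continuous (fun=> M)} by move=> x; exact: cvg_cst.
have cuM : {within @Iset R, continuous (fun t => u t + M)}.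
  by move=> x; apply: cvgD; [exact: cu|exact: cM].
have uM0 t : Iset t -> 0 <= u t + M by move=> /uM; rewrite ler_norml; lra.
have -> : \int[mu]_(t in Iset) (u t * weight t) =
    \int[mu]_(t in Iset) ((u t + M) * weight t - M * weight t).
  by apply: eq_Rintegral => x _; ring.
rewrite RintegralB; first last.
- exact: weight_integrable cM.
- exact: weight_integrable cuM.
- exact: measurable_itv.
rewrite /Rintegral subst_cos_ge0//.
rewrite (@subst_cos_ge0 (fun=> M))//; last by move=> *; exact: ltW.
rewrite -/(Rintegral _ _ _) -/(Rintegral _ _ _).
have := @cont_RintB R (fun x => u (cos x) + M) (fun=> M) 0 pi
  (within_comp_cos cuM) (within_comp_cos cM).
by move=> <-; apply: eq_Rintegral => x _; rewrite addrK.
Qed.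

End substitution.

Section cosine_continuity.
Context {R : realType}.
Local Notation mu := (@lebesgue_measure R).
Implicit Types (u v : R -> R).

Lemma cont_cosn (k : R) : continuous (fun x : R => cos (k * x)).
Proof.
move=> x; apply: (@continuous_comp _ _ _ (fun x => k * x) cos).
  by apply: cvgM; [exact: cvg_cst|exact: cvg_id].
exact: continuous_cos.
Qed.

Lemma cont_sinn (k : R) : continuous (fun x : R => sin (k * x)).
Proof.
move=> x; apply: (@continuous_comp _ _ _ (fun x => k * x) sin).
  by apply: cvgM; [exact: cvg_cst|exact: cvg_id].
exact: continuous_sin.
Qed.

Lemma cont_mul u v : continuous u -> continuous v ->
  continuous (fun x => u x * v x).
Proof. by move=> cu cv x; apply: cvgM; [exact: cu|exact: cv]. Qed.

Lemma cont_add u v : continuous u -> continuous v ->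
  continuous (fun x => u x + v x).
Proof. by move=> cu cv x; apply: cvgD; [exact: cu|exact: cv]. Qed.

Lemma cont_cst (c : R) : continuous (fun _ : R => c).
Proof. by move=> x; exact: cvg_cst. Qed.

Lemma cont_exp u n : continuous u -> continuous (fun x => u x ^+ n).
Proof.
move=> cu; elim: n => [|n IH].
  by under eq_fun do rewrite expr0; exact: cont_cst.
by under eq_fun do rewrite exprS; exact: cont_mul.
Qed.

Lemma cont_scale (c : R) u : continuous u -> continuous (fun x => c * u x).
Proof. by move=> cu; exact: cont_Z. Qed.

Lemma cont_opp u : continuous u -> continuous (fun x => - u x).
Proof. by move=> cu x; apply: cvgN; exact: cu. Qed.

Lemma cont_max u v : continuous u -> continuous v ->
  continuous (fun x => Num.max (u x) (v x)).
Proof.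
by move=> cu cv x; apply: (@continuous_max _ _ _ _ x); [exact: cu|exact: cv].
Qed.

Definition nk (k : nat) : R := Num.sqrt ((if k == 0%N then 1 else 2) / pi).
Definition cosn (k : nat) (x : R) : R := nk k * cos (k%:R * x).
Definition sinn (k : nat) (x : R) : R := nk k.+1 * sin (k.+1%:R * x).

Lemma cosn_cont k : continuous (cosn k).
Proof. by apply: cont_scale; exact: cont_cosn. Qed.
Lemma sinn_cont k : continuous (sinn k).
Proof. by apply: cont_scale; exact: cont_sinn. Qed.

End cosine_continuity.

(* Continuity of an expression, by recursion on its syntax. *)
Ltac cnt := lazymatch goal with |- continuous ?f =>
  lazymatch f with
  | (fun x => (@?a x + @?b x)%R) => apply: (@cont_add _ a b); [cnt|cnt]
  | (fun x => (- @?a x)%R) => apply: (@cont_opp _ a); cnt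
  | (fun x => (@?a x * @?b x)%R) => apply: (@cont_mul _ a b); [cnt|cnt]
  | (fun x => (@?a x ^+ ?n)%R) => apply: (@cont_exp _ a n); cnt
  | (fun _ => ?c) => exact: cont_cst
  | (fun x => cos (?k * x)%R) => exact: cont_cosn
  | (fun x => sin (?k * x)%R) => exact: cont_sinn
  | (fun x => Num.max (@?a x) (@?b x)) => apply: (@cont_max _ a b); [cnt|cnt]
  | (fun x => cosn ?k x) => exact: cosn_cont
  | (fun x => sinn ?k x) => exact: sinn_cont
  | _ => first [assumption
         | match goal with H : forall k, continuous _ |- _ => exact: H end]
  end end.

Section cosine_system.
Context {R : realType}.
Local Notation mu := (@lebesgue_measure R).
Implicit Types (u v : R -> R).

Lemma sin_natpi (n : nat) : sin (n%:R * pi : R) = 0.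
Proof.
elim: n => [|n IH]; first by rewrite mul0r sin0.
by rewrite -natr1 mulrDl mul1r sinDpi IH oppr0.
Qed.

Lemma is_derive_sinn (m : R) (x : R) :
  is_derive x (1 : R) (fun x => sin (m * x)) (m * cos (m * x)).
Proof.
have h : is_derive x (1 : R) (fun x : R => m * x) m.
  have := is_deriveZ (f := id) m (is_derive_id x (1:R)).
  by move/is_derive_eq; apply; rewrite /GRing.scale/= mulr1.
have := is_derive1_comp (is_derive_sin (m * x)) h.
by move/is_derive_eq; apply; rewrite mulrC.
Qed.

Lemma Rint_cosn (m : nat) : (0 < m)%N ->
  \int[mu]_(x in `[0, pi]) cos (m%:R * x) = 0 :> R.
Proof.
move=> m0; have m0' : (m%:R : R) != 0 by rewrite pnatr_eq0 -lt0n.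
have c1 : continuous (fun x : R => m%:R * cos (m%:R * x)) by cnt.
have := Rint_FTC2T (pi_ge0 _) c1 (is_derive_sinn m%:R).
rewrite cont_RintZ; last by cnt.
rewrite sin_natpi mulr0 sin0 subrr.
by move/eqP; rewrite mulf_eq0 (negbTE m0') => /eqP.
Qed.

Lemma prod_cos (x y : R) : cos x * cos y = (cos (x + y) + cos (x - y)) / 2.
Proof. by rewrite cosB cosD; field. Qed.

Lemma prod_sin (x y : R) : sin x * sin y = (cos (x - y) - cos (x + y)) / 2.
Proof. by rewrite cosB cosD; field. Qed.

Lemma Rint_cosn0 (m : nat) :
  \int[mu]_(x in `[0, pi]) cos (m%:R * x) = (if m == 0%N then pi else 0) :> R.
Proof.
case: eqP => [->|/eqP m0]; last by rewrite Rint_cosn// lt0n.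
under eq_Rint do rewrite mul0r cos0.
by rewrite Rint_cst ?pi_ge0// subr0 mul1r.
Qed.

Lemma Rint_coscos (j k : nat) : (j <= k)%N ->
  \int[mu]_(x in `[0, pi]) (cos (j%:R * x) * cos (k%:R * x)) =
  ((if (j + k == 0)%N then pi else 0) + (if j == k then pi else 0)) / 2 :> R.
Proof.
move=> jk.
transitivity (\int[mu]_(x in `[0, pi])
    (2^-1 * cos ((j + k)%:R * x) + 2^-1 * cos ((k - j)%:R * x)) : R).
  apply: eq_Rint => x _; rewrite mulrC prod_cos natrD natrB//.
  have -> : (j%:R + k%:R) * x = k%:R * x + j%:R * x by ring.
  have -> : (k%:R - j%:R) * x = k%:R * x - j%:R * x by ring.
  by field.
rewrite cont_RintD; [|by cnt..].
rewrite !cont_RintZ; [|by cnt..].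
rewrite !Rint_cosn0 subn_eq0 (eqn_leq j k) jk /=.
by rewrite -mulrDr mulrC.
Qed.

Lemma Rint_sinsin (j k : nat) : (j <= k)%N ->
  \int[mu]_(x in `[0, pi]) (sin (j%:R * x) * sin (k%:R * x)) =
  ((if j == k then pi else 0) - (if (j + k == 0)%N then pi else 0)) / 2 :> R.
Proof.
move=> jk.
transitivity (\int[mu]_(x in `[0, pi])
    (2^-1 * cos ((k - j)%:R * x) - 2^-1 * cos ((j + k)%:R * x)) : R).
  apply: eq_Rint => x _; rewrite mulrC prod_sin natrD natrB//.
  have -> : (j%:R + k%:R) * x = k%:R * x + j%:R * x by ring.
  have -> : (k%:R - j%:R) * x = k%:R * x - j%:R * x by ring.
  by field.
rewrite cont_RintB; [|by cnt..].
rewrite !cont_RintZ; [|by cnt..].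
rewrite !Rint_cosn0 subn_eq0 (eqn_leq j k) jk /=.
by rewrite -mulrBr mulrC.
Qed.

Lemma nk_ge0 k : 0 <= nk k :> R. Proof. exact: sqrtr_ge0. Qed.

Lemma nk_gt0 k : 0 < nk k :> R.
Proof. by rewrite sqrtr_gt0 divr_gt0 ?pi_gt0//; case: ifP. Qed.

Lemma nk_sqr k : nk k ^+ 2 = (if k == 0%N then 1 else 2) / pi :> R.
Proof. by rewrite sqr_sqrtr// divr_ge0 ?pi_ge0//; case: ifP. Qed.

Lemma nkS k : nk k.+1 ^+ 2 = 2 / pi :> R. Proof. by rewrite nk_sqr. Qed.

Definition orthonormal_sys (e : nat -> R -> R) :=
  forall j k, (j <= k)%N ->
    \int[mu]_(x in `[0, pi]) (e j x * e k x) = (j == k)%:R.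

Lemma cosn_orthonormal : orthonormal_sys cosn.
Proof.
move=> j k jk.
transitivity (\int[mu]_(x in `[0, pi]) ((nk j * nk k) *
    (cos (j%:R * x) * cos (k%:R * x)))).
  by apply: eq_Rint => x _; rewrite /cosn; ring.
rewrite cont_RintZ; last by cnt.
rewrite Rint_coscos//.
have p0 : (pi : R) != 0 by rewrite gt_eqF ?pi_gt0.
case: (j =P k) => [->|njk]; last first.
  case: eqP => [|_]; last by rewrite addr0 mul0r mulr0.
  by move/eqP; rewrite addn_eq0 => /andP[/eqP h1 /eqP h2]; case: njk; rewrite h1 h2.
rewrite -expr2 nk_sqr addnn double_eq0; have -> : (true%:R : R) = 1 by [].
have d2 : 2 / pi * (pi / 2) = 1 :> R by rewrite mulf_div [2 * _]mulrC divff ?mulf_neq0.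
case: eqP => _; rewrite ?add0r//.
by rewrite (_ : pi + pi = pi * 2) ?mulfK ?mul1r ?mulVf//; ring.
Qed.

Lemma sinn_orthonormal : orthonormal_sys sinn.
Proof.
move=> j k jk.
transitivity (\int[mu]_(x in `[0, pi]) ((nk j.+1 * nk k.+1) *
    (sin (j.+1%:R * x) * sin (k.+1%:R * x)))).
  by apply: eq_Rint => x _; rewrite /sinn; ring.
rewrite cont_RintZ; last by cnt.
rewrite Rint_sinsin//.
have p0 : (pi : R) != 0 by rewrite gt_eqF ?pi_gt0.
rewrite eqSS addSn /= subr0.
case: eqP => [->|njk]; last by rewrite mul0r mulr0.
by rewrite -expr2 nkS mulf_div [2 * _]mulrC divff ?mulf_neq0.
Qed.

(** Bessel's inequality: removing from [v] its components one at a time, each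
    removal lowers the integral of the square by the square of a coefficient. *)
Lemma bessel (e : nat -> R -> R) v n : (forall k, continuous (e k)) ->
  orthonormal_sys e -> continuous v ->
  \sum_(k < n) (\int[mu]_(x in `[0, pi]) (v x * e k x)) ^+ 2 <=
  \int[mu]_(x in `[0, pi]) (v x ^+ 2).
Proof.
move=> ce oe cv; pose c k := \int[mu]_(x in `[0, pi]) (v x * e k x).
pose w m x := v x - \sum_(k < m) c k * e k x.
have cS m : continuous (fun x => \sum_(k < m) c k * e k x).
  by apply: (@cont_sum R _ _ _ (fun (k : 'I_m) x => c k * e k x)) => k; cnt.
have cw m : continuous (w m) by rewrite /w; cnt.
have we m : \int[mu]_(x in `[0, pi]) (w m x * e m x) = c m.
  rewrite (_ : c m = c m - \sum_(k < m) c k * \int[mu]_(x in `[0, pi]) (e k x * e m x)).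
    rewrite {1}/c.
    transitivity (\int[mu]_(x in `[0, pi])
       (v x * e m x - \sum_(k < m) c k * (e k x * e m x))).
      apply: eq_Rint => x _; rewrite /w mulrBl mulr_suml; congr (_ - _).
      by apply: eq_bigr => k _; rewrite mulrA.
    have ck (k : 'I_m) : continuous (fun x => c k * (e k x * e m x)) by cnt.
    rewrite cont_RintB; [|by cnt|exact: (cont_sum ck)].
    rewrite (cont_Rint_sum _ _ _ _ ck); congr (_ - _); apply: eq_bigr => k _.
    by rewrite cont_RintZ//; cnt.
  rewrite big1 ?subr0// => k _; rewrite oe ?(ltnW (ltn_ord k))//.
  by rewrite (ltn_eqF (ltn_ord k)) mulr0.
have step m : \int[mu]_(x in `[0, pi]) (w m x ^+ 2) =
    \int[mu]_(x in `[0, pi]) (v x ^+ 2) - \sum_(k < m) c k ^+ 2.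
  elim: m => [|m IH].
    rewrite big_ord0 subr0; apply: eq_Rint => x _.
    by rewrite /w big_ord0 subr0.
  rewrite big_ord_recr /= opprD addrA -IH.
  transitivity (\int[mu]_(x in `[0, pi])
      (w m x ^+ 2 - (c m * 2 * (w m x * e m x) - c m ^+ 2 * (e m x * e m x)))).
    by apply: eq_Rint => x _; rewrite /w big_ord_recr/=; ring.
  rewrite cont_RintB; [|by cnt..].
  rewrite cont_RintB; [|by cnt..].
  rewrite cont_RintZ; [|by cnt].
  rewrite cont_RintZ; [|by cnt].
  by rewrite we oe// eqxx [true%:R]mulr1n; ring.
have : 0 <= \int[mu]_(x in `[0, pi]) (w n x ^+ 2).
  by apply: Rintegral_ge0 => x _; exact: sqr_ge0.
by rewrite step subr_ge0.
Qed.

Lemma bernoulli_ineq n (x : R) : -1 <= x -> 1 + n%:R * x <= (1 + x) ^+ n.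
Proof.
move=> x0; have x1 : 0 <= 1 + x by lra.
elim: n => [|n IH]; first by rewrite mul0r addr0 expr0.
rewrite exprS -natr1; apply: le_trans (ler_wpM2l x1 IH).
have : 0 <= (n%:R : R) by []. nra.
Qed.

(** Only the derivative of the primitive is used: a primitive that does not
    increase over the whole interval is constant. *)
Lemma ge0_Rint_eq0 (g : R -> R) (a b : R) : a < b -> continuous g ->
  (forall x, 0 <= g x) -> \int[mu]_(x in `[a, b]) g x <= 0 ->
  forall x, a < x < b -> g x = 0.
Proof.
move=> ab cg g0 intg x /andP[ax xb].
pose G y := \int[mu]_(t in `[a, y]) g t.
have Gmono y z : a <= y -> y <= z -> z <= b -> G y <= G z.
  move=> ay yz zb; rewrite -subr_ge0 /G Rintegral_itvB.
  - by apply: Rintegral_ge0.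
  - exact: cont_integrable.
  - by rewrite bnd_simp.
  - by rewrite bnd_simp.
have G0 y : a <= y -> y <= b -> G y = 0.
  move=> ay yb; apply/eqP; rewrite eq_le; apply/andP; split.
    by apply: le_trans intg; exact: Gmono.
  by apply: Rintegral_ge0.
have dG := Rint_derive cg ax; rewrite -/G in dG.
have d0 : is_derive x (1 : R) G 0.
  apply: (@near_eq_is_derive _ _ _ (fun=> 0)) => //.
  have : \forall y \near x, a < y < b.
    have : x \in `]a, b[ by rewrite in_itv/= ax xb.
    move/near_in_itvoo; apply: filterS => y; by rewrite in_itv.
  by apply: filterS => y /andP[ay yb]; rewrite G0// ltW.
by case: dG => _ <-; case: d0.
Qed.

End cosine_system.

(** * Completeness of the Chebyshev system *)

Section completeness.
Context {R : realType}.
Local Notation mu := (@lebesgue_measure R).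
Implicit Types (u v h : R -> R).

Definition cos_orth v := forall j : nat,
  \int[mu]_(x in `[0, pi]) (v x * cos (j%:R * x)) = 0.

Lemma cos_orth_cos v : continuous v -> cos_orth v ->
  cos_orth (fun x => v x * cos (1 * x)).
Proof.
move=> cv ov [|j].
  rewrite -[RHS](ov 1%N); apply: eq_Rint => x _.
  by rewrite mul0r cos0 mulr1.
transitivity (\int[mu]_(x in `[0, pi])
  (2^-1 * (v x * cos (j.+2%:R * x)) + 2^-1 * (v x * cos (j%:R * x)))).
  apply: eq_Rint => x _; rewrite -mulrA [cos (1 * x) * _]mulrC prod_cos.
  rewrite -mulrDl -mulrBl natr1 -[j.+1%:R - 1]/(j.+1%:R - 1%:R) -natrB// subn1.
  by rewrite /=; field.
rewrite cont_RintD; [|by cnt..].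
rewrite cont_RintZ; [|by cnt].
rewrite cont_RintZ; [|by cnt].
by rewrite !ov; ring.
Qed.

Lemma cos_orthD v h : continuous v -> continuous h ->
  cos_orth v -> cos_orth h -> cos_orth (fun x => v x + h x).
Proof.
move=> cv ch ov oh j.
transitivity (\int[mu]_(x in `[0, pi])
  (v x * cos (j%:R * x) + h x * cos (j%:R * x))).
  by apply: eq_Rint => x _; rewrite mulrDl.
by rewrite cont_RintD ?ov ?oh ?addr0//; cnt.
Qed.

Lemma cos_orthZ v (c : R) : continuous v -> cos_orth v ->
  cos_orth (fun x => c * v x).
Proof.
move=> cv ov j.
transitivity (\int[mu]_(x in `[0, pi]) (c * (v x * cos (j%:R * x)))).
  by apply: eq_Rint => x _; rewrite mulrA.
by rewrite cont_RintZ ?ov ?mulr0//; cnt.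
Qed.

Lemma cos_orth_quad v (A B C : R) n : continuous v -> cos_orth v ->
  cos_orth (fun x => v x * (A + B * cos (1 * x) +
    C * (cos (1 * x) * cos (1 * x))) ^+ n).
Proof.
move=> cv ov; pose q (x : R) := A + B * cos (1 * x) +
    C * (cos (1 * x) * cos (1 * x)).
have cq : continuous q by rewrite /q; cnt.
rewrite -/(cos_orth (fun x => v x * q x ^+ n)).
have cqn m : continuous (fun x => v x * q x ^+ m) by cnt.
elim: n => [|n IH]; first by under eq_fun do rewrite expr0 mulr1; exact: ov.
set w := fun x => v x * q x ^+ n in IH.
have cw : continuous w := cqn n.
have h1 := cos_orth_cos cw IH.
have cw1 : continuous (fun x => w x * cos (1 * x)) by cnt.
have h2 := cos_orth_cos cw1 h1.
have cw2 : continuous (fun x => w x * cos (1 * x) * cos (1 * x)) by cnt.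
have := cos_orthD _ _ (cos_orthD _ _ (cos_orthZ A cw IH) (cos_orthZ B cw1 h1))
   (cos_orthZ C cw2 h2).
move=> H; have {H} : cos_orth (fun x => A * w x + B * (w x * cos (1 * x)) +
   C * (w x * cos (1 * x) * cos (1 * x))) by apply: H; cnt.
rewrite (_ : (fun x => A * _ + _ + _) = (fun x => v x * q x ^+ n.+1)) //.
by apply/funext => x; rewrite /w exprSr /q; ring.
Qed.

(** If [u t0 > 0], integrate [u] against high powers of a nonnegative quadratic
    polynomial which exceeds 1 near [t0] only: the part near [t0] grows without
    bound while the rest stays bounded, although every such integral is 0. *)
Lemma cheb_complete_pos u t0 : {within Iset, continuous u} ->
  cos_orth (u \o cos) -> Iset t0 -> u t0 <= 0.
Proof.
move=> cu ou It0; rewrite leNgt; apply/negP => ut0.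
have cv := within_comp_cos cu.
have [M M0 uM] := within_bounded cu.
have [d d0 hd] : exists2 d, 0 < d &
    forall t, Iset t -> `|t - t0| < d -> u t0 / 2 < u t.
  have e0 : 0 < u t0 / 2 by rewrite divr_gt0.
  have /cvgrPdist_lt/(_ _ e0) := cu t0.
  rewrite /nbhs/= -(nbhs_subspace_in It0) => /nbhs_ballP[d /= d0 hd].
  exists d => // t It tt0; have := hd t; rewrite /ball/= distrC => /(_ tt0 It).
  rewrite ltr_norml => /andP[_]; rewrite /from_subspace; lra.
have It0' : -1 <= t0 <= 1 by move: It0; rewrite /Iset/= in_itv.
pose q (x : R) := 1 + (d ^+ 2 / 2 - (cos (1 * x) - t0) ^+ 2) / 4.
pose g x := Num.max 0 (q x - 1).
have cq : continuous q by rewrite /q; cnt.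
have cg : continuous g by rewrite /g; cnt.
have g0 x : 0 <= g x by rewrite le_max lexx.
pose m := u t0 / 2.
have m0 : 0 < m by rewrite divr_gt0.
have q0 x : 0 <= q x.
  rewrite /q; have /andP[c1 c2] : -1 <= cos (1 * x) <= 1 by rewrite cos_geN1 cos_le1.
  have := sqr_ge0 d; move: (cos _) c1 c2 => c c1 c2 d2.
  have : (c - t0) ^+ 2 <= 4 by rewrite expr2; nra.
  lra.
have low n x : n%:R * (m * g x) - M <= u (cos x) * q x ^+ n.
  have Ic := Iset_cos x.
  have [near|far] := ltP `|cos x - t0| d.
    have uc := hd _ Ic near; have uc0 : 0 <= u (cos x) by lra.
    have h : n%:R * g x <= q x ^+ n.
      rewrite /g; have [h|h] := leP 1 (q x).
        rewrite max_r ?subr_ge0//.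
        have h' : -1 <= q x - 1 by lra.
        have := bernoulli_ineq n h'.
        by rewrite [1 + (_ - 1)]addrC subrK; lra.
      by rewrite max_l ?mulr0 ?exprn_ge0// subr_le0 ltW.
    have : m * (n%:R * g x) <= u (cos x) * q x ^+ n.
      apply: ler_pM => //; first exact: ltW.
        by rewrite mulr_ge0.
      exact: ltW.
    rewrite [m * _]mulrCA; lra.
  have gx : g x = 0.
    apply/max_l; rewrite /q mul1r.
    have : d ^+ 2 <= (cos x - t0) ^+ 2.
      by rewrite -[leRHS]real_normK ?num_real// ler_pXn2r ?nnegrE// ltW.
    have := sqr_ge0 d; lra.
  have q1 : q x <= 1 by move/eqP : gx; rewrite eq_maxl subr_le0.
  rewrite gx !mulr0 sub0r.
  have : `|u (cos x) * q x ^+ n| <= M * 1.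
    rewrite normrM ler_pM// ?uM// ger0_norm ?exprn_ge0//.
    by rewrite exprn_ile1.
  by rewrite mulr1 ler_norml => /andP[].
have ub n : n%:R * (m * \int[mu]_(x in `[0, pi]) g x) <= M * pi.
  have cvq : continuous (fun x => (u \o cos) x * q x ^+ n) by cnt.
  have : \int[mu]_(x in `[0, pi]) (n%:R * (m * g x) - M) <=
         \int[mu]_(x in `[0, pi]) ((u \o cos) x * q x ^+ n).
    apply: cont_Rint_le; [by cnt|exact: cvq|by move=> x _; exact: low].
  rewrite cont_RintB; [|by cnt|by cnt].
  rewrite cont_RintZ; [|by cnt].
  rewrite cont_RintZ; [|by cnt].
  rewrite Rint_cst ?pi_ge0// subr0.
  have -> : \int[mu]_(x in `[0, pi]) ((u \o cos) x * q x ^+ n) = 0.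
    have := @cos_orth_quad _ (1 + (d ^+ 2 / 2 - t0 ^+ 2) / 4) (t0 / 2) (- 4^-1)
      n cv ou 0%N.
    move=> e0; rewrite -[RHS]e0; apply: eq_Rint => x _; rewrite mul0r cos0 mulr1; congr (_ * _ ^+ _).
    by rewrite /q; field.
  lra.
have intg : \int[mu]_(x in `[0, pi]) g x <= 0.
  rewrite leNgt; apply/negP => ig0.
  have a0 : 0 < m * \int[mu]_(x in `[0, pi]) g x by rewrite mulr_gt0.
  have := ub (Num.trunc (M * pi / (m * \int[mu]_(x in `[0, pi]) g x))).+1.
  by rewrite -ler_pdivlMr// leNgt truncnS_gt.
have gz := ge0_Rint_eq0 (pi_gt0 R) cg g0 intg.
(* [g] vanishes on the open interval, but it is positive near [acos t0] *)
have ct0 : cos (acos t0) = t0 by rewrite acosK// in_itv.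
have g1 : 0 < g (acos t0).
  rewrite lt_max /q mul1r ct0 subrr expr0n/= subr0.
  by have := exprn_gt0 2 d0; lra.
have : exists2 x, 0 < x < pi & 0 < g x.
  have [a0|a0] := boolP (0 < acos t0 < pi); first by exists (acos t0).
  have /cvgrPdist_lt/(_ _ g1) /nbhs_ballP[r /= r0 hr] := cg (acos t0).
  have hr' x : `|acos t0 - x| < r -> 0 < g x.
    move=> /hr; rewrite /= ltr_norml => /andP[_]; lra.
  pose e := Num.min (r / 2) 1.
  have e0 : 0 < e by rewrite lt_min ltr01 divr_gt0.
  have er : e < r by rewrite gt_min; apply/orP; left; lra.
  have e1 : e <= 1 by rewrite ge_min lexx orbT.
  have p2 := @pi_ge2 R.
  have a1 := acos_ge0 It0'; have a2 := acos_lepi It0'.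
  have [aE|aE] : acos t0 = 0 \/ acos t0 = pi.
  - move: a0; rewrite negb_and -!leNgt => /orP[h|h]; [left|right]; lra.
  - exists e; first lra.
    by apply: hr'; rewrite aE sub0r normrN gtr0_norm.
  - exists (pi - e); first lra.
    by apply: hr'; rewrite aE opprB addrC subrK gtr0_norm.
by move=> [x /gz ->]; rewrite ltxx.
Qed.

Lemma cheb_complete u : {within Iset, continuous u} ->
  cos_orth (u \o cos) -> forall t, Iset t -> u t = 0.
Proof.
move=> cu ou t It; apply/eqP; rewrite eq_le (cheb_complete_pos cu ou It) /=.
rewrite -oppr_le0.
have cv := within_comp_cos cu.
apply: (@cheb_complete_pos (fun t => - u t)) => //.
  by move=> x; apply: cvgN; exact: cu.
move=> j; have := cos_orthZ (-1) cv ou j.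
by under eq_Rint do rewrite mulN1r.
Qed.

End completeness.

(** * Chebyshev polynomials and coefficients *)

Section chebyshev_polynomials.
Context {R : realType}.
Implicit Types (f g : R -> R[i]) (p : {poly R[i]}).

Fixpoint chebpair (n : nat) : {poly R[i]} * {poly R[i]} :=
  if n is m.+1 then
    let q := (chebpair m).2 in (q, 2 *: ('X * q) - (chebpair m).1)
  else (1, 'X).
Definition chebp n := (chebpair n).1.

Lemma chebp0 : chebp 0 = 1. Proof. by []. Qed.
Lemma chebp1 : chebp 1 = 'X. Proof. by []. Qed.
Lemma chebpSS n : chebp n.+2 = 2 *: ('X * chebp n.+1) - chebp n.
Proof. by []. Qed.

Lemma chebp_cos n (x : R) :
  polfun (chebp n) (cos x) = (cos (n%:R * x))%:C /\
  polfun (chebp n.+1) (cos x) = (cos (n.+1%:R * x))%:C.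
Proof.
elim: n => [|n [IH1 IH2]].
  by rewrite chebp0 chebp1 /polfun hornerC hornerX mul0r cos0 mul1r.
split=> //; rewrite chebpSS /polfun hornerD hornerN hornerZ hornerM hornerX.
rewrite -!/(polfun _ _) IH1 IH2.
rewrite -[2]/(2%:R) -(rmorph_nat (real_complex R)) -!rmorphM -rmorphB /=.
congr (_%:C); rewrite prod_cos.
have -> : (x + n.+1%:R * x) = n.+2%:R * x by rewrite -!natr1; ring.
have -> : x - n.+1%:R * x = - (n%:R * x) by rewrite -!natr1; ring.
by rewrite cosN; field.
Qed.

Lemma polfun_cheb n (t : R) : Iset t -> polfun (chebp n) t = (chebT n t)%:C.
Proof.
rewrite /Iset/= => It; rewrite -{1}(acosK It).
by have [->] := chebp_cos n (acos t).
Qed.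

Lemma size_chebp n : size (chebp n) = n.+1.
Proof.
suff [] : size (chebp n) = n.+1 /\ size (chebp n.+1) = n.+2 by [].
elim: n => [|n [IH1 IH2]]; first by rewrite chebp0 chebp1 size_poly1 size_polyX.
split=> //.
have h : size (2 *: ('X * chebp n.+1)) = n.+3.
  rewrite size_scale ?pnatr_eq0// mulrC size_mulX ?IH2//.
  by rewrite -size_poly_eq0 IH2.
by rewrite chebpSS size_polyDl ?size_polyN ?h// IH1.
Qed.

Lemma chebp_span n p : (size p <= n)%N ->
  exists d : nat -> R[i], p = \sum_(k < n) d k *: chebp k.
Proof.
elim: n p => [|n IH] p sp.
  by exists (fun=> 0); rewrite big_ord0; apply/eqP; rewrite -size_poly_leq0.
pose c := p`_n / lead_coef (chebp n).
have lc : lead_coef (chebp n) != 0 by rewrite lead_coef_eq0 -size_poly_eq0 size_chebp.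
have [|d hd] := IH (p - c *: chebp n).
  apply/leq_sizeP => j; rewrite leq_eqVlt => /predU1P[<-|nj].
    rewrite coefB coefZ /c lead_coefE size_chebp divfK ?subrr//.
    by move: lc; rewrite lead_coefE size_chebp.
  rewrite coefB coefZ [p`_j]nth_default ?(leq_trans sp)//.
  by rewrite [(chebp n)`_j]nth_default ?size_chebp// mulr0 subrr.
exists (fun k => if k == n then c else d k).
rewrite big_ord_recr /= eqxx -[LHS](subrK (c *: chebp n)) hd; congr (_ + _).
by apply: eq_bigr => k _; rewrite (ltn_eqF (ltn_ord k)).
Qed.

Lemma polfun_cont p : continuous (polfun p : R -> R[i]^o).
Proof.
elim/poly_ind: p => [|p c IH].
  by rewrite /polfun; under eq_fun do rewrite horner0; exact: ccont_cst.
rewrite (_ : polfun _ = fun t => polfun p t * t%:C + c); last first.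
  by apply/funext => t; rewrite /polfun hornerMXaddC.
apply: ccontD; last exact: ccont_cst.
by apply: ccontM; [exact: IH|apply: ccont_real => x; exact: cvg_id].
Qed.

(** Continuity on [-1, 1], wrapped in an inductive so that the unifier treats
    it as an atom instead of unfolding it to a statement about filters. *)
Variant contI f : Prop := ContI of CI f.

Lemma contI_cont f : continuous (f : R -> R[i]^o) -> contI f.
Proof. by move=> cf; split; apply: continuous_subspaceT. Qed.

Lemma contI_polfun p : contI (polfun p).
Proof. apply: contI_cont; exact: polfun_cont. Qed.

Lemma contI_eqI f g : eqI f g -> contI f -> contI g.
Proof.
move=> fg [cf]; split; apply: subspace_eq_continuous cf => t.
by rewrite inE => It; exact: fg.
Qed.

Lemma contID f g : contI f -> contI g -> contI (fun t => f t + g t).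
Proof. by move=> [cf] [cg]; split=> x; exact: (cvgD (cf x) (cg x)). Qed.

Lemma contI_cst c : contI (fun _ : R => c).
Proof. by split=> x; exact: cvg_cst. Qed.

Lemma contIM f g : contI f -> contI g -> contI (fun t => f t * g t).
Proof.
move=> [/within_cont_ReIm[f1 f2]] [/within_cont_ReIm[g1 g2]].
split; apply/within_cont_ReIm; split=> x.
  under eq_fun do rewrite ReM.
  apply: cvgB; apply: cvgM; by [exact: f1|exact: g1|exact: f2|exact: g2].
under eq_fun do rewrite ImM.
apply: cvgD; apply: cvgM; by [exact: f1|exact: g1|exact: f2|exact: g2].
Qed.

Lemma contIZ (c : R[i]) f : contI f -> contI (fun t => c * f t).
Proof. by move=> cf; apply: contIM => //; exact: contI_cst. Qed.

Lemma contIB f g : contI f -> contI g -> contI (fun t => f t - g t).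
Proof. by move=> [cf] [cg]; split=> x; exact: (cvgB (cf x) (cg x)). Qed.

Lemma contI_sum (I : Type) (r : seq I) (P : pred I) (F : I -> R -> R[i]) :
  (forall i, contI (F i)) -> contI (fun t => \sum_(i <- r | P i) F i t).
Proof.
move=> cF; elim: r => [|i r IH].
  by apply: contI_eqI (contI_cst 0) => t _; rewrite big_nil.
apply: (@contI_eqI (fun t => (if P i then F i t else 0) +
  \sum_(i <- r | P i) F i t)) => [t _|].
  by rewrite big_cons; case: (P i); rewrite ?add0r.
by apply: contID => //; case: (P i) => //; exact: contI_cst.
Qed.

Lemma contI_ReIm f : contI f ->
  {within Iset, continuous (fun t => complex.Re (f t))} /\
  {within Iset, continuous (fun t => complex.Im (f t))}.
Proof. by move=> [/within_cont_ReIm]. Qed.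

(** The same device for continuity on the whole line. *)
Variant ccont f : Prop := Ccont of continuous (f : R -> R[i]^o).

Lemma ccont_comp_cos f : contI f -> ccont (fun x => f (cos x)).
Proof. by move=> [cf]; split; exact: within_comp_cos cf. Qed.

Lemma ccont_mulr f (u : R -> R) : ccont f -> continuous u ->
  ccont (fun x => f x * (u x)%:C).
Proof.
by move=> [cf] cu; split; apply: ccontM; [exact: cf|exact: ccont_real].
Qed.

Lemma ccont_ReIm f : ccont f ->
  continuous (fun t => complex.Re (f t)) /\
  continuous (fun t => complex.Im (f t)).
Proof. by move=> [/ccontP]. Qed.

Lemma chebT_cos k (x : R) : 0 <= x <= pi -> chebT k (cos x) = cos (k%:R * x).
Proof. by move=> hx; rewrite /chebT cosK// in_itv. Qed.

Lemma chebT_within k : {within Iset, continuous (@chebT R k)}.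
Proof.
have [h _] := contI_ReIm (contI_polfun (chebp k)).
apply: subspace_eq_continuous h => t; rewrite inE => It.
by rewrite /from_subspace/= polfun_cheb.
Qed.

(** The substitution [t = cos x] removes the weight. *)
Lemma coefTE f k : contI f -> coefT f k =
  (nk k)%:C * cint `[0, pi] (fun x => f (cos x) * (cos (k%:R * x))%:C).
Proof.
move=> cf; have [c1 c2] := contI_ReIm cf.
have [d1 d2] := ccont_ReIm (ccont_comp_cos cf).
have ck : {within @Iset R, continuous (fun t => nk k * chebT k t)}.
  by move=> x; apply: cvgM; [exact: cvg_cst|exact: chebT_within].
have main (u : R -> R) : {within Iset, continuous u} ->
    \int[lebesgue_measure]_(t in Iset) ((nk k * chebT k t * u t) * weight t) =
    nk k * \int[lebesgue_measure]_(x in `[0, pi]) (u (cos x) * cos (k%:R * x)).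
  move=> cu; rewrite (subst_cos (u := fun t => nk k * chebT k t * u t)).
    have cuc := within_comp_cos cu.
    rewrite -cont_RintZ; last first.
      by apply: (@cont_mul _ (u \o cos)); [|exact: cont_cosn].
    by apply: eq_Rint => x hx; rewrite chebT_cos//; ring.
  by move=> x; apply: cvgM; [exact: ck|exact: cu].
rewrite /coefT /L2inner /cint; apply: complex_ext; rewrite ?ReZ ?ImZ /=.
  rewrite (@eq_Rint _ (fun x => complex.Re (f (cos x) * _)) (fun x => complex.Re (f (cos x)) * cos (k%:R * x))); last first.
    by move=> x _; rewrite ReM /= mulr0 subr0.
  rewrite -(main _ c1); apply: eq_Rintegral => t _.
  by rewrite !(ReM, ImM) /= /nk; ring.
rewrite (@eq_Rint _ (fun x => complex.Im (f (cos x) * _)) (fun x => complex.Im (f (cos x)) * cos (k%:R * x))); last first.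
  by move=> x _; rewrite ImM /= mulr0 add0r.
rewrite -(main _ c2); apply: eq_Rintegral => t _.
by rewrite !(ReM, ImM) /= /nk; ring.
Qed.

Lemma ccont_coef f k : contI f ->
  continuous ((fun x => f (cos x) * (cos (k%:R * x))%:C) : R -> R[i]^o).
Proof.
move=> cf; have [] := ccont_mulr (ccont_comp_cos cf) (@cont_cosn _ k%:R).
exact.
Qed.

Lemma coefTD f g k : contI f -> contI g ->
  coefT (fun t => f t + g t) k = coefT f k + coefT g k.
Proof.
move=> cf cg; rewrite !coefTE//; last exact: contID.
rewrite -mulrDr -cont_cintD; [|exact: ccont_coef..].
by congr (_ * _); apply: eq_cint => x _; rewrite mulrDl.
Qed.

Lemma coefTZ (c : R[i]) f k : contI f ->
  coefT (fun t => c * f t) k = c * coefT f k.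
Proof.
move=> cf; rewrite !coefTE//; last exact: contIZ.
rewrite [RHS]mulrCA -[X in _ = _ * X]cont_cintZ; last exact: ccont_coef.
by congr (_ * _); apply: eq_cint => x _; rewrite mulrA.
Qed.

Lemma coefT_eqI f g k : contI f -> eqI f g -> coefT f k = coefT g k.
Proof.
move=> cf fg; rewrite !coefTE//; last exact: contI_eqI fg cf.
by congr (_ * _); apply: eq_cint => x _; rewrite fg//; exact: Iset_cos.
Qed.

Lemma coefT0 k : coefT (fun _ : R => 0 : R[i]) k = 0.
Proof.
rewrite -[RHS](mul0r (coefT (fun _ : R => 0 : R[i]) k)) -coefTZ; last exact: contI_cst.
by apply: coefT_eqI; [exact: contI_cst|move=> t _; rewrite mul0r].
Qed.

Lemma coefTB f g k : contI f -> contI g ->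
  coefT (fun t => f t - g t) k = coefT f k - coefT g k.
Proof.
move=> cf cg; rewrite -[- coefT g k]mulN1r -coefTZ// -coefTD//; last exact: contIZ.
by apply: coefT_eqI; [exact: contIB|move=> t _; rewrite mulN1r].
Qed.

Lemma coefT_sum (I : Type) (r : seq I) (P : pred I) (F : I -> R -> R[i]) k :
  (forall i, contI (F i)) ->
  coefT (fun t => \sum_(i <- r | P i) F i t) k = \sum_(i <- r | P i) coefT (F i) k.
Proof.
move=> cF; elim: r => [|i r IH].
  rewrite big_nil -[RHS](coefT0 k); apply: coefT_eqI.
    by apply: (@contI_sum _ nil).
  by move=> t _; rewrite big_nil.
rewrite big_cons; case: ifP => Pi.
  rewrite -IH -coefTD//; last exact: contI_sum.
  apply: coefT_eqI; first exact: (@contI_sum _ (i :: r)).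
  by move=> t _; rewrite big_cons Pi.
rewrite -IH; apply: coefT_eqI; first exact: (@contI_sum _ (i :: r)).
by move=> t _; rewrite big_cons Pi.
Qed.

Lemma nk_le1 k : nk k <= 1 :> R.
Proof.
rewrite -(ler_pXn2r (n := 2))// ?nnegrE ?nk_ge0//.
rewrite nk_sqr expr1n ler_pdivrMr ?pi_gt0// mul1r.
by have := @pi_ge2 R; case: ifP => _; lra.
Qed.

Lemma coefT_bound f k (M : R) : contI f -> (forall t, Iset t -> cabs (f t) <= M) ->
  cabs (coefT f k) <= M * pi.
Proof.
move=> cf fM; rewrite coefTE// cabsM cabs_real ger0_norm ?nk_ge0//.
rewrite -[leRHS]mul1r ler_pM ?nk_ge0 ?nk_le1 ?cabs_ge0//.
rewrite -[X in _ * X](subr0 pi); apply: cont_cint_abs => //.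
- exact: pi_ge0.
- exact: ccont_coef.
move=> x _; rewrite cabsM cabs_real -[leRHS]mulr1.
by rewrite ler_pM ?cabs_ge0 ?fM//; [exact: Iset_cos|exact: cos_max].
Qed.

Lemma coefT_cheb j k : coefT (polfun (chebp j)) k = ((j == k)%:R / nk k)%:C.
Proof.
have nk0 l : nk l != 0 :> R by rewrite gt_eqF ?nk_gt0.
rewrite coefTE; last exact: contI_polfun.
have h : \int[lebesgue_measure]_(x in `[0, pi])
    (cos (j%:R * x) * cos (k%:R * x)) = (j == k)%:R / (nk j * nk k) :> R.
  apply: (mulIf (mulf_neq0 (nk0 j) (nk0 k))).
  rewrite divfK ?mulf_neq0// mulrC -cont_RintZ; last by cnt.
  transitivity (\int[lebesgue_measure]_(x in `[0, pi]) (cosn j x * cosn k x : R)).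
    by apply: eq_Rint => x _; rewrite /cosn; ring.
  case: (leqP j k) => jk; first by rewrite cosn_orthonormal.
  rewrite eq_sym -(cosn_orthonormal (ltnW jk)).
  by apply: eq_Rint => x _; rewrite mulrC.
transitivity ((nk k)%:C * (\int[lebesgue_measure]_(x in `[0, pi])
    (cos (j%:R * x) * cos (k%:R * x)))%:C : R[i]).
  congr (_ * _); rewrite /cint; apply: complex_ext => /=.
    apply: eq_Rint => x _; have [-> _] := chebp_cos j x.
    by rewrite ReM /= mulr0 subr0.
  rewrite -[RHS](mul0r (pi - 0)) -Rint_cst ?pi_ge0//; apply: eq_Rint => x _.
  by have [-> _] := chebp_cos j x; rewrite ImM /= mulr0 mul0r addr0.
rewrite h -rmorphM /=; congr (_%:C); case: eqP => [->|_].
  by field; rewrite nk0.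
by rewrite !mul0r mulr0.
Qed.

Lemma coefT_poly_high n p k : (size p <= n)%N -> (n <= k)%N ->
  coefT (polfun p) k = 0.
Proof.
move=> /chebp_span[d ->] nk.
rewrite (@coefT_eqI _ (fun t => \sum_(j < n) d j * polfun (chebp j) t)).
- rewrite coefT_sum => [|i]; last exact/contIZ/contI_polfun.
  apply: big1 => j _; rewrite coefTZ; last exact: contI_polfun.
  by rewrite coefT_cheb (ltn_eqF (leq_trans (ltn_ord j) nk)) mul0r mulr0.
- exact: contI_polfun.
- move=> t _; rewrite /polfun horner_sum; apply: eq_bigr => j _.
  by rewrite hornerZ.
Qed.

Lemma ReIm_coefT f k : contI f ->
  (complex.Re (coefT f k) = \int[lebesgue_measure]_(x in `[0, pi])
    (complex.Re (f (cos x)) * cosn k x)) *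
  (complex.Im (coefT f k) = \int[lebesgue_measure]_(x in `[0, pi])
    (complex.Im (f (cos x)) * cosn k x)).
Proof.
move=> cf; have [d1 d2] := ccont_ReIm (ccont_comp_cos cf).
rewrite coefTE// /cint ReZ ImZ /=; split.
  rewrite -cont_RintZ; last first.
    under eq_fun do rewrite ReM /= mulr0 subr0.
    by apply: cont_mul => //; exact: cont_cosn.
  by apply: eq_Rint => x _; rewrite ReM /= mulr0 subr0 /cosn; ring.
rewrite -cont_RintZ; last first.
  under eq_fun do rewrite ImM /= mulr0 add0r.
  by apply: cont_mul => //; exact: cont_cosn.
by apply: eq_Rint => x _; rewrite ImM /= mulr0 add0r /cosn; ring.
Qed.

(** Completeness of the Chebyshev polynomials, applied to the real and to the
    imaginary part. *)
Lemma coefT_eq0 f : contI f -> (forall k, coefT f k = 0) -> eqI f (fun=> 0).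
Proof.
move=> cf f0 t It; have [c1 c2] := contI_ReIm cf.
have nk0 l : nk l != 0 :> R by rewrite gt_eqF ?nk_gt0.
apply: complex_ext => /=.
  apply: (cheb_complete c1) => // k.
  apply: (mulfI (nk0 k)); rewrite mulr0 -cont_RintZ; last first.
    by apply: cont_mul; [exact: within_comp_cos c1|exact: cont_cosn].
  transitivity (complex.Re (coefT f k)); last by rewrite f0.
  by rewrite ReIm_coefT//; apply: eq_Rint => x _; rewrite /cosn /=; ring.
apply: (@cheb_complete _ _ c2) => // k.
apply: (mulfI (nk0 k)); rewrite mulr0 -cont_RintZ; last first.
  by apply: cont_mul; [exact: within_comp_cos c2|exact: cont_cosn].
transitivity (complex.Im (coefT f k)); last by rewrite f0.
by rewrite ReIm_coefT//; apply: eq_Rint => x _; rewrite /cosn /=; ring.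
Qed.

(** For a continuous function the integrability condition in [H1] is automatic,
    because the substitution [t = cos x] turns its integral into the integral of
    a continuous function on a segment. *)
Lemma contI_L2w f : contI f -> L2w f.
Proof.
move=> cf; have [c1 c2] := contI_ReIm cf.
have mI : measurable (@Iset R) by exact: measurable_itv.
split.
- exact: subspace_continuous_measurable_fun.
- exact: subspace_continuous_measurable_fun.
have cu : {within @Iset R, continuous (fun t => cabs (f t) ^+ 2)}.
  move=> x; under eq_fun do rewrite cabs_sqr !expr2.
  by apply: cvgD; [exact: cvgM (c1 x) (c1 x)|exact: cvgM (c2 x) (c2 x)].
rewrite subst_cos_ge0//; last by move=> t _; exact: sqr_ge0.
have := cont_integrable 0 pi (within_comp_cos cu).
move=> /integrableP[_]; apply: le_lt_trans.
rewrite le_eqVlt; apply/orP; left; apply/eqP; apply: eq_integral => x _ /=.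
by rewrite ger0_norm// sqr_ge0.
Qed.

End chebyshev_polynomials.

(** * The coefficient space l2 *)

Section ell2.
Context {R : realType}.
Implicit Types (c d : nat -> R[i]).

Local Notation sq c := (fun k => (cabs (c k)) ^+ 2).

Lemma series_sq_ge0 c n : 0 <= series (sq c) n.
Proof. by rewrite /series/= sumr_ge0// => k _; exact: sqr_ge0. Qed.

Lemma series_sq_nd c : nondecreasing_seq (series (sq c)).
Proof. by apply: nondecreasing_series => k _ _; exact: sqr_ge0. Qed.

Lemma l2_bound c (M : R) : 0 <= M -> (forall n, series (sq c) n <= M ^+ 2) ->
  l2 c /\ l2norm c <= M.
Proof.
move=> M0 h.
have cv : cvgn (series (sq c)).
  apply: nondecreasing_is_cvgn; first exact: series_sq_nd.
  by exists (M ^+ 2) => _ [n _ <-].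
split=> //; rewrite /l2norm -(ger0_norm M0) -sqrtr_sqr ler_wsqrtr//.
by apply: limr_le => //; apply: nearW.
Qed.

Lemma l2norm_ge0 c : 0 <= l2norm c. Proof. exact: sqrtr_ge0. Qed.

Lemma l2_psum c n : l2 c -> series (sq c) n <= l2norm c ^+ 2.
Proof.
move=> cv; have h := nondecreasing_cvgn_le (@series_sq_nd c) cv n.
by rewrite sqr_sqrtr// (le_trans _ h)// series_sq_ge0.
Qed.

Lemma l2norm_sqr c : l2 c -> l2norm c ^+ 2 = limn (series (sq c)).
Proof.
move=> cv; have h := nondecreasing_cvgn_le (@series_sq_nd c) cv 0%N.
by rewrite sqr_sqrtr// (le_trans _ h)// series_sq_ge0.
Qed.

Lemma l2_coord c k : l2 c -> cabs (c k) <= l2norm c.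
Proof.
move=> cv; rewrite -(ler_pXn2r (n := 2))// ?nnegrE ?cabs_ge0 ?l2norm_ge0//.
apply: le_trans (l2_psum k.+1 cv); rewrite /series/= big_nat_recr//= lerDr.
exact: (series_sq_ge0 c k).
Qed.

Lemma l2_le c d : (forall k, cabs (c k) <= cabs (d k)) -> l2 d ->
  l2 c /\ l2norm c <= l2norm d.
Proof.
move=> h ld; apply: l2_bound; first exact: l2norm_ge0.
move=> n; apply: le_trans (l2_psum n ld); apply: ler_sum => k _.
by rewrite ler_pXn2r// nnegrE cabs_ge0.
Qed.

Lemma l2_eq c d : c =1 d -> l2 c -> l2 d.
Proof. by move=> /funext ->. Qed.

Lemma l2norm_eq0 c : l2 c -> l2norm c = 0 -> c =1 (fun=> 0).
Proof.
move=> lc c0 k; apply: cabs0_eq0; apply/eqP; rewrite eq_le cabs_ge0 andbT.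
by rewrite -c0 l2_coord.
Qed.

(** Young's inequality [2 x y <= t x^2 + y^2 / t] with the optimal [t] gives
    Minkowski's inequality without passing through Cauchy-Schwarz. *)
Lemma l2D c d : l2 c -> l2 d ->
  l2 (fun k => c k + d k) /\ l2norm (fun k => c k + d k) <= l2norm c + l2norm d.
Proof.
move=> lc ld; have [c0|c0] := eqVneq (l2norm c) 0.
  rewrite c0 add0r; apply: l2_le => // k.
  by rewrite (l2norm_eq0 lc c0) add0r.
have [d0|d0] := eqVneq (l2norm d) 0.
  rewrite d0 addr0; apply: l2_le => // k.
  by rewrite (l2norm_eq0 ld d0) addr0.
have A0 : 0 < l2norm c by rewrite lt_def c0 l2norm_ge0.
have B0 : 0 < l2norm d by rewrite lt_def d0 l2norm_ge0.
apply: l2_bound; first by rewrite addr_ge0// ltW.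
move=> n; have hc := l2_psum n lc; have hd := l2_psum n ld.
set A := l2norm c in A0 hc *; set B := l2norm d in B0 hd *.
have step (x y : R) : (x + y) ^+ 2 <= (1 + B / A) * x ^+ 2 + (1 + A / B) * y ^+ 2.
  rewrite -subr_ge0.
  have -> : (1 + B / A) * x ^+ 2 + (1 + A / B) * y ^+ 2 - (x + y) ^+ 2 =
    (B * x - A * y) ^+ 2 / (A * B).
    by field; rewrite !gt_eqF.
  by rewrite divr_ge0 ?sqr_ge0// mulr_ge0 ?ltW.
have : series (sq (fun k => c k + d k)) n <=
    (1 + B / A) * series (sq c) n + (1 + A / B) * series (sq d) n.
  rewrite /series/= !mulr_sumr -big_split; apply: ler_sum => k _ /=.
  apply: le_trans (step _ _); rewrite ler_pXn2r ?nnegrE ?cabs_ge0//.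
    exact: cabsD.
  by rewrite addr_ge0 ?cabs_ge0.
move/le_trans; apply.
have -> : (A + B) ^+ 2 = (1 + B / A) * A ^+ 2 + (1 + A / B) * B ^+ 2.
  by field; rewrite !gt_eqF.
by rewrite lerD// ler_wpM2l// addr_ge0// divr_ge0// ltW.
Qed.

Lemma l2Z (a : R[i]) c : l2 c ->
  l2 (fun k => a * c k) /\ l2norm (fun k => a * c k) = cabs a * l2norm c.
Proof.
move=> lc.
have hser n : series (sq (fun k => a * c k)) n = cabs a ^+ 2 * series (sq c) n.
  by rewrite /series/= mulr_sumr; apply: eq_bigr => k _; rewrite cabsM exprMn.
have [h1 h2] : l2 (fun k => a * c k) /\ l2norm (fun k => a * c k) <= cabs a * l2norm c.
  apply: l2_bound; first by rewrite mulr_ge0 ?cabs_ge0 ?l2norm_ge0.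
  by move=> n; rewrite hser exprMn ler_wpM2l ?sqr_ge0// l2_psum.
split=> //; apply/eqP; rewrite eq_le h2/=.
have [->|a0] := eqVneq a 0; first by rewrite cabs0 mul0r l2norm_ge0.
have ca := cabs_gt0 a0; rewrite -ler_pdivlMl//.
have [] // := @l2_bound c ((cabs a)^-1 * l2norm (fun k => a * c k)).
  by rewrite mulr_ge0 ?l2norm_ge0// invr_ge0 ltW.
move=> n; rewrite exprMn exprVn ler_pdivlMl ?exprn_gt0//.
by rewrite -hser l2_psum.
Qed.

Lemma l2_finite c N : (forall k, (N <= k)%N -> c k = 0) ->
  l2 c /\ l2norm c ^+ 2 = \sum_(k < N) cabs (c k) ^+ 2.
Proof.
move=> c0; set S := \sum_(k < N) _.
have S0 : 0 <= S by apply: sumr_ge0 => *; exact: sqr_ge0.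
have hS n : (N <= n)%N -> series (sq c) n = S.
  move=> Nn; rewrite /series/= (big_cat_nat (n := N))//=.
  rewrite big_mkord [X in _ + X]big_nat_cond [X in _ + X]big1 ?addr0//.
  by move=> k; rewrite andbT => /andP[Nk _]; rewrite c0// cabs0 expr0n.
have cS : series (sq c) @ \oo --> S.
  by apply: cvg_near_cst; exists N => // n /= /hS.
split; first by apply/cvg_ex; exists S.
rewrite l2norm_sqr; last by apply/cvg_ex; exists S.
exact/cvg_lim.
Qed.

(** The bound on the tail depends only on the majorant: for series of functions
    it gives uniform convergence. *)
Lemma abs_series (u : nat -> R[i]) (M : nat -> R) :
  (forall k, cabs (u k) <= M k) -> cvgn (series M) ->
  exists l, forall n,
    cabs (l - \sum_(k < n) u k) <= 2 * (limn (series M) - series M n).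
Proof.
move=> uM cM.
have M0 k : 0 <= M k by apply: le_trans (uM k); exact: cabs_ge0.
have ndM : nondecreasing_seq (series M) by apply: nondecreasing_series.
have real (a : nat -> R) : (forall k, `|a k| <= M k) -> exists l, forall n,
    `|l - \sum_(k < n) a k| <= limn (series M) - series M n.
  move=> aM.
  have cva : cvgn (series a).
    apply: normed_cvg; apply: (series_le_cvg _ M0 aM cM) => k; exact: normr_ge0.
  exists (limn (series a)) => n.
  have close m : (n <= m)%N -> `|series a m - series a n| <=
      limn (series M) - series M n.
    move=> nm; have : series M m - series M n <= limn (series M) - series M n.
      by rewrite lerD2r; exact: nondecreasing_cvgn_le.
    apply: le_trans; rewrite !sub_series_geq//.
    by apply: le_trans (ler_norm_sum _ _ _) _; apply: ler_sum.
  rewrite (_ : \sum_(k < n) a k = series a n); last by rewrite /series/= big_mkord.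
  have : `|series a m - series a n| @[m --> \oo] -->
     `|limn (series a) - series a n|.
    by apply: cvg_norm; apply: cvgB => //; exact: cvg_cst.
  move/cvg_lim => <-//.
  apply: limr_le; last by exists n => // m /= /close.
  apply/cvg_ex; exists `|limn (series a) - series a n|.
  by apply: cvg_norm; apply: cvgB => //; exact: cvg_cst.
have [l1 h1] := real (fun k => complex.Re (u k))
  (fun k => le_trans (Re_le_cabs _) (uM k)).
have [l2 h2] := real (fun k => complex.Im (u k))
  (fun k => le_trans (Im_le_cabs _) (uM k)).
exists (l1 +i* l2) => n; apply: le_trans (cabs_le_ReIm _) _.
rewrite ReB ImB Re_sum Im_sum mulr_natl mulr2n.
by apply: lerD; [exact: h1|exact: h2].
Qed.

Lemma tail_cvg0 (M : nat -> R) (e : R) : cvgn (series M) -> 0 < e ->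
  exists n0, forall n, (n0 <= n)%N -> `|limn (series M) - series M n| < e.
Proof.
move=> cM e0; have /cvgrPdist_lt/(_ _ e0)[n0 _ h] := cM.
by exists n0 => n nn; apply: h.
Qed.

End ell2.

(** * H1 as an isometric copy of l2 *)

Section H1_space.
Context {R : realType}.
Implicit Types (f g : R -> R[i]) (c d : nat -> R[i]).

(** Coordinates in the orthonormal basis [Ttilde]. *)
Definition kap f (k : nat) : R[i] := k.+1%:R * coefT f k.

Lemma cabs_kap f k : cabs (kap f k) ^+ 2 = k.+1%:R ^+ 2 * cabs (coefT f k) ^+ 2.
Proof. by rewrite /kap cabsM cabs_nat exprMn. Qed.

(** Membership in H1 is a condition on the coordinates alone. *)
Lemma H1P f : H1 f <-> contI f /\ l2 (kap f).
Proof.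
rewrite /H1/= /l2/=; split.
  move=> [cf _ h]; split; first by [].
  by under eq_fun do rewrite cabs_kap.
move=> [cf h]; split; [by case: cf|exact: contI_L2w|].
by under eq_fun do rewrite -cabs_kap.
Qed.

Lemma cvg_complex (u : nat -> R) (l : R) : u @ \oo --> l ->
  ((fun n => (u n)%:C) : nat -> R[i]^o) @ \oo --> (l%:C : R[i]^o).
Proof. by move=> ul; apply/cvg_ReImP; split => //=; exact: cvg_cst. Qed.

Lemma conjc_mul (z : R[i]) : conjc z * z = (cabs z ^+ 2)%:C.
Proof.
by rewrite cabs_sqr; case: z => a b; apply: complex_ext => /=; ring.
Qed.

Lemma H1norm_kap f : l2 (kap f) -> H1norm f = l2norm (kap f).
Proof.
move=> lf; rewrite /H1norm /H1inner /l2norm.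
rewrite (_ : (fun k => _) = fun k => (cabs (kap f k) ^+ 2)%:C); last first.
  apply/funext => k; rewrite conjc_mul cabs_kap [RHS]rmorphM.
  by rewrite [in RHS]rmorphXn [in RHS]rmorph_nat.
have h : (series (fun k => (cabs (kap f k) ^+ 2)%:C : R[i]) : nat -> R[i]^o) @ \oo -->
    ((limn (series (fun k => cabs (kap f k) ^+ 2)))%:C : R[i]^o).
  rewrite (_ : series _ = fun n => (series (fun k => cabs (kap f k) ^+ 2) n)%:C).
    exact: cvg_complex.
  by apply/funext => n; rewrite /series/= rmorph_sum.
by rewrite (cvg_lim _ h)//; exact: norm_hausdorff.
Qed.

Lemma kapD f g k : contI f -> contI g ->
  kap (fun t => f t + g t) k = kap f k + kap g k.
Proof. by move=> cf cg; rewrite /kap coefTD// mulrDr. Qed.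
Lemma kapB f g k : contI f -> contI g ->
  kap (fun t => f t - g t) k = kap f k - kap g k.
Proof. by move=> cf cg; rewrite /kap coefTB// mulrBr. Qed.
Lemma kapZ (a : R[i]) f k : contI f -> kap (fun t => a * f t) k = a * kap f k.
Proof. by move=> cf; rewrite /kap coefTZ// mulrCA. Qed.
Lemma kap_eqI f g k : contI f -> eqI f g -> kap f k = kap g k.
Proof. by move=> cf fg; rewrite /kap (coefT_eqI _ cf fg). Qed.
Lemma kap_sum (I : Type) (r : seq I) (P : pred I) (F : I -> R -> R[i]) k :
  (forall i, contI (F i)) ->
  kap (fun t => \sum_(i <- r | P i) F i t) k = \sum_(i <- r | P i) kap (F i) k.
Proof. by move=> cF; rewrite /kap coefT_sum// mulr_sumr. Qed.

Lemma kap_inj f g : contI f -> contI g -> kap f =1 kap g -> eqI f g.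
Proof.
move=> cf cg h t It; apply/eqP; rewrite -subr_eq0; apply/eqP.
apply: (coefT_eq0 (contIB cf cg)) => // k.
apply: (mulfI (_ : k.+1%:R != 0)); first by rewrite pnatr_eq0.
by rewrite mulr0 coefTB// mulrBr -!/(kap _ _) h subrr.
Qed.

Lemma H1_contI f : H1 f -> contI f. Proof. by case/H1P. Qed.
Lemma H1_l2 f : H1 f -> l2 (kap f). Proof. by case/H1P. Qed.
Lemma H1normE f : H1 f -> H1norm f = l2norm (kap f).
Proof. by move/H1_l2/H1norm_kap. Qed.

Lemma H1_eqI f g : H1 f -> eqI f g -> H1 g.
Proof.
move=> /H1P[cf lf] fg; apply/H1P; split; first exact: contI_eqI fg cf.
by apply: l2_eq lf => k; exact: kap_eqI.
Qed.

Lemma H1norm_eqI f g : H1 f -> eqI f g -> H1norm f = H1norm g.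
Proof.
move=> hf fg; rewrite (H1normE hf) (H1normE (H1_eqI hf fg)).
by congr l2norm; apply/funext => k; apply: kap_eqI => //; exact: H1_contI.
Qed.

Lemma H1D f g : H1 f -> H1 g -> H1 (fun t => f t + g t) /\
  H1norm (fun t => f t + g t) <= H1norm f + H1norm g.
Proof.
move=> hf hg; have [cf lf] := iffLR (H1P f) hf; have [cg lg] := iffLR (H1P g) hg.
have [h1 h2] := l2D lf lg.
have e : kap (fun t => f t + g t) = fun k => kap f k + kap g k.
  by apply/funext => k; rewrite kapD.
have h : H1 (fun t => f t + g t) by apply/H1P; rewrite e; split => //; exact: contID.
by split=> //; rewrite !H1normE// e.
Qed.

Lemma H1Z (a : R[i]) f : H1 f -> H1 (fun t => a * f t) /\
  H1norm (fun t => a * f t) = cabs a * H1norm f.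
Proof.
move=> hf; have [cf lf] := iffLR (H1P f) hf.
have [h1 h2] := l2Z a lf.
have e : kap (fun t => a * f t) = fun k => a * kap f k.
  by apply/funext => k; rewrite kapZ.
have h : H1 (fun t => a * f t) by apply/H1P; rewrite e; split => //; exact: contIZ.
by split=> //; rewrite !H1normE// e.
Qed.

Lemma H1B f g : H1 f -> H1 g -> H1 (fun t => f t - g t) /\
  H1norm (fun t => f t - g t) <= H1norm f + H1norm g.
Proof.
move=> hf hg; have [hg1 hg2] := H1Z (-1) hg; have [h1 h2] := H1D hf hg1.
have e : eqI (fun t => f t + -1 * g t) (fun t => f t - g t).
  by move=> t _; rewrite mulN1r.
split; first exact: H1_eqI e.
by rewrite -(H1norm_eqI h1 e); apply: le_trans h2 _; rewrite hg2 cabsN cabs1 mul1r.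
Qed.

Lemma H1norm_ge0 f : 0 <= H1norm f. Proof. exact: sqrtr_ge0. Qed.

Lemma H1_polfun p : H1 (polfun p : R -> R[i]).
Proof.
apply/H1P; split; first exact: contI_polfun.
have [] // := @l2_finite _ (kap (polfun p)) (size p).
by move=> k hk; rewrite /kap (coefT_poly_high (leqnn _) hk) mulr0.
Qed.

Lemma contI_Ttilde k : contI (Ttilde k : R -> R[i]).
Proof.
apply: contIZ.
have e : eqI (fun t => (nk k)%:C * polfun (chebp k) t) (That k : R -> R[i]).
  by move=> t It; rewrite polfun_cheb// -rmorphM.
by apply: contI_eqI e _; apply: contIZ; exact: contI_polfun.
Qed.

Lemma TtildeE k (t : R) : Iset t ->
  Ttilde k t = (nk k / k.+1%:R)%:C * polfun (chebp k) t.
Proof.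
move=> It; rewrite /Ttilde /That polfun_cheb// -/(nk k) !rmorphM /= fmorphV.
by rewrite rmorph_nat; ring.
Qed.

Lemma kap_Ttilde j k : kap (Ttilde j) k = (j == k)%:R :> R[i].
Proof.
have cp : contI (fun t : R => (nk j / j.+1%:R)%:C * polfun (chebp j) t).
  by apply: contIZ; exact: contI_polfun.
rewrite -(@kap_eqI (fun t => (nk j / j.+1%:R)%:C * polfun (chebp j) t))//; last first.
  by move=> t It; rewrite TtildeE.
rewrite kapZ; last exact: contI_polfun.
rewrite /kap coefT_cheb -(rmorph_nat (real_complex R) k.+1) -!rmorphM /=.
rewrite -(rmorph_nat (real_complex R)); congr (_%:C).
case: eqP => [->|_]; last by rewrite mul0r !mulr0.
by field; rewrite gt_eqF ?nk_gt0// nat1r pnatr_eq0.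
Qed.

Lemma kap_comb c n k : kap (fun t => \sum_(j < n) c j * Ttilde j t) k =
  if (k < n)%N then c k else 0.
Proof.
rewrite (@kap_sum _ _ _ (fun (j : 'I_n) t => c j * Ttilde j t)); last first.
  by move=> j; apply: contIZ; exact: contI_Ttilde.
case: ifP => hk.
  rewrite (bigD1 (Ordinal hk))//= big1 ?addr0 => [|j jk].
    by rewrite kapZ ?kap_Ttilde ?eqxx ?mulr1//; exact: contI_Ttilde.
  rewrite kapZ ?kap_Ttilde; last exact: contI_Ttilde.
  by case: eqP => [e|_]; [case/eqP: jk; exact: val_inj|rewrite mulr0].
rewrite big1// => j _; rewrite kapZ ?kap_Ttilde; last exact: contI_Ttilde.
by case: eqP => [e|_]; [move: hk; rewrite -e ltn_ord|rewrite mulr0].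
Qed.

Lemma cabs_Ttilde k (t : R) : Iset t -> cabs (Ttilde k t : R[i]) <= nk k / k.+1%:R.
Proof.
move=> It; rewrite /Ttilde /That cabsM cabsV cabs_nat cabs_real -/(nk k) mulrC.
rewrite ler_wpM2r ?invr_ge0// normrM ger0_norm ?nk_ge0//.
by rewrite -[leRHS]mulr1 ler_wpM2l ?nk_ge0// cos_max.
Qed.

(** The squares of the sup norms of the basis functions have sum at most
    [1/pi + (2/pi) * 1], by telescoping [1/(k+1)^2 <= 1/k - 1/(k+1)]. *)
Lemma sum_Ttilde_sup n : \sum_(k < n) (nk k / k.+1%:R) ^+ 2 <= 3 / pi :> R.
Proof.
have p0 := pi_gt0 R.
case: n => [|n]; first by rewrite big_ord0 divr_ge0// ltW.
suff : \sum_(k < n.+1) (nk k / k.+1%:R) ^+ 2 <= (3 - 2 / n.+1%:R) / pi :> R.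
  move/le_trans; apply; apply: ler_wpM2r; first by rewrite invr_ge0 ltW.
  by rewrite gerBl divr_ge0.
elim: n => [|n IH].
  by rewrite big_ord1 expr_div_n nk_sqr/= expr1n !divr1; apply: ler_wpM2r;
    [by rewrite invr_ge0 ltW|lra].
rewrite big_ord_recr /= (le_trans (lerD IH (lexx _)))//.
rewrite expr_div_n nkS mulrAC -mulrDl; apply: ler_wpM2r.
  by rewrite invr_ge0 ltW.
have n1 : 0 < n.+1%:R :> R by [].
rewrite -[n.+2%:R]natr1; set m := n.+1%:R in n1 *.
rewrite -subr_ge0.
have -> : 3 - 2 / (m + 1) - (3 - 2 / m + 2 / (m + 1) ^+ 2) =
   2 / (m * (m + 1) ^+ 2) :> R.
  by field; rewrite !gt_eqF// ltr_wpDr.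
by rewrite divr_ge0// mulr_ge0 ?ltW// exprn_gt0// ltr_wpDr.
Qed.

Lemma CS_sum (x y : nat -> R) n :
  (\sum_(k < n) x k * y k) ^+ 2 <=
  (\sum_(k < n) x k ^+ 2) * (\sum_(k < n) y k ^+ 2).
Proof.
set X := \sum_(k < n) x k ^+ 2; set Y := \sum_(k < n) y k ^+ 2.
set P := \sum_(k < n) x k * y k.
have X0 : 0 <= X by apply: sumr_ge0 => *; exact: sqr_ge0.
have quad (s : R) : 0 <= X * s ^+ 2 - 2 * P * s + Y.
  have -> : X * s ^+ 2 - 2 * P * s + Y = \sum_(k < n) (x k * s - y k) ^+ 2.
    rewrite /X /P /Y mulr_sumr !mulr_suml -sumrB -big_split /=.
    by apply: eq_bigr => k _; ring.
  by apply: sumr_ge0 => *; exact: sqr_ge0.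
have [X00|Xn0] := eqVneq X 0.
  have -> : P = 0.
    rewrite /P big1// => k _; have /eqP := X00.
    rewrite psumr_eq0; last by move=> *; exact: sqr_ge0.
    by move=> /allP/(_ k); rewrite mem_index_enum expf_eq0/= => /(_ isT)/eqP ->;
      rewrite mul0r.
  by rewrite X00 expr0n mul0r.
have Xp : 0 < X by rewrite lt_def Xn0.
have := quad (P / X).
have -> : X * (P / X) ^+ 2 - 2 * P * (P / X) + Y = (X * Y - P ^+ 2) / X.
  by field.
by rewrite pmulr_lge0 ?invr_gt0// subr_ge0.
Qed.

End H1_space.

Section synthesis.
Context {R : realType}.
Implicit Types (f g F : R -> R[i]) (c d : nat -> R[i]).

Lemma contI_ulim F (f : nat -> R -> R[i]) : (forall n, contI (f n)) ->
  (forall e, 0 < e -> exists n, forall t, Iset t -> cabs (F t - f n t) < e) ->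
  contI F.
Proof.
move=> cf hF; split; rewrite /CI/= continuous_subspace_in => x; rewrite inE => Ix.
apply/cvg_cabsP; apply/cvgrPdist_lt => e e0.
have e3 : 0 < e / 3 by rewrite divr_gt0.
have [n hn] := hF _ e3.
have [cn] := cf n; have /cvg_cabsP/cvgrPdist_lt/(_ _ e3) := cn x.
rewrite /nbhs/= -(nbhs_subspace_in Ix).
rewrite !near_withinE => h0; apply: filterS h0 => y h1 Iy; have {}h1 := h1 Iy.
rewrite sub0r normrN ger0_norm ?cabs_ge0// in h1.
rewrite sub0r normrN ger0_norm ?cabs_ge0//.
rewrite /from_subspace in h1 *.
have h2 := hn _ Iy; have h3 := hn _ Ix; rewrite cabsB in h3.
apply: le_lt_trans (cabs_dist _ (f n y) _) _.
have := cabs_dist (f n y) (f n x) (F x); lra.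
Qed.

Lemma ler_addeps (x y : R) : (forall e, 0 < e -> x <= y + e) -> x <= y.
Proof. by move=> h; apply/ler_addgt0Pr. Qed.

(** Surjectivity of the coordinate map. The sup norms of the basis functions are
    square summable, so by Cauchy-Schwarz the series with coefficients in l2
    converges uniformly; its coordinates can then be computed term by term. *)
Lemma H1_synth c : l2 c -> exists F, [/\ H1 F, kap F =1 c &
  forall t, Iset t -> cabs (F t) <= Num.sqrt (3 / pi) * l2norm c].
Proof.
move=> lc; pose b k : R := nk k / k.+1%:R; pose M k := cabs (c k) * b k.
have b0 k : 0 <= b k by rewrite divr_ge0 ?nk_ge0.
have M0 k : 0 <= M k by rewrite mulr_ge0 ?cabs_ge0.
pose B := Num.sqrt (3 / pi) * l2norm c.
have B0 : 0 <= B by rewrite mulr_ge0 ?sqrtr_ge0 ?l2norm_ge0.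
have SM n : series M n <= B.
  rewrite -(ler_pXn2r (n := 2))// ?nnegrE//; last first.
    by rewrite /series/= sumr_ge0.
  rewrite /series/= big_mkord.
  apply: le_trans (CS_sum (fun k => cabs (c k)) b n) _.
  rewrite mulrC exprMn sqr_sqrtr ?divr_ge0 ?pi_ge0// ler_pM//.
  - by apply: sumr_ge0 => *; exact: sqr_ge0.
  - by apply: sumr_ge0 => *; exact: sqr_ge0.
  - exact: sum_Ttilde_sup.
  - by have := l2_psum n lc; rewrite /series/= big_mkord.
have cM : cvgn (series M).
  apply: nondecreasing_is_cvgn; first exact: nondecreasing_series.
  by exists B => _ [n _ <-].
have hT k (t : R) : Iset t -> cabs (c k * Ttilde k t) <= M k.
  by move=> It; rewrite cabsM ler_wpM2l ?cabs_ge0// cabs_Ttilde.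
have /choice[F hF] : forall t : R, exists l, Iset t -> forall n,
    cabs (l - \sum_(k < n) c k * Ttilde k t) <= 2 * (limn (series M) - series M n).
  move=> t; have [It|nIt] := pselect (Iset t); last by exists 0.
  have [l hl] := abs_series (fun k => hT k t It) cM.
  by exists l.
pose f n t := \sum_(k < n) c k * Ttilde k t : R[i].
have cf n : contI (f n) by apply: contI_sum => k; apply: contIZ; exact: contI_Ttilde.
have unif e : 0 < e -> exists n0, forall n, (n0 <= n)%N -> forall t, Iset t ->
    cabs (F t - f n t) < e.
  move=> e0; have e2 : 0 < e / 2 by rewrite divr_gt0.
  have [n0 h] := tail_cvg0 cM e2; exists n0 => n nn t It.
  apply: le_lt_trans (hF t It n) _.
  have := le_lt_trans (ler_norm _) (h n nn); lra.
have cF : contI F.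
  apply: (contI_ulim cf) => e e0; have [n0 h] := unif e e0.
  by exists n0; exact: h.
have kF : kap F =1 c.
  move=> k; apply/eqP; rewrite -subr_eq0; apply/eqP; apply: cabs0_eq0.
  apply/eqP; rewrite eq_le cabs_ge0 andbT; apply: ler_addeps => e e0; rewrite add0r.
  pose K : R := k.+1%:R * pi.
  have K0 : 0 < K by rewrite mulr_gt0// pi_gt0.
  have eK : 0 < e / K by rewrite divr_gt0.
  have [n0 h] := unif _ eK.
  pose n := maxn n0 k.+1.
  have -> : c k = kap (f n) k.
    by rewrite kap_comb leq_max leqnn orbT.
  rewrite -kapB// /kap cabsM cabs_nat.
  have : cabs (coefT (fun t => F t - f n t) k) <= e / K * pi.
    apply: coefT_bound; first exact: contIB.
    by move=> t It; apply: ltW; apply: h => //; rewrite leq_max leqnn.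
  rewrite -(ler_pM2l (_ : 0 < k.+1%:R)) // => /le_trans; apply.
  have -> : k.+1%:R * (e / K * pi) = e / K * K by rewrite {3}/K; ring.
  by rewrite divfK ?gt_eqF.
exists F; split=> //.
  by apply/H1P; split=> //; apply: l2_eq lc => k; rewrite kF.
move=> t It; apply: ler_addeps => e e0.
have [n0 h] := unif _ e0.
have := h _ (leqnn _) t It; have := cabs_le_dist (F t) (f n0 t).
have : cabs (f n0 t) <= B.
  apply: le_trans (cabs_sum _ _ _) _; apply: le_trans (SM n0).
  by rewrite /series/= big_mkord; apply: ler_sum => k _; exact: hT.
rewrite -/B; lra.
Qed.

(** H1 embeds in the continuous functions. *)
Lemma H1_sup f t : H1 f -> Iset t -> cabs (f t) <= Num.sqrt (3 / pi) * H1norm f.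
Proof.
move=> hf It; have [F [hF kF sF]] := H1_synth (H1_l2 hf).
have fF : eqI f F.
  by apply: kap_inj (H1_contI hf) (H1_contI hF) _ => k; rewrite kF.
by rewrite (fF t It) (H1normE hf); exact: sF.
Qed.

Lemma H1norm_eq0 f : H1 f -> H1norm f = 0 -> eqI f (fun=> 0).
Proof.
move=> hf f0 t It; apply: cabs0_eq0; apply/eqP; rewrite eq_le cabs_ge0 andbT.
by have := H1_sup hf It; rewrite f0 mulr0.
Qed.

End synthesis.

(** * Smooth functions are in H1 *)

Section H1_C1.
Context {R : realType}.
Local Notation mu := (@lebesgue_measure R).

(** Integration by parts: the cosine coefficients of [u (cos x)] times the
    frequency are the sine coefficients of its derivative. *)
Lemma cosn_by_parts (u du : R -> R) (k : nat) : {within Iset, continuous u} ->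
  {within Iset, continuous du} ->
  (forall t : R, -1 < t < 1 -> is_derive t (1 : R) u (du t)) ->
  k.+1%:R * \int[mu]_(x in `[0, pi]) (u (cos x) * cosn k.+1 x) =
  \int[mu]_(x in `[0, pi]) (du (cos x) * sin x * sinn k x).
Proof.
move=> cu cdu du1.
have cuc := within_comp_cos cu; have cduc := within_comp_cos cdu.
have csin : continuous (fun x : R => sin x) by exact: continuous_sin.
pose F (x : R) := u (cos x) * sin (k.+1%:R * x).
pose dF (x : R) := u (cos x) * (k.+1%:R * cos (k.+1%:R * x)) -
   du (cos x) * sin x * sin (k.+1%:R * x).
have c1 : continuous (fun x => u (cos x) * (k.+1%:R * cos (k.+1%:R * x))) by cnt.
have c2 : continuous (fun x => du (cos x) * sin x * sin (k.+1%:R * x)) by cnt.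
have hF : \int[mu]_(x in `[0, pi]) dF x = F pi - F 0.
  apply: (@Rint_FTC2 _ F dF); first exact: pi_ge0.
  - by apply: continuous_subspaceT; rewrite /F; cnt.
  - by apply: continuous_subspaceT; rewrite /dF; cnt.
  move=> x x0p.
  have cx : -1 < cos x < 1.
    have m0 : (0 : R) \in `[0, pi] by rewrite in_itv/= lexx pi_ge0.
    have mp : (pi : R) \in `[0, pi] by rewrite in_itv/= lexx pi_ge0.
    have mx : x \in `[0, pi] by rewrite in_itv/=; lra.
    by rewrite -{1}cospi -cos0 !ltr_cos// andbC.
  have h1 := is_derive1_comp (du1 _ cx) (is_derive_cos x).
  have h2 := is_derive_sinn k.+1%:R x.
  have := is_deriveM h1 h2; move/is_derive_eq; apply.
  by rewrite /dF /GRing.scale /=; ring.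
move: hF; rewrite cont_RintB// /F sin_natpi [_.+1%:R * 0]mulr0 sin0 !mulr0 subrr.
move=> /eqP; rewrite subr_eq0 => /eqP e.
rewrite -cont_RintZ; last by rewrite /cosn; cnt.
transitivity (nk k.+1 * \int[mu]_(x in `[0, pi])
    (u (cos x) * (k.+1%:R * cos (k.+1%:R * x)))).
  by rewrite -cont_RintZ//; apply: eq_Rint => x _; rewrite /cosn; ring.
by rewrite e -cont_RintZ//; apply: eq_Rint => x _; rewrite /sinn; ring.
Qed.

(** Bessel's inequality for the cosine system, applied to [u (cos x)], and for
    the sine system, applied to its derivative; the factor 2 comes from
    [(k + 1)^2 <= 2 (1 + k^2)]. *)
Lemma weighted_bessel (u du : R -> R) n : {within Iset, continuous u} ->
  {within Iset, continuous du} ->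
  (forall t : R, -1 < t < 1 -> is_derive t (1 : R) u (du t)) ->
  \sum_(k < n.+1) k.+1%:R ^+ 2 *
     (\int[mu]_(x in `[0, pi]) (u (cos x) * cosn k x)) ^+ 2 <=
  2 * \int[mu]_(x in `[0, pi]) (u (cos x) ^+ 2 + du (cos x) ^+ 2).
Proof.
move=> cu cdu du1.
have cuc : continuous (fun x => u (cos x)) := within_comp_cos cu.
have cduc : continuous (fun x => du (cos x)) := within_comp_cos cdu.
have csin : continuous (fun x : R => sin x) by exact: continuous_sin.
pose C k := \int[mu]_(x in `[0, pi]) (u (cos x) * cosn k x).
have b1 := bessel n.+1 (@cosn_cont R) (@cosn_orthonormal R) cuc.
have cdus : continuous (fun x => du (cos x) * sin x) by cnt.
have b2 := bessel n (@sinn_cont R) (@sinn_orthonormal R) cdus.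
rewrite cont_RintD; [|by cnt|by cnt].
have b3 : \int[mu]_(x in `[0, pi]) ((du (cos x) * sin x) ^+ 2) <=
    \int[mu]_(x in `[0, pi]) (du (cos x) ^+ 2).
  apply: cont_Rint_le; [by cnt|by cnt|move=> x _].
  have s1 : sin x ^+ 2 <= 1 by rewrite sin2cos2 gerBl sqr_ge0.
  by rewrite exprMn ler_piMr ?sqr_ge0.
have b4 : \sum_(k < n.+1) k%:R ^+ 2 * C k ^+ 2 <=
    \int[mu]_(x in `[0, pi]) (du (cos x) ^+ 2).
  apply: le_trans b3; apply: le_trans b2.
  rewrite big_ord_recl /= expr0n mul0r add0r; apply: ler_sum => k _.
  by rewrite /bump/= add1n -exprMn /C (cosn_by_parts _ cu cdu du1).
rewrite mulrDr; apply: le_trans (lerD (ler_wpM2l _ b1) (ler_wpM2l _ b4)) => //.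
rewrite !mulr_sumr -big_split; apply: ler_sum => k _ /=; rewrite -/(C k).
rewrite mulrA -mulrDl ler_wpM2r ?sqr_ge0// -natr1.
by have := sqr_ge0 (k%:R - 1 : R); lra.
Qed.

Lemma H1_C1 (g dg : R -> R[i]) (B D : R) : contI g -> contI dg ->
  (forall t : R, -1 < t < 1 -> cderiv g dg t) ->
  (forall t, Iset t -> cabs (g t) <= B) ->
  (forall t, Iset t -> cabs (dg t) <= D) ->
  H1 g /\ H1norm g <= Num.sqrt (2 * pi) * (B + D).
Proof.
move=> cg cdg dg1 gB dgD.
have [g1 g2] := contI_ReIm cg; have [d1 d2] := contI_ReIm cdg.
have I0 : Iset (0 : R) by rewrite /Iset/= in_itv/=; lra.
have B0 : 0 <= B := le_trans (cabs_ge0 _) (gB _ I0).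
have D0 : 0 <= D := le_trans (cabs_ge0 _) (dgD _ I0).
have p0 := pi_ge0 R.
have [] := @l2_bound _ (kap g) (Num.sqrt (2 * pi) * (B + D)).
- by rewrite mulr_ge0 ?sqrtr_ge0// addr_ge0.
- move=> [|n].
    by rewrite /series/= big_mkord big_ord0 sqr_ge0.
  rewrite /series/= big_mkord.
  under eq_bigr do rewrite cabs_kap cabs_sqr !ReIm_coefT// mulrDr.
  rewrite big_split /=.
  have h1 := weighted_bessel n g1 d1 (fun t ht => (dg1 t ht).1).
  have h2 := weighted_bessel n g2 d2 (fun t ht => (dg1 t ht).2).
  apply: le_trans (lerD h1 h2) _.
  have [a1 a2] := ccont_ReIm (ccont_comp_cos cg).
  have [b1 b2] := ccont_ReIm (ccont_comp_cos cdg).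
  rewrite -mulrDr -cont_RintD; [|by cnt|by cnt].
  rewrite exprMn sqr_sqrtr ?mulr_ge0// -mulrA ler_wpM2l//.
  rewrite [leRHS]mulrC -[X in _ * X](subr0 pi) -Rint_cst//.
  apply: cont_Rint_le; [by cnt|exact: cont_cst|move=> x _].
  have := gB _ (Iset_cos x); have := dgD _ (Iset_cos x).
  rewrite addrACA -!cabs_sqr.
  move: (cabs_ge0 (g (cos x))) (cabs_ge0 (dg (cos x))).
  move: (cabs _) (cabs _) => u v; nra.
by move=> h1 h2; have h : H1 g; [apply/H1P|split=> //; rewrite H1normE].
Qed.

End H1_C1.

(** * The monodromy operator *)

Section clamping.
Context {R : realType}.
Implicit Types p q t : R.

Definition clamp_to p q t : R := Num.max p (Num.min q t).

Lemma clamp_to_itv p q t : p <= q -> p <= clamp_to p q t <= q.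
Proof.
by move=> pq; rewrite /clamp_to le_max lexx /= ge_max pq ge_min lexx.
Qed.

Lemma clamp_to_id p q t : p <= t <= q -> clamp_to p q t = t.
Proof. by move=> /andP[h1 h2]; rewrite /clamp_to min_r// max_r. Qed.

Lemma clamp_to_cont p q : continuous (clamp_to p q).
Proof.
move=> x; apply: (@continuous_max _ _ _ _ x); first exact: cvg_cst.
by apply: (@continuous_min _ _ _ _ x); [exact: cvg_cst|exact: cvg_id].
Qed.

End clamping.

Section monodromy_operator.
Context {R : realType}.
Implicit Types (f g : R -> R[i]) (a b : R[i] -> R[i]).

Lemma contI_bounded f : contI f ->
  exists2 M, 0 < M & forall t, Iset t -> cabs (f t) <= M.
Proof.
move=> cf; have [c1 c2] := contI_ReIm cf.
have [M1 M10 h1] := within_bounded c1; have [M2 M20 h2] := within_bounded c2.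
exists (M1 + M2); first exact: addr_gt0.
by move=> t It; apply: le_trans (cabs_le_ReIm _) _; rewrite lerD ?h1 ?h2.
Qed.

(** Retraction of the line onto [-1, 1]; composing with it turns functions
    continuous on [-1, 1] into continuous functions on the line. *)
Definition clamp (t : R) : R := clamp_to (-1) 1 t.

Lemma clamp_I t : Iset (clamp t).
Proof. by rewrite /Iset/= in_itv/= clamp_to_itv//; lra. Qed.

Lemma clamp_id t : Iset t -> clamp t = t.
Proof. by rewrite /Iset/= in_itv/=; exact: clamp_to_id. Qed.

Lemma clamp_cont : continuous clamp.
Proof. exact: clamp_to_cont. Qed.

Lemma contI_clamp f : contI f -> continuous ((fun t => f (clamp t)) : R -> R[i]^o).
Proof. by move=> [cf]; exact: (within_comp clamp_cont clamp_I cf). Qed.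

Definition prim f t := cint `[-1, t] (fun s => f (clamp s)).

Lemma prim_cint f t : Iset t -> prim f t = cint `[-1, t] f.
Proof.
rewrite /Iset/= in_itv/= => /andP[h1 h2].
by apply: eq_cint => x /andP[x1 x2]; rewrite clamp_id// /Iset/= in_itv/=; lra.
Qed.

Lemma prim_m1 f : prim f (-1) = 0.
Proof.
by rewrite /prim /cint set_itv1 !Rintegral_set1.
Qed.

Lemma prim_deriv f t : contI f -> -1 < t ->
  cderiv (prim f) (fun s => f (clamp s)) t.
Proof. by move=> cf t1; apply: cint_deriv => //; exact: contI_clamp. Qed.

Lemma prim_contI f : contI f -> contI (prim f).
Proof.
move=> cf; have /ccontP[c1 c2] := contI_clamp cf.
split; apply/within_cont_ReIm; split.
  by apply: (@cont_Rint_cont _ (fun s => complex.Re (f (clamp s)))) => //; lra.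
by apply: (@cont_Rint_cont _ (fun s => complex.Im (f (clamp s)))) => //; lra.
Qed.

Lemma contI_cexp f : contI f -> contI (fun t => cexp (f t)).
Proof.
move=> cf; apply: (@contI_eqI _ (fun t => cexp (f (clamp t)))).
  by move=> t It; rewrite clamp_id.
by apply: contI_cont; apply: ccont_cexp; exact: contI_clamp.
Qed.

Lemma cderiv_near (F G f : R -> R[i]) t : (\forall y \near t, F y = G y) ->
  cderiv F f t -> cderiv G f t.
Proof.
move=> FG [h1 h2]; split.
  by apply: near_eq_is_derive h1; apply: filterS FG => y ->.
by apply: near_eq_is_derive h2; apply: filterS FG => y ->.
Qed.

Lemma near_I (t : R) : -1 < t < 1 -> \forall y \near t, -1 < y < 1.
Proof.
move=> ht; have : t \in `]-1, 1[ by rewrite in_itv.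
by move/near_in_itvoo; apply: filterS => y; rewrite in_itv.
Qed.

Variables (a b : R[i] -> R[i]).
Hypothesis ca : contI (fun t => a t%:C).
Hypothesis cb : contI (fun t => b t%:C).
Let A := prim (fun t => a t%:C).
Let h f (s : R) := cexp (- A s) * b s%:C * f s.
Let V f t := cexp (A t) * (f 1 + prim (h f) t).

Lemma Phi_prim t : Iset t -> Phi a t = cexp (A t).
Proof. by move=> It; rewrite /Phi /A prim_cint. Qed.

Let ch f : contI f -> contI (h f).
Proof.
move=> cf; apply: contIM => //; apply: contIM => //; apply: contI_cexp.
by apply: (@contI_eqI _ (fun t => -1 * A t)) => [t _|];
  [rewrite mulN1r|apply: contIZ; exact: prim_contI].
Qed.

Let monoE f : eqI (monodromy a b f) (V f).
Proof.
move=> t It; rewrite /monodromy /V Phi_prim// prim_cint//; congr (_ * (_ + _)).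
move: It; rewrite /Iset/= in_itv/= => It.
apply: eq_cint => s hs; rewrite /h cexpN -Phi_prim//.
by rewrite /Iset/= in_itv/=; lra.
Qed.

Let cV f : contI f -> contI (V f).
Proof.
move=> cf; apply: contIM; first by apply: contI_cexp; exact: prim_contI.
by apply: contID; [exact: contI_cst|apply: prim_contI; exact: ch].
Qed.

Lemma contI_monodromy f : contI f -> contI (monodromy a b f).
Proof. by move=> cf; apply: contI_eqI (cV cf) => t It; rewrite monoE. Qed.

(** [U f] solves the linear equation [y' = a y + b f]. *)
Lemma monodromy_deriv f (t : R) : contI f -> -1 < t < 1 ->
  cderiv (monodromy a b f)
    (fun s => a s%:C * monodromy a b f s + b s%:C * f s) t.
Proof.
move=> cf ht; have It : Iset t by rewrite /Iset/= in_itv/=; lra.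
have t1 : -1 < t by lra.
apply: (@cderiv_near (V f)).
  apply: filterS (near_I ht) => y hy; rewrite monoE// /Iset/= in_itv/=; lra.
have d1 := cderiv_cexp (prim_deriv ca t1).
have d2 := cderivD (cderiv_cst (f 1) t) (prim_deriv (ch cf) t1).
apply: cderiv_eq (cderivM d1 d2) _.
rewrite monoE// /V -/A clamp_id// add0r /h.
rewrite -[LHS]/(_ * _ * _ + _ * (_ * _ * _)).
rewrite [cexp (A t) * (cexp _ * _ * _)]mulrA [cexp (A t) * (_ * _)]mulrA.
by rewrite cexpNK mul1r mulrA.
Qed.

(** The second expression is the derivative of [U f]. *)
Lemma monodromy_bound : exists2 K : R, 0 < K & forall f m, contI f ->
  (forall t, Iset t -> cabs (f t) <= m) ->
  (forall t, Iset t -> cabs (monodromy a b f t) <= K * m) /\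
  (forall t, Iset t -> cabs (a t%:C * monodromy a b f t + b t%:C * f t) <= K * m).
Proof.
have [Ma a0 hMa] := contI_bounded ca; have [Mb b0 hMb] := contI_bounded cb.
have [M1 M10 hM1] := contI_bounded (contI_cexp (prim_contI ca)).
have [M2 M20 hM2] := contI_bounded (@ch _ (contI_cst 1)).
have I1 : Iset (1 : R) by rewrite /Iset/= in_itv/=; lra.
pose K0 := M1 * (1 + 2 * M2).
have K00 : 0 < K0 by rewrite mulr_gt0// addr_gt0// mulr_gt0.
exists (K0 + (Ma * K0 + Mb)); first by rewrite addr_gt0// addr_gt0// mulr_gt0.
move=> f m cf fm.
have m0 : 0 <= m := le_trans (cabs_ge0 _) (fm _ I1).
have hK t : Iset t -> cabs (monodromy a b f t) <= K0 * m.
  move=> It; rewrite monoE// /V cabsM /K0 -mulrA ler_pM ?cabs_ge0//; first exact: hM1.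
  apply: le_trans (cabsD _ _) _; rewrite mulrDl mul1r lerD ?fm//.
  have It' : -1 <= t <= 1 by move: It; rewrite /Iset/= in_itv.
  have : cabs (prim (h f) t) <= M2 * m * (t - -1).
    apply: cont_cint_abs; [lra|exact: contI_clamp (ch cf)|move=> x _].
    have Ix := clamp_I x; rewrite /h cabsM ler_pM ?cabs_ge0 ?fm//.
    by have := hM2 _ Ix; rewrite /h mulr1.
  move/le_trans; apply.
  have : 0 <= M2 * m by rewrite mulr_ge0// ltW.
  by rewrite -[2 * M2 * m]mulrA; move: (M2 * m) => y y0; nra.
have Kp : 0 <= (Ma * K0 + Mb) * m.
  apply: mulr_ge0 => //; apply: addr_ge0; last exact: ltW.
  by apply: mulr_ge0; exact: ltW.
split=> t It.
  by apply: le_trans (hK t It) _; rewrite mulrDl lerDl.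
rewrite mulrDl -[leLHS]add0r lerD//; first by rewrite mulr_ge0// ltW.
apply: le_trans (cabsD _ _) _.
rewrite (cabsM (a t%:C)) (cabsM (b t%:C)) mulrDl lerD//.
  by rewrite -mulrA ler_pM ?cabs_ge0 ?hMa ?hK.
by rewrite ler_pM ?cabs_ge0 ?hMb ?fm.
Qed.

Lemma monodromy_H1_bound : exists2 K : R, 0 <= K & forall f m, contI f ->
  (forall t, Iset t -> cabs (f t) <= m) ->
  H1 (monodromy a b f) /\ H1norm (monodromy a b f) <= K * m.
Proof.
have [K K0 hK] := monodromy_bound.
exists (Num.sqrt (2 * pi) * (K + K)).
  by rewrite mulr_ge0 ?sqrtr_ge0// addr_ge0// ltW.
move=> f m cf fm; have [h1 h2] := hK f m cf fm.
have cU := contI_monodromy cf.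
have [] := H1_C1 cU _ (fun t ht => monodromy_deriv cf ht) h1 h2.
  by apply: contID; exact: contIM.
by move=> h3 h4; split=> //; apply: le_trans h4 _; rewrite -mulrA [(K + K) * m]mulrDl.
Qed.

Lemma H1_monodromy f : contI f -> H1 (monodromy a b f).
Proof.
move=> cf; have [K _ hK] := monodromy_H1_bound.
by have [M _ hM] := contI_bounded cf; have [] := hK f M cf hM.
Qed.

(** The monodromy operator is bounded on H1, because H1 embeds in C(I) and the
    operator maps C(I) into continuously differentiable functions. *)
Lemma monodromy_H1 : exists2 K : R, 0 <= K & forall f, H1 f ->
  H1norm (monodromy a b f) <= K * H1norm f.
Proof.
have [K K0 hK] := monodromy_H1_bound.
exists (K * Num.sqrt (3 / pi)); first by rewrite mulr_ge0 ?sqrtr_ge0.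
move=> f hf; have [] := hK f (Num.sqrt (3 / pi) * H1norm f) (H1_contI hf).
  by move=> t It; exact: H1_sup.
by rewrite mulrA.
Qed.

Lemma monodromyD f g : contI f -> contI g ->
  eqI (monodromy a b (fun t => f t + g t))
      (fun t => monodromy a b f t + monodromy a b g t).
Proof.
move=> cf cg t It; rewrite !monoE// /V -mulrDr addrACA; congr (_ * (_ + _)).
rewrite /prim -cont_cintD; [|exact: contI_clamp (ch _)..].
by apply: eq_cint => s _; rewrite /h mulrDr.
Qed.

Lemma monodromyZ (l : R[i]) f : contI f ->
  eqI (monodromy a b (fun t => l * f t)) (fun t => l * monodromy a b f t).
Proof.
move=> cf t It; rewrite !monoE// /V mulrCA; congr (_ * _); rewrite mulrDr.
congr (_ + _); rewrite /prim -cont_cintZ; last exact: contI_clamp (ch _).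
by apply: eq_cint => s _; rewrite /h mulrCA.
Qed.

Lemma monodromy_eqI f g : contI f -> eqI f g ->
  eqI (monodromy a b f) (monodromy a b g).
Proof.
move=> cf fg t It; rewrite !monoE// /V fg//; last first.
  by rewrite /Iset/= in_itv/=; lra.
congr (_ * (_ + _)); apply: eq_cint => s _; rewrite /h fg//; exact: clamp_I.
Qed.

Lemma cderiv_zero_const (F : R -> R[i]) : contI F ->
  (forall t : R, -1 < t < 1 -> cderiv F (fun=> 0) t) ->
  forall t, Iset t -> F t = F (-1).
Proof.
move=> cF dF t; rewrite /Iset/= in_itv/= => /andP[t1 t2].
have [c1 c2] := contI_ReIm cF.
have sub : `[-1, t] `<=` @Iset R.
  by move=> x; rewrite /Iset/= !in_itv/=; lra.
have i0 : \int[lebesgue_measure]_(x in `[-1, t]) 0 = 0 :> R by rewrite Rint_cst// mul0r.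
have z0 : {within `[-1, t], continuous (fun _ : R => 0 : R)}.
  by move=> x; exact: cvg_cst.
apply: complex_ext; apply/eqP; rewrite -subr_eq0; apply/eqP; rewrite -[RHS]i0.
  have d1 x : -1 < x < t -> is_derive x (1 : R) (fun t => complex.Re (F t)) 0.
    by move=> hx; have [] := dF x (ltac:(lra)).
  exact: esym (Rint_FTC2 t1 (continuous_subspaceW sub c1) z0 d1).
have d2 x : -1 < x < t -> is_derive x (1 : R) (fun t => complex.Im (F t)) 0.
  by move=> hx; have [] := dF x (ltac:(lra)).
exact: esym (Rint_FTC2 t1 (continuous_subspaceW sub c2) z0 d2).
Qed.

(** An eigenfunction solves the ordinary differential equation
    [mu x' = (mu a + b) x], hence is an explicit exponential. *)
Lemma eigenfunction_exp (x : R -> R[i]) (mu : R[i]) : contI x -> mu != 0 ->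
  eqI (monodromy a b x) (fun t => mu * x t) ->
  forall t, Iset t -> x t = x (-1) *
    cexp (prim (fun s => a s%:C) t + mu^-1 * prim (fun s => b s%:C) t).
Proof.
move=> cx mu0 Ux; pose P t := prim (fun s => a s%:C) t +
  mu^-1 * prim (fun s => b s%:C) t.
have cP : contI P.
  by apply: contID; [|apply: contIZ]; exact: prim_contI.
have cQ : contI (fun t => monodromy a b x t * cexp (-1 * P t)).
  by apply: contIM; [exact: contI_monodromy|apply: contI_cexp; exact: contIZ].
have dQ (t : R) : -1 < t < 1 ->
    cderiv (fun t => monodromy a b x t * cexp (-1 * P t)) (fun=> 0) t.
  move=> ht; have It : Iset t by rewrite /Iset/= in_itv/=; lra.
  have t1 : -1 < t by lra.
  have dP := cderivD (prim_deriv ca t1) (cderivZ mu^-1 (prim_deriv cb t1)).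
  apply: cderiv_eq (cderivM (monodromy_deriv cx ht) (cderiv_cexp (cderivZ (-1) dP))) _.
  rewrite -/(P t) clamp_id// Ux//; move: (cexp _) => E.
  by field.
have Qcst := cderiv_zero_const cQ dQ.
have Im1 : Iset (-1 : R) by rewrite /Iset/= in_itv/=; lra.
move=> t It; have := Qcst t It; rewrite !Ux//.
rewrite {2}/P !prim_m1 !(mulr0, addr0) cexp0 mulr1 => e.
apply: (mulfI mu0); rewrite mulrA -e -/(P t) mulN1r -mulrA.
have E1 : cexp (- P t) * cexp (P t) = 1 by rewrite mulrC cexpNK.
by rewrite -[RHS]mulrA -[x t * _ * _]mulrA E1 mulr1.
Qed.

End monodromy_operator.

(** * Holomorphy through divided differences *)

Section holomorphy.
Context {R : realType}.
Implicit Types (f g : R[i] -> R[i]) (z w : R[i]).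

(** The second line is the second divided difference of [f] at [w], [z], [z'],
    freed from its denominators. *)
Definition dd_bound f (K : R) (w z z' : R[i]) : Prop :=
  cabs (f z - f w) <= K * cabs (z - w) /\
  cabs ((z' - w) * (f z - f w) - (z - w) * (f z' - f w)) <=
    K * (cabs (z - w) * cabs (z' - w) * cabs (z - z')).

(** A substitute for complex differentiability which carries its constants: a
    real-differentiable function satisfies the second bound of [dd_bound] for
    non-collinear [w], [z], [z'] only if its derivative is complex linear. *)
Definition hol f z0 := exists r K, [/\ 0 < r, 0 <= K &
  forall w z z', cabs (w - z0) < r -> cabs (z - z0) < r -> cabs (z' - z0) < r ->
    dd_bound f K w z z'].

Lemma dd_bound_le f K L w z z' : K <= L -> dd_bound f K w z z' ->
  dd_bound f L w z z'.
Proof.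
move=> KL [h1 h2]; split; [apply: le_trans h1 _|apply: le_trans h2 _].
  by rewrite ler_wpM2r ?cabs_ge0.
by rewrite ler_wpM2r// !mulr_ge0 ?cabs_ge0.
Qed.

Lemma hol_cst c z0 : hol (fun=> c) z0.
Proof.
exists 1, 0; split=> // w z z' _ _ _; rewrite /dd_bound !subrr !mulr0 subrr cabs0.
by rewrite !mul0r.
Qed.

Lemma hol_id z0 : hol id z0.
Proof.
exists 1, 1; split=> // w z z' _ _ _; rewrite /dd_bound mul1r; split=> //.
by rewrite mulrC subrr cabs0 !mulr_ge0 ?cabs_ge0.
Qed.

Lemma holD f g z0 : hol f z0 -> hol g z0 -> hol (fun z => f z + g z) z0.
Proof.
move=> [r1 [K1 [r10 K10 h1]]] [r2 [K2 [r20 K20 h2]]].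
exists (Num.min r1 r2), (K1 + K2); split; [by rewrite lt_min r10|exact: addr_ge0|].
move=> w z z'; rewrite !lt_min => /andP[a1 a2] /andP[b1 b2] /andP[c1 c2].
have [p1 p2] := h1 _ _ _ a1 b1 c1; have [q1 q2] := h2 _ _ _ a2 b2 c2.
split.
  have -> : f z + g z - (f w + g w) = (f z - f w) + (g z - g w) by ring.
  by apply: le_trans (cabsD _ _) _; rewrite [leRHS]mulrDl lerD.
have -> : (z' - w) * (f z + g z - (f w + g w)) - (z - w) * (f z' + g z' - (f w + g w))
  = ((z' - w) * (f z - f w) - (z - w) * (f z' - f w)) +
    ((z' - w) * (g z - g w) - (z - w) * (g z' - g w)) by ring.
by apply: le_trans (cabsD _ _) _; rewrite [leRHS]mulrDl lerD.
Qed.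

Lemma hol_near_bound f z0 : hol f z0 -> exists r M, [/\ 0 < r, 0 <= M &
  forall z, cabs (z - z0) < r -> cabs (f z) <= M].
Proof.
move=> [r [K [r0 K0 h]]]; exists r, (cabs (f z0) + K * r); split=> //.
  by rewrite addr_ge0 ?cabs_ge0// mulr_ge0// ltW.
have hz0 : cabs (z0 - z0) < r by rewrite subrr cabs0.
move=> z hz; have [h1 _] := h _ _ _ hz0 hz hz.
apply: le_trans (cabs_le_dist _ (f z0)) _; rewrite lerD2l.
by apply: le_trans h1 _; rewrite ler_wpM2l// ltW.
Qed.

Lemma holM f g z0 : hol f z0 -> hol g z0 -> hol (fun z => f z * g z) z0.
Proof.
move=> hf hg.
have [r3 [M1 [r30 M10 b1]]] := hol_near_bound hf.
have [r4 [M2 [r40 M20 b2]]] := hol_near_bound hg.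
move: hf hg => [r1 [K1 [r10 K10 h1]]] [r2 [K2 [r20 K20 h2]]].
exists (Num.min (Num.min r1 r2) (Num.min r3 r4)), (M1 * K2 + M2 * K1 + K1 * K2).
split; [by rewrite !lt_min r10 r20 r30|by rewrite !addr_ge0// mulr_ge0|].
move=> w z z'; rewrite !lt_min => /andP[/andP[a1 a2] /andP[a3 a4]].
move=> /andP[/andP[z1 z2] /andP[z3 z4]] /andP[/andP[y1 y2] /andP[y3 y4]].
have [p1 p2] := h1 _ _ _ a1 z1 y1; have [q1 q2] := h2 _ _ _ a2 z2 y2.
have [p3 _] := h1 _ _ _ y1 z1 a1; have [q3 _] := h2 _ _ _ a2 y2 z2.
have fz := b1 _ z3; have gw := b2 _ a4.
split.
  have -> : f z * g z - f w * g w = f z * (g z - g w) + g w * (f z - f w) by ring.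
  apply: le_trans (cabsD _ _) _; rewrite !cabsM [leRHS]mulrDl.
  apply: ler_wpDr; first by rewrite !mulr_ge0 ?cabs_ge0.
  by rewrite [leRHS]mulrDl -!mulrA; apply: lerD; apply: ler_pM; rewrite ?cabs_ge0.
have -> : (z' - w) * (f z * g z - f w * g w) - (z - w) * (f z' * g z' - f w * g w) =
  f z * ((z' - w) * (g z - g w) - (z - w) * (g z' - g w)) +
  g w * ((z' - w) * (f z - f w) - (z - w) * (f z' - f w)) +
  (z - w) * ((f z - f z') * (g z' - g w)) by ring.
apply: le_trans (cabsD _ _) _; rewrite [leRHS]mulrDl; apply: lerD.
  apply: le_trans (cabsD _ _) _; rewrite !cabsM [leRHS]mulrDl -!mulrA.
  rewrite ![cabs (z - w) * (_ * _)]mulrA.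
  by apply: lerD; apply: ler_pM; rewrite ?cabs_ge0.
rewrite !cabsM; set d := cabs (z - w); set d' := cabs (z' - w).
rewrite (_ : K1 * K2 * _ = d * ((K1 * cabs (z - z')) * (K2 * d'))); last by ring.
by rewrite ler_wpM2l ?cabs_ge0// ler_pM ?cabs_ge0.
Qed.

Lemma holZ c f z0 : hol f z0 -> hol (fun z => c * f z) z0.
Proof. by move=> hf; apply: holM => //; exact: hol_cst. Qed.

(** The chain rule. Divided differences of the composite are compared with those
    of the two factors after multiplication by [g z - g w]; when this increment
    vanishes the Lipschitz bounds suffice. *)
Lemma hol_comp f g z0 : hol f (g z0) -> hol g z0 -> hol (fun z => f (g z)) z0.
Proof.
move=> [r1 [K1 [r10 K10 h1]]] [r2 [K2 [r20 K20 h2]]].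
have K21 : 0 < K2 + 1 by lra.
exists (Num.min r2 (r1 / (K2 + 1))), (K1 * K2 + K1 * K2 * K2).
split; first by rewrite lt_min r20 divr_gt0.
  by rewrite addr_ge0// !mulr_ge0.
have hz0 : cabs (z0 - z0) < r2 by rewrite subrr cabs0.
have near z : cabs (z - z0) < r2 -> cabs (z - z0) < r1 / (K2 + 1) ->
    cabs (g z - g z0) < r1.
  move=> zr2; rewrite ltr_pdivlMr// => zr1.
  have [lip _] := h2 _ _ _ hz0 zr2 hz0.
  apply: le_lt_trans lip _; apply: le_lt_trans zr1.
  by rewrite mulrC ler_wpM2l ?cabs_ge0// lerDl.
move=> w z z'; rewrite !lt_min => /andP[a1 a2] /andP[b1 b2] /andP[c1 c2].
have ga := near _ a1 a2; have gb := near _ b1 b2; have gc := near _ c1 c2.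
have [p1 p2] := h1 _ _ _ ga gb gc; have [q1 q2] := h2 _ _ _ a1 b1 c1.
have [p3 _] := h1 _ _ _ ga gc gb; have [q3 _] := h2 _ _ _ a1 c1 b1.
have [q4 _] := h2 _ _ _ c1 b1 a1.
set A := f (g z) - f (g w) in p1 p2 *; set A' := f (g z') - f (g w) in p2 p3 *.
have e1 : g z - g z' = (g z - g w) - (g z' - g w) by ring.
rewrite e1 in p2 q4.
set B := g z - g w in p1 p2 q1 q2 q4; set B' := g z' - g w in p2 p3 q2 q3 q4.
set d := z - w in q1 q2 *; set d' := z' - w in q2 q3 *; set e := z - z' in q2 q4 *.
have KK : 0 <= K1 * K2 * K2 by rewrite !mulr_ge0.
split.
  apply: le_trans p1 _; rewrite mulrDl; apply: ler_wpDr.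
    by rewrite mulr_ge0 ?cabs_ge0.
  by rewrite -mulrA ler_wpM2l.
set T := cabs d * cabs d' * cabs e.
have T0 : 0 <= T by rewrite !mulr_ge0 ?cabs_ge0.
have [B0|B0] := eqVneq B 0.
  have A0 : A = 0.
    by apply: cabs0_eq0; apply/eqP; rewrite eq_le cabs_ge0 andbT;
      move: p1; rewrite B0 cabs0 mulr0.
  rewrite -/A -/A' -/d -/d' A0 mulr0 sub0r cabsN cabsM [leRHS]mulrDl; apply: ler_wpDr.
    by rewrite mulr_ge0.
  have := q2; rewrite B0 mulr0 sub0r cabsN cabsM -/T => q2'.
  rewrite -mulrA; apply: le_trans (ler_wpM2l K10 q2').
  by rewrite mulrCA ler_wpM2l ?cabs_ge0.
have cB := cabs_gt0 B0; rewrite -(ler_pM2l cB) -cabsM.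
rewrite -/A -/A' -/d -/d'; have -> : B * (d' * A - d * A') = A * (d' * B - d * B') + d * (B' * A - B * A').
  by ring.
apply: le_trans (cabsD _ _) _.
rewrite [X in _ <= _ * X]mulrDl [leRHS]mulrDr; apply: lerD.
  rewrite cabsM (_ : cabs B * _ = (K1 * cabs B) * (K2 * T)); last by ring.
  by apply: ler_pM; rewrite ?cabs_ge0.
rewrite cabsM (_ : cabs B * _ = cabs d * (K1 * (cabs B * (K2 * cabs d') * (K2 * cabs e)))); last first.
  by rewrite /T; ring.
rewrite ler_wpM2l ?cabs_ge0//; apply: le_trans p2 _; rewrite ler_wpM2l//.
apply: ler_pM; rewrite ?mulr_ge0 ?cabs_ge0//.
by rewrite ler_wpM2l ?cabs_ge0.
Qed.

Lemma hol_path f (gam : R -> R[i]) : continuous (gam : R -> R[i]^o) ->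
  (forall u, hol f (gam u)) -> continuous ((fun u => f (gam u)) : R -> R[i]^o).
Proof.
move=> cg hf u; have [r [K [r0 K0 h]]] := hf u.
apply/cvg_cabsP; apply/cvgrPdist_lt => e e0.
have hu : cabs (gam u - gam u) < r by rewrite subrr cabs0.
have d0 : 0 < Num.min r (e / (K + 1)) by rewrite lt_min r0 divr_gt0//; lra.
have /cvg_cabsP/cvgrPdist_lt/(_ _ d0) := cg u.
apply: filterS => v; rewrite !sub0r !normrN !ger0_norm ?cabs_ge0//.
rewrite lt_min => /andP[v1 v2]; have [lip _] := h _ _ _ hu v1 hu.
apply: le_lt_trans lip _; move: v2; rewrite ltr_pdivlMr; last by lra.
by apply: le_lt_trans; rewrite mulrC ler_wpM2l ?cabs_ge0// lerDl.
Qed.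

(** ** The exponential *)

Definition psi z := cint `[0, 1] (fun u : R => cexp (u%:C * z)).

Let cline z : continuous ((fun u : R => u%:C * z) : R -> R[i]^o).
Proof.
apply: ccontM; last exact: ccont_cst.
by apply: ccont_real => x; exact: cvg_id.
Qed.

Let cexpline z : continuous ((fun u : R => cexp (u%:C * z)) : R -> R[i]^o).
Proof. by apply: ccont_cexp; exact: cline. Qed.

(** [psi] is the divided difference of the exponential at [z] and [0]; the one
    at [z] and [w] is [cexp w * psi (z - w)], so that bounds for second divided
    differences of the exponential are Lipschitz bounds for [psi]. *)
Lemma cexp_psi z : cexp z - 1 = z * psi z.
Proof.
rewrite /psi -cont_cintZ; last exact: cexpline.
rewrite (@cint_FTC2 _ (fun u => cexp (u%:C * z)) _ 0 1) ?ler01//.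
- by rewrite mul1r mul0r cexp0.
- by apply: ccontM; [exact: ccont_cst|exact: cexpline].
move=> x _; apply: (@cderiv_cexp _ (fun u => u%:C * z) (fun=> z)).
split.
  under eq_fun do rewrite ReZ.
  have := is_deriveM (is_derive_id x (1:R)) (is_derive_cst (complex.Re z) x (1:R)).
  by move/is_derive_eq; apply; rewrite /GRing.scale/= mulr0 add0r mulr1.
under eq_fun do rewrite ImZ.
have := is_deriveM (is_derive_id x (1:R)) (is_derive_cst (complex.Im z) x (1:R)).
by move/is_derive_eq; apply; rewrite /GRing.scale/= mulr0 add0r mulr1.
Qed.

Lemma cabs_cexp_le z : cabs (cexp z) <= expR (cabs z).
Proof.
rewrite cabs_cexp ler_expR; apply: le_trans (Re_le_cabs z); exact: ler_norm.
Qed.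

Lemma psi_bound z : cabs (psi z) <= expR (cabs z).
Proof.
rewrite -[leRHS]mulr1 -[X in _ * X](subr0 1); apply: cont_cint_abs => //.
move=> u /andP[u0 u1]; apply: le_trans (cabs_cexp_le _) _; rewrite ler_expR.
by rewrite cabsM cabs_real ger0_norm// ler_piMl ?cabs_ge0.
Qed.

Lemma cexp_lip z w : cabs (cexp z - cexp w) <=
  expR (cabs w) * expR (cabs (z - w)) * cabs (z - w).
Proof.
have -> : cexp z - cexp w = cexp w * ((z - w) * psi (z - w)).
  by rewrite -cexp_psi mulrBr mulr1 -cexpD [w + _]addrC subrK.
rewrite (cabsM (cexp w)) (cabsM (z - w)) -mulrA.
apply: ler_pM; rewrite ?mulr_ge0 ?cabs_ge0//; first exact: cabs_cexp_le.
by rewrite mulrC ler_wpM2r ?cabs_ge0// psi_bound.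
Qed.

Lemma psi_lip z w : cabs (psi z - psi w) <=
  expR (cabs w) * expR (cabs (z - w)) * cabs (z - w).
Proof.
rewrite /psi -cont_cintB; [|exact: cexpline..].
rewrite -[leRHS]mulr1 -[X in _ * X](subr0 1); apply: cont_cint_abs => //.
  by apply: ccontB; exact: cexpline.
move=> u /andP[u0 u1]; apply: le_trans (cexp_lip _ _) _.
have le y : cabs (u%:C * y) <= cabs y.
  by rewrite cabsM cabs_real ger0_norm// ler_piMl ?cabs_ge0.
rewrite -mulrBr; apply: ler_pM; rewrite ?mulr_ge0 ?expR_ge0 ?cabs_ge0//.
by apply: ler_pM; rewrite ?expR_ge0// ler_expR.
Qed.

Lemma hol_cexp z0 : hol cexp z0.
Proof.
pose E := expR (cabs z0 + 1); pose K := E * expR 2 + E * (expR 2 * expR 4).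
have E0 : 0 <= E := expR_ge0 _.
have EE : 0 <= E * (expR 2 * expR 4) by rewrite !mulr_ge0 ?expR_ge0.
exists 1, K; split=> //; first by rewrite addr_ge0// mulr_ge0 ?expR_ge0.
move=> w z z' hw hz hz'.
have dist y : cabs (y - z0) < 1 -> cabs (y - w) <= 2.
  by move=> hy; apply: le_trans (cabs_dist _ z0 _) _; rewrite (cabsB z0); lra.
have ew : cabs (cexp w) <= E.
  apply: le_trans (cabs_cexp_le _) _; rewrite ler_expR.
  by have := cabs_le_dist w z0; lra.
have diff y : cexp y - cexp w = cexp w * ((y - w) * psi (y - w)).
  by rewrite -cexp_psi mulrBr mulr1 -cexpD [w + _]addrC subrK.
rewrite /dd_bound !diff; split.
  rewrite (cabsM (cexp w)) (cabsM (z - w)) /K [leRHS]mulrDl; apply: ler_wpDr; first by rewrite mulr_ge0 ?cabs_ge0.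
  rewrite -mulrA; apply: ler_pM; rewrite ?mulr_ge0 ?cabs_ge0//.
  rewrite mulrC ler_wpM2r ?cabs_ge0//; apply: le_trans (psi_bound _) _.
  by rewrite ler_expR dist.
have -> : (z' - w) * (cexp w * ((z - w) * psi (z - w))) -
   (z - w) * (cexp w * ((z' - w) * psi (z' - w))) =
   cexp w * ((z - w) * (z' - w) * (psi (z - w) - psi (z' - w))) by ring.
rewrite /K [leRHS]mulrDl; apply: ler_wpDl.
  by rewrite !mulr_ge0 ?expR_ge0 ?cabs_ge0.
rewrite (cabsM (cexp w)) (cabsM ((z - w) * (z' - w))) (cabsM (z - w)).
rewrite (_ : E * _ * _ = E * (cabs (z - w) * cabs (z' - w) *
  (expR 2 * expR 4 * cabs (z - z')))); last by ring.
apply: ler_pM; rewrite ?mulr_ge0 ?cabs_ge0//.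
rewrite ler_wpM2l ?mulr_ge0 ?cabs_ge0//.
apply: le_trans (psi_lip _ _) _.
have -> : z - w - (z' - w) = z - z' by ring.
rewrite ler_wpM2r ?cabs_ge0//; apply: ler_pM; rewrite ?expR_ge0//.
  by rewrite ler_expR dist.
rewrite ler_expR; apply: le_trans (cabs_dist _ w _) _.
by have := dist _ hz; have := dist _ hz'; rewrite (cabsB w); lra.
Qed.

(** ** Analytic functions *)

Lemma pow_lip n (rho : R) z w : 0 < rho -> cabs z <= rho -> cabs w <= rho ->
  cabs (z ^+ n - w ^+ n) <= n%:R * rho ^+ n / rho * cabs (z - w).
Proof.
move=> r0 hz hw; elim: n => [|n IH]; first by rewrite !expr0 subrr cabs0 !mul0r.
have -> : z ^+ n.+1 - w ^+ n.+1 = z * (z ^+ n - w ^+ n) + w ^+ n * (z - w).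
  by rewrite !exprS; ring.
apply: le_trans (cabsD _ _) _; rewrite !cabsM cabsX -natr1.
have -> : (n%:R + 1) * rho ^+ n.+1 / rho * cabs (z - w) =
   rho * (n%:R * rho ^+ n / rho * cabs (z - w)) + rho ^+ n * cabs (z - w).
  by rewrite exprS; field; rewrite gt_eqF.
apply: lerD; first by apply: ler_pM; rewrite ?cabs_ge0.
by rewrite ler_wpM2r ?cabs_ge0//; apply: lerXn2r; rewrite ?nnegrE ?cabs_ge0// ltW.
Qed.

Lemma pow_dd n (rho : R) z w z' : 0 < rho ->
  cabs z <= rho -> cabs w <= rho -> cabs z' <= rho ->
  cabs ((z' - w) * (z ^+ n - w ^+ n) - (z - w) * (z' ^+ n - w ^+ n)) <=
  n%:R ^+ 2 * rho ^+ n / rho ^+ 2 * (cabs (z - w) * cabs (z' - w) * cabs (z - z')).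
Proof.
move=> r0 hz hw hz'; set T := _ * _ * cabs (z - z').
have T0 : 0 <= T by rewrite !mulr_ge0 ?cabs_ge0.
elim: n => [|n IH]; first by rewrite !expr0 !subrr !mulr0 subrr cabs0 expr0n !mul0r.
have -> : (z' - w) * (z ^+ n.+1 - w ^+ n.+1) - (z - w) * (z' ^+ n.+1 - w ^+ n.+1) =
  z * ((z' - w) * (z ^+ n - w ^+ n) - (z - w) * (z' ^+ n - w ^+ n)) +
  (z - w) * (z - z') * (z' ^+ n - w ^+ n) by rewrite !exprS; ring.
apply: le_trans (cabsD _ _) _; rewrite (cabsM z) !(cabsM (_ * _)) (cabsM (z - w)).
have lip := pow_lip n r0 hz' hw.
apply: (@le_trans _ _ (rho * (n%:R ^+ 2 * rho ^+ n / rho ^+ 2 * T) +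
   n%:R * rho ^+ n / rho * T)).
  apply: lerD; first by apply: ler_pM; rewrite ?cabs_ge0.
  rewrite (_ : _ / _ * T = cabs (z - w) * cabs (z - z') *
     (n%:R * rho ^+ n / rho * cabs (z' - w))); last by rewrite /T; ring.
  by rewrite ler_wpM2l ?mulr_ge0 ?cabs_ge0.
rewrite -subr_ge0 -natr1.
have -> : (n%:R + 1) ^+ 2 * rho ^+ n.+1 / rho ^+ 2 * T -
   (rho * (n%:R ^+ 2 * rho ^+ n / rho ^+ 2 * T) + n%:R * rho ^+ n / rho * T) =
   (n%:R + 1) * rho ^+ n / rho * T.
  by rewrite (exprS rho n); field; rewrite gt_eqF.
by rewrite mulr_ge0// divr_ge0 ?ltW// mulr_gt0// ?exprn_gt0// ltr_wpDl.
Qed.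

Lemma sum_sq_half n : \sum_(k < n) k%:R ^+ 2 / 2 ^+ k <= 6 :> R.
Proof.
have h : \sum_(k < n) k%:R ^+ 2 / 2 ^+ k =
    6 - (n%:R ^+ 2 + 2 * n%:R + 3) * 2 / 2 ^+ n :> R.
  elim: n => [|n IH]; first by rewrite big_ord0 expr0 expr0n mulr0 /= !add0r divr1; lra.
  rewrite big_ord_recr /= IH (exprS 2 n) -natr1.
  by field; rewrite expf_neq0.
rewrite h gerBl divr_ge0 ?exprn_ge0// mulr_ge0// !addr_ge0// mulr_ge0//.
Qed.

Lemma cvg_mulC (T : Type) (F : set_system T) (FF : Filter F) (c : R[i])
    (u : T -> R[i]^o) (l : R[i]) : u @ F --> (l : R[i]^o) ->
  ((fun x => c * u x) : T -> R[i]^o) @ F --> (c * l : R[i]^o).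
Proof.
move=> /cvg_ReImP[h1 h2]; apply/cvg_ReImP; split.
  under eq_fun do rewrite ReM.
  by rewrite ReM; apply: cvgB; apply: cvgM => //; exact: cvg_cst.
under eq_fun do rewrite ImM.
by rewrite ImM; apply: cvgD; apply: cvgM => //; exact: cvg_cst.
Qed.

Lemma cvg_subC (T : Type) (F : set_system T) (FF : Filter F)
    (u v : T -> R[i]^o) (l m : R[i]) :
  u @ F --> (l : R[i]^o) -> v @ F --> (m : R[i]^o) ->
  ((fun x => (u x : R[i]) - v x) : T -> R[i]^o) @ F --> (l - m : R[i]^o).
Proof.
move=> /cvg_ReImP[u1 u2] /cvg_ReImP[v1 v2]; apply/cvg_ReImP; split.
  under eq_fun do rewrite ReB.
  by rewrite ReB; exact: cvgB.
under eq_fun do rewrite ImB.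
by rewrite ImB; exact: cvgB.
Qed.

Lemma cvg_cabs_le (u : nat -> R[i]^o) (l : R[i]) (B : R) :
  u @ \oo --> (l : R[i]^o) -> (forall n, cabs (u n) <= B) -> cabs l <= B.
Proof.
move=> /cvg_cabsP h uB; apply: ler_addeps => e e0.
have /cvgrPdist_lt/(_ _ e0)[n _ /(_ n (leqnn n))] := h.
rewrite /= sub0r normrN ger0_norm ?cabs_ge0// cabsB => hn.
by apply: le_trans (cabs_le_dist _ (u n)) _; rewrite lerD ?uB// ltW.
Qed.

Lemma dd_bound_lim (S : nat -> R[i] -> R[i]) f (K : R) w z z' :
  (forall y, y \in [:: w; z; z'] -> ((S ^~ y) : nat -> R[i]^o) @ \oo --> (f y : R[i]^o)) ->
  (forall n, dd_bound (S n) K w z z') -> dd_bound f K w z z'.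
Proof.
move=> cS hS.
have cw := cS w _; have cz := cS z _; have cz' := cS z' _.
rewrite !inE !eqxx ?orbT in cw cz cz'.
have {}cw := cw isT; have {}cz := cz isT; have {}cz' := cz' isT.
split.
  apply: (@cvg_cabs_le (fun n => S n z - S n w)); last by move=> n; have [] := hS n.
  exact: (@cvg_subC _ \oo _ (fun n => S n z) (fun n => S n w) (f z) (f w) cz cw).
apply: (@cvg_cabs_le (fun n => (z' - w) * (S n z - S n w) - (z - w) * (S n z' - S n w))).
  apply: cvg_subC; apply: cvg_mulC.
    exact: (@cvg_subC _ \oo _ (fun n => S n z) (fun n => S n w) (f z) (f w) cz cw).
  exact: (@cvg_subC _ \oo _ (fun n => S n z') (fun n => S n w) (f z') (f w) cz' cw).
by move=> n; have [] := hS n.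
Qed.

Lemma dd_bound_sum n (F : nat -> R[i] -> R[i]) (K : nat -> R) w z z' :
  (forall k, dd_bound (F k) (K k) w z z') ->
  dd_bound (fun y => \sum_(k < n) F k y) (\sum_(k < n) K k) w z z'.
Proof.
move=> h; elim: n => [|n [IH1 IH2]].
  by rewrite /dd_bound !big_ord0 !mul0r !subrr !mulr0 subrr cabs0.
have [h1 h2] := h n; rewrite /dd_bound !big_ord_recr /=.
set a := \sum_(k < n) F k z in IH1 IH2 *; set b := \sum_(k < n) F k w in IH1 IH2 *.
set c := \sum_(k < n) F k z' in IH2 *.
split.
  have -> : a + F n z - (b + F n w) = (a - b) + (F n z - F n w) by ring.
  by apply: le_trans (cabsD _ _) _; rewrite [leRHS]mulrDl lerD.
have -> : (z' - w) * (a + F n z - (b + F n w)) - (z - w) * (c + F n z' - (b + F n w)) =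
  ((z' - w) * (a - b) - (z - w) * (c - b)) +
  ((z' - w) * (F n z - F n w) - (z - w) * (F n z' - F n w)) by ring.
by apply: le_trans (cabsD _ _) _; rewrite [leRHS]mulrDl lerD.
Qed.

(** Inside half the disc of convergence the second divided differences of the
    terms of the power series are bounded by a summable sequence. *)
Lemma analytic_hol f z0 : analytic_at f z0 -> hol f z0.
Proof.
move=> [c [r [r0 hc]]].
pose rho := r / 4; have rho0 : 0 < rho by rewrite divr_gt0.
pose S n z := \sum_(k < n) c k * (z - z0) ^+ k.
have cS z : cabs (z - z0) < r -> ((S ^~ z) : nat -> R[i]^o) @ \oo --> (f z : R[i]^o).
  move=> /hc; rewrite (_ : series _ = S ^~ z)//.
  by apply/funext => n; rewrite /series/= /S big_mkord.
(* a convergent power series has bounded terms; here at distance [r / 2] *)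
have [C C0 hC] : exists2 C, 0 <= C & forall n, cabs (c n) * (2 * rho) ^+ n <= C.
  pose z1 := z0 + (2 * rho)%:C.
  have e1 : z1 - z0 = (2 * rho)%:C by rewrite /z1 addrC addKr.
  have a1 : cabs (z1 - z0) = 2 * rho.
    by rewrite e1 cabs_real ger0_norm// mulr_ge0// ltW.
  have h1 : cabs (z1 - z0) < r by rewrite a1 /rho; lra.
  have /cvg_cabsP h2 := cS _ h1.
  have [B [_ hB]] := cvg_seq_bounded (cvgP _ h2).
  have {}hB n : cabs (S n z1 - f z1) <= B + 1.
    have BB : B < B + 1 by rewrite ltrDl.
    by have /= := hB _ BB n I; rewrite ger0_norm ?cabs_ge0.
  exists (2 * (B + 1)).
    by rewrite mulr_ge0// (le_trans _ (hB 0%N))// cabs_ge0.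
  move=> n; rewrite -{1}a1 -cabsX -cabsM.
  have -> : c n * (z1 - z0) ^+ n = (S n.+1 z1 - f z1) - (S n z1 - f z1).
    by rewrite /S big_ord_recr /=; ring.
  by apply: le_trans (cabs_sub _ _) _; have := hB n; have := hB n.+1; lra.
pose k n : R := cabs (c n) * (n%:R ^+ 2 * rho ^+ n * (rho^-1 + rho^-2)).
have ir0 : 0 <= rho^-1 by rewrite invr_ge0 ltW.
have ir2 : 0 <= rho^-2 by rewrite invr_ge0 exprn_ge0// ltW.
have hk n : \sum_(j < n) k j <= 6 * (C * (rho^-1 + rho^-2)).
  apply: le_trans (ler_wpM2r _ (sum_sq_half n)); last first.
    by rewrite mulr_ge0// addr_ge0.
  rewrite mulr_suml; apply: ler_sum => j _.
  rewrite /k (_ : cabs (c j) * _ = j%:R ^+ 2 / 2 ^+ j * ((cabs (c j) * (2 * rho) ^+ j) *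
     (rho^-1 + rho^-2))).
    rewrite ler_wpM2l ?divr_ge0 ?exprn_ge0// ler_wpM2r ?addr_ge0//.
  rewrite [(2 * rho) ^+ j]exprMn; have := @expf_neq0 R 2 j; rewrite (_ : (2 : R) != 0)//.
  move: (rho^-1 + _) (j%:R ^+ 2 : R) (2 ^+ j : R) (rho ^+ j) => P Q T W /(_ isT) T0.
  by field.
exists rho, (6 * (C * (rho^-1 + rho^-2))); split=> //.
  by rewrite !mulr_ge0// addr_ge0.
move=> w z z' hw hz hz'.
have rr y : cabs (y - z0) < rho -> cabs (y - z0) < r by rewrite /rho; lra.
apply: (@dd_bound_lim S).
  by move=> y; rewrite !inE => /or3P[] /eqP ->; apply: cS; exact: rr.
move=> n; apply: dd_bound_le (hk n) _.
apply: (@dd_bound_sum n (fun j y => c j * (y - z0) ^+ j)) => j.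
have d1 : z - w = (z - z0) - (w - z0) by ring.
have d2 : z' - w = (z' - z0) - (w - z0) by ring.
have d3 : z - z' = (z - z0) - (z' - z0) by ring.
have j2 : (j%:R : R) <= j%:R ^+ 2.
  by rewrite -natrX ler_nat; case: (j) => // m; rewrite -mulnn leq_pmulr.
split.
  rewrite -mulrBr cabsM /k -mulrA ler_wpM2l ?cabs_ge0//.
  have := pow_lip j rho0 (ltW hz) (ltW hw); rewrite -d1 => /le_trans; apply.
  rewrite ler_wpM2r ?cabs_ge0// -(mulrA (j%:R)) -(mulrA (j%:R ^+ 2)).
  apply: ler_pM => //.
    by rewrite mulr_ge0// exprn_ge0// ltW.
  by rewrite ler_wpM2l ?exprn_ge0 ?(ltW rho0)// lerDl.
have -> : (z' - w) * (c j * (z - z0) ^+ j - c j * (w - z0) ^+ j) -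
  (z - w) * (c j * (z' - z0) ^+ j - c j * (w - z0) ^+ j) =
  c j * ((z' - w) * ((z - z0) ^+ j - (w - z0) ^+ j) -
  (z - w) * ((z' - z0) ^+ j - (w - z0) ^+ j)) by ring.
rewrite cabsM /k -mulrA ler_wpM2l ?cabs_ge0//.
have := pow_dd j rho0 (ltW hz) (ltW hw) (ltW hz'); rewrite -d1 -d2 -d3.
move=> /le_trans; apply; rewrite ler_wpM2r ?mulr_ge0 ?cabs_ge0//.
rewrite ler_wpM2l ?mulr_ge0 ?exprn_ge0 ?(ltW rho0)//.
by rewrite lerDr.
Qed.

End holomorphy.

(** * Contour shift and coefficient decay *)

Section primitives.
Context {R : realType}.
Implicit Types (f g F G : R -> R[i]).

Lemma cderiv_affine G g (c m x : R) : cderiv G g (c + m * x) ->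
  cderiv (fun u => G (c + m * u)) (fun u => m%:C * g (c + m * u)) x.
Proof.
have da : is_derive x (1 : R) (fun u : R => c + m * u) m.
  have := is_deriveD (is_derive_cst c x (1:R))
    (is_deriveM (is_derive_cst m x (1:R)) (is_derive_id x (1:R))).
  by move/is_derive_eq; apply; rewrite /GRing.scale/= mulr1 mulr0 addr0 add0r.
move=> [h1 h2]; split; rewrite ?ReZ ?ImZ mulrC.
  exact: (@is_derive1_comp _ (fun t => complex.Re (G t)) (fun u => c + m * u)).
exact: (@is_derive1_comp _ (fun t => complex.Im (G t)) (fun u => c + m * u)).
Qed.

Lemma cderivB F f G g x : cderiv F f x -> cderiv G g x ->
  cderiv (fun t => F t - G t) (fun t => f t - g t) x.
Proof.
move=> hF hG; apply: (@cderiv_eq _ _ (fun t => f t + -1 * g t)); last first.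
  by rewrite mulN1r.
have := cderivD hF (cderivZ (-1) hG).
by rewrite (_ : (fun t => F t + -1 * G t) = fun t => F t - G t)//;
  apply/funext => t; rewrite mulN1r.
Qed.

Lemma ccont_affine g (c m : R) : continuous (g : R -> R[i]^o) ->
  continuous ((fun u => g (c + m * u)) : R -> R[i]^o).
Proof.
move=> cg x; have ca : (fun u : R => c + m * u) @ x --> c + m * x.
  by apply: cvgD; [exact: cvg_cst|apply: cvgM; [exact: cvg_cst|exact: cvg_id]].
exact: (cvg_comp _ _ ca (cg _)).
Qed.

(** Integrals with different lower ends are compared through one primitive,
    based at a point [c] to the left of them all: there it is differentiable up
    to and including their endpoints. *)
Lemma cint_prim g c a b : continuous (g : R -> R[i]^o) -> c < a -> a <= b ->
  cint `[a, b] g = cint `[c, b] g - cint `[c, a] g.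
Proof.
move=> cg ca ab; apply: (@cint_FTC2 _ (fun y => cint `[c, y] g)) => // x /andP[x1 _].
by apply: cint_deriv; [exact: cg|lra].
Qed.

Lemma cint_affine g (c m : R) : continuous (g : R -> R[i]^o) -> 0 <= m ->
  m%:C * cint `[0, 1] (fun u => g (c + m * u)) = cint `[c, c + m] g.
Proof.
move=> cg m0; rewrite -cont_cintZ; last exact: ccont_affine.
have ltc : c - 1 < c by lra.
have lcm : c <= c + m by lra.
rewrite (cint_prim cg ltc lcm).
have e : cint `[0, 1] (fun u => m%:C * g (c + m * u)) =
    cint `[c - 1, c + m * 1] g - cint `[c - 1, c + m * 0] g.
  apply: (@cint_FTC2 _ (fun u => cint `[c - 1, c + m * u] g)).
  - exact: ler01.
  - by apply: ccontM; [exact: ccont_cst|exact: ccont_affine].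
  move=> x /andP[x0 _]; apply: (@cderiv_affine (fun y => cint `[c - 1, y] g)).
  apply: cint_deriv; first exact: cg.
  have : 0 <= m * x by rewrite mulr_ge0.
  by lra.
by rewrite e mulr1 mulr0 addr0.
Qed.

Lemma cint_sym g (p : R) : continuous (g : R -> R[i]^o) -> 0 <= p ->
  cint `[- p, p] g = cint `[0, p] (fun x => g x + g (- x)).
Proof.
move=> cg p0; have l1 : - p - 1 < - p by lra.
have l2 : - p <= p by lra.
rewrite (cint_prim cg l1 l2).
have cg' : continuous ((fun x => g (- x)) : R -> R[i]^o).
  have := @ccont_affine g 0 (-1) cg.
  by rewrite (_ : (fun u => g (0 + -1 * u)) = fun u => g (- u))//;
    apply/funext => u; rewrite add0r mulN1r.
have e : cint `[0, p] (fun x => g x + g (- x)) =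
    (cint `[- p - 1, p] g - cint `[- p - 1, - p] g) -
    (cint `[- p - 1, 0] g - cint `[- p - 1, - 0] g); last first.
  by rewrite e oppr0 subrr subr0.
apply: (@cint_FTC2 _ (fun x => cint `[- p - 1, x] g - cint `[- p - 1, - x] g)).
- exact: p0.
- exact: (ccontD cg cg').
move=> x /andP[x0 x1].
have d1 : cderiv (fun y => cint `[- p - 1, y] g) g x by apply: cint_deriv; [exact: cg|lra].
have d2 : cderiv (fun y => cint `[- p - 1, 0 + -1 * y] g) (fun u => (-1)%:C * g (0 + -1 * u)) x.
  by apply: (@cderiv_affine (fun y => cint `[- p - 1, y] g)); apply: cint_deriv; [exact: cg|lra].
rewrite (_ : (fun x => _ - _) = fun y => cint `[- p - 1, y] g - cint `[- p - 1, 0 + -1 * y] g); last first.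
  by apply/funext => y; rewrite add0r mulN1r.
apply: cderiv_eq (cderivB d1 d2) _.
by rewrite add0r mulN1r rmorphN1 mulN1r opprK.
Qed.

(** The integral of a periodic function over a period does not see
    translations of its argument. *)
Lemma cint_periodic g (p d : R) : continuous (g : R -> R[i]^o) -> 0 <= p ->
  0 <= d -> (forall x, g (x + 2 * p) = g x) ->
  cint `[- p, p] (fun x => g (x + d)) = cint `[- p, p] g.
Proof.
move=> cg p0 d0 per.
pose G y := cint `[- p - 1, y] g.
have dG y : - p - 1 < y -> cderiv G g y by exact: cint_deriv.
have l1 : - p - 1 < - p by lra.
have l2 : - p <= p by lra.
have shift c x : - p - 1 < c + x -> cderiv (fun x => G (c + x)) (fun x => g (c + x)) x.
  move=> h; have := @cderiv_affine G g c 1 x.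
  rewrite mul1r => /(_ (dG _ h)).
  rewrite (_ : (fun u => G (c + 1 * u)) = fun u => G (c + u)); last first.
    by apply/funext => u; rewrite mul1r.
  by move/cderiv_eq; apply; rewrite mul1r mul1r.
have cs c : continuous ((fun x => g (c + x)) : R -> R[i]^o).
  have := @ccont_affine g c 1 cg.
  by rewrite (_ : (fun u => g (c + 1 * u)) = fun u => g (c + u))//;
    apply/funext => u; rewrite mul1r.
have -> : (fun x => g (x + d)) = (fun x => g (d + x)).
  by apply/funext => x; rewrite addrC.
have -> : cint `[- p, p] (fun x => g (d + x)) = G (d + p) - G (d + - p).
  apply: (@cint_FTC2 _ (fun x => G (d + x))); [exact: l2|exact: cs|].
  by move=> x /andP[x1 x2]; apply: shift; lra.
rewrite (cint_prim cg l1 l2) -/(G p) -/(G (- p)).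
have : cint `[- p, d - p] (fun x : R => 0) = (G (2 * p + (d - p)) - G (0 + (d - p))) -
    (G (2 * p + - p) - G (0 + - p)).
  apply: (@cint_FTC2 _ (fun x => G (2 * p + x) - G (0 + x))); [lra|exact: ccont_cst|].
  move=> x /andP[x1 x2].
  have s1 : - p - 1 < 2 * p + x by lra.
  have s2 : - p - 1 < 0 + x by lra.
  apply: cderiv_eq (cderivB (shift _ _ s1) (shift _ _ s2)) _.
  by rewrite [2 * p + x]addrC per add0r subrr.
have lcd : - p <= d - p by lra.
rewrite cont_cint_cst// mulr0 !add0r.
have -> : 2 * p + (d - p) = d + p by ring.
have -> : 2 * p + - p = p by ring.
move/esym/eqP; rewrite subr_eq0 => /eqP <-.
by [].
Qed.

End primitives.

Section contour.
Context {R : realType}.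
Implicit Types (f g : R[i] -> R[i]) (z w : R[i]).

(** Compactness makes the constants in [hol] uniform along a compact family of
    points. *)
Lemma hol_uniform (T : topologicalType) (D : set T) (gam : T -> R[i]) f :
  compact D -> continuous (gam : T -> R[i]^o) ->
  (forall u, D u -> hol f (gam u)) ->
  exists r K, [/\ 0 < r, 0 <= K & forall u w z z', D u ->
    cabs (w - gam u) < r -> cabs (z - gam u) < r -> cabs (z' - gam u) < r ->
    dd_bound f K w z z'].
Proof.
move=> /compact_near_coveringP cD cg hf.
pose P (n : nat) u := forall w z z', cabs (w - gam u) < n.+1%:R^-1 ->
  cabs (z - gam u) < n.+1%:R^-1 -> cabs (z' - gam u) < n.+1%:R^-1 ->
  dd_bound f n%:R w z z'.
have /(_ _)[|n _ /(_ n (leqnn n)) hn] := cD nat \oo P _; last first.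
  by exists n.+1%:R^-1, n%:R; split=> // u w z z' /hn; exact.
move=> u Du; have [r [K [r0 K0 h]]] := hf u Du.
have r20 : 0 < r / 2 by rewrite divr_gt0.
have /cvg_cabsP/cvgrPdist_lt/(_ _ r20) near1 := cg u.
have near2 : \forall n \near \oo, n.+1%:R^-1 < r / 2 /\ K <= n%:R.
  near=> n; split; last by near: n; exact: nbhs_infty_ger.
  by near: n; exact: (near_infty_natSinv_lt (PosNum r20)).
exists ([set u' | `|0 - cabs (gam u' - gam u)| < r / 2],
        [set n | n.+1%:R^-1 < r / 2 /\ K <= n%:R]); first by split.
move=> [u' n] [/= h1 [h2 h3]] w z z' hw hz hz'.
have {}h1 : cabs (gam u' - gam u) < r / 2.
  by move: h1; rewrite sub0r normrN ger0_norm ?cabs_ge0.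
have cl y : cabs (y - gam u') < n.+1%:R^-1 -> cabs (y - gam u) < r.
  move=> hy; apply: le_lt_trans (cabs_dist _ (gam u') _) _.
  have -> : r = r / 2 + r / 2 by lra.
  by apply: ltrD => //; exact: lt_trans hy h2.
by apply: dd_bound_le h3 _; apply: h; exact: cl.
Unshelve. all: by end_near. Qed.

Let seg z (u : R) : R[i] := -1 + (clamp_to 0 1 u)%:C * (z + 1).

Let seg_cont z : continuous (seg z : R -> R[i]^o).
Proof.
apply: ccontD; first exact: ccont_cst.
by apply: ccontM; [apply: ccont_real; exact: clamp_to_cont|exact: ccont_cst].
Qed.

Let segI u : [set` `[(0 : R), 1]] (clamp_to 0 1 u).
Proof. by rewrite /= in_itv/= clamp_to_itv. Qed.

Let cprimE f z : cprim f z = (z + 1) * cint `[0, 1] (fun u => f (seg z u)).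
Proof.
rewrite /cprim; congr (_ * _); apply: eq_cint => u hu.
by rewrite /seg clamp_to_id.
Qed.

(** The segments from -1 to the points near [z0] lie in a neighbourhood of the
    segment from -1 to [z0] in which the constants are uniform; the bounds for
    the integrand can then be integrated. *)
Lemma hol_cprim f z0 :
  (forall u : R, 0 <= u <= 1 -> hol f (-1 + u%:C * (z0 + 1))) -> hol (cprim f) z0.
Proof.
move=> hf.
have hf0 u : hol f (seg z0 u) by apply: hf; exact: clamp_to_itv.
have [r [K [r0 K0 hK]]] := hol_uniform (@segment_compact R 0 1) (@seg_cont z0) (fun u _ => hf0 u).
have near z u : cabs (z - z0) < r -> cabs (seg z u - seg z0 u) < r.
  move=> hz; rewrite (_ : seg z u - seg z0 u = (clamp_to 0 1 u)%:C * (z - z0)); last first.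
    by rewrite /seg; ring.
  apply: le_lt_trans hz; rewrite cabsM cabs_real.
  have /andP[u0 u1] := clamp_to_itv u ler01.
  by rewrite ger0_norm// ler_piMl ?cabs_ge0.
have hz z u : cabs (z - z0) < r -> hol f (seg z u).
  move=> h; have h' := near z u h; have r2 : 0 < r - cabs (seg z u - seg z0 u) by lra.
  exists (r - cabs (seg z u - seg z0 u)), K; split=> // y1 y2 y3 k1 k2 k3.
  have tri y : cabs (y - seg z u) < r - cabs (seg z u - seg z0 u) -> cabs (y - seg z0 (clamp_to 0 1 u)) < r.
    move=> hy; have -> : seg z0 (clamp_to 0 1 u) = seg z0 u.
      by rewrite /seg (clamp_to_id (clamp_to_itv u ler01)).
    by apply: le_lt_trans (cabs_dist _ (seg z u) _) _; lra.
  by apply: (hK (clamp_to 0 1 u)); [exact: segI|exact: tri..].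
have cont z : cabs (z - z0) < r -> continuous ((fun u => f (seg z u)) : R -> R[i]^o).
  by move=> h; apply: hol_path => [|u]; [exact: seg_cont|exact: hz].
have -> : cprim f = fun z => (z + 1) * cint `[0, 1] (fun u => f (seg z u)).
  by apply/funext => z; exact: cprimE.
apply: (@holM _ (fun z => z + 1)).
  by apply: holD; [exact: hol_id|exact: hol_cst].
exists r, K; split=> // w z z' hw hz1 hz2.
have [cw cz cz'] := And3 (cont w hw) (cont z hz1) (cont z' hz2).
have sd x y u : seg x u - seg y u = (clamp_to 0 1 u)%:C * (x - y).
  by rewrite /seg; ring.
have ddu u : dd_bound f K (seg w u) (seg z u) (seg z' u).
  have e : seg z0 (clamp_to 0 1 u) = seg z0 u by rewrite /seg (clamp_to_id (clamp_to_itv u ler01)).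
  by apply: (hK (clamp_to 0 1 u)); [exact: segI|rewrite e; exact: near..].
split.
  rewrite -(cont_cintB _ _ cz cw) -[leRHS]mulr1 -[X in _ * X](subr0 1).
  apply: cont_cint_abs; [exact: ler01|exact: (ccontB cz cw)|].
  move=> u _; have [+ _] := ddu u; move=> /le_trans; apply.
  rewrite ler_wpM2l// sd cabsM cabs_real.
  by have /andP[u0 u1] := clamp_to_itv u ler01; rewrite ger0_norm// ler_piMl ?cabs_ge0.
have czw := ccontB cz cw; have czw' := ccontB cz' cw.
have m1 := ccontM (@ccont_cst _ (z' - w)) czw.
have m2 := ccontM (@ccont_cst _ (z - w)) czw'.
rewrite -(cont_cintB _ _ cz cw) -(cont_cintB _ _ cz' cw).
rewrite -(cont_cintZ _ _ _ czw) -(cont_cintZ _ _ _ czw') -(cont_cintB _ _ m1 m2).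
rewrite -[leRHS]mulr1 -[X in _ * X](subr0 1).
apply: cont_cint_abs; [exact: ler01|exact: (ccontB m1 m2)|].
move=> u _; have [lip dd] := ddu u.
have /andP[u0 u1] := clamp_to_itv u ler01.
have [c0|c0] := eqVneq (clamp_to 0 1 u) 0.
  by rewrite /seg c0 !mul0r !addr0 !subrr !mulr0 subrr cabs0 !mulr_ge0 ?cabs_ge0.
have cp : 0 < clamp_to 0 1 u by rewrite lt_neqAle eq_sym c0.
have ac : cabs (clamp_to 0 1 u)%:C = clamp_to 0 1 u by rewrite cabs_real ger0_norm.
rewrite -(ler_pM2l cp) -{1}ac -(cabsM (clamp_to 0 1 u)%:C).
have -> : (clamp_to 0 1 u)%:C * ((z' - w) * (f (seg z u) - f (seg w u)) -
   (z - w) * (f (seg z' u) - f (seg w u))) =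
   (seg z' u - seg w u) * (f (seg z u) - f (seg w u)) -
   (seg z u - seg w u) * (f (seg z' u) - f (seg w u)) by rewrite !sd; ring.
apply: le_trans dd _; rewrite !sd !cabsM !ac.
rewrite (_ : K * _ = clamp_to 0 1 u * (clamp_to 0 1 u * clamp_to 0 1 u * (K * (cabs (z - w) * cabs (z' - w) * cabs (z - z'))))); last by ring.
rewrite ler_wpM2l// ler_piMl ?mulr_ge0 ?cabs_ge0//.
by rewrite mulr_ile1.
Qed.

(** On the interval the segment primitive is the usual one. *)
Lemma cprim_prim f t : contI (fun s => f s%:C) -> Iset t ->
  cprim f t%:C = prim (fun s => f s%:C) t.
Proof.
move=> cf It; have := It; rewrite /Iset/= in_itv/= => /andP[t0 t1].
have t2 : 0 <= t + 1 by lra.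
have := cint_affine (-1) (contI_clamp cf) t2.
have -> : -1 + (t + 1) = t by ring.
rewrite /prim => <-; rewrite /cprim rmorphD rmorph1; congr (_ * _).
apply: eq_cint => u /andP[u0 u1]; rewrite clamp_id; last first.
  rewrite /Iset/= in_itv/=.
  have : 0 <= (t + 1) * u by rewrite mulr_ge0.
  have : (t + 1) * u <= t + 1 by rewrite ler_piMr.
  by move: (_ * u) => y; lra.
by congr (f _); rewrite rmorphD rmorphN rmorphM rmorphD rmorph1 mulrC.
Qed.

(** On the right-angled triangle of vertices [z], [z + d], [z + i d], the second
    divided difference compares [i (H (z + d) - H z)] with [H (z + i d) - H z] up
    to order [d^2]. Averaged over a period the second difference vanishes, so a
    step of length [d] to the right changes the average by [O (d^2)] only, and
    [n] steps of length [eta / n] change it by [O (1 / n)]. *)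
Lemma mean_shift (H : R[i] -> R[i]) (eta : R) : 0 < eta ->
  (forall s th : R, 0 <= s <= eta -> hol H (s +i* th)) ->
  (forall z, H (z + (0 +i* (2 * pi))) = H z) ->
  cint `[- pi, pi] (fun th => H (eta +i* th)) =
  cint `[- pi, pi] (fun th => H (0 +i* th)).
Proof.
move=> eta0 hH per; pose D s := cint `[- pi, pi] (fun th => H (s +i* th)).
rewrite -/(D eta) -/(D 0).
have pi0 : 0 <= pi :> R by exact: pi_ge0.
have lpi : - pi <= pi :> R by lra.
have cH s : 0 <= s <= eta -> continuous ((fun th => H (s +i* th)) : R -> R[i]^o).
  move=> hs; apply: hol_path => [|th]; last exact: hH.
  by apply/ccontP; split=> x; [exact: cvg_cst|exact: cvg_id].
pose Q := `[(0 : R), eta]%classic `*` `[- pi, (pi : R)]%classic.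
have cQ : compact Q by apply: compact_setX; exact: segment_compact.
pose gam (p : R * R) : R[i] := p.1 +i* p.2.
have cgam : continuous (gam : R * R -> R[i]^o).
  by move=> p; apply/cvg_ReImP; split; [exact: cvg_fst|exact: cvg_snd].
have hQ p : Q p -> hol H (gam p).
  by move=> [/= h1 _]; apply: hH; move: h1; rewrite in_itv.
have [r [K [r0 K0 hK]]] := hol_uniform cQ cgam hQ.
have step s d : 0 <= s -> 0 < d -> s + d <= eta -> d < r ->
    cabs (D (s + d) - D s) <= 4 * pi * K * d ^+ 2.
  move=> s0 d0 sd dr.
  have hs1 : 0 <= s <= eta by lra.
  have hs2 : 0 <= s + d <= eta by lra.
  have c1 := cH _ hs1; have c2 := cH _ hs2.
  have c3 : continuous ((fun th => H (s +i* (th + d))) : R -> R[i]^o).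
    have := @ccont_affine _ _ d 1 c1.
    by rewrite (_ : (fun u => _) = fun th => H (s +i* (th + d)))//;
      apply/funext => u; rewrite mul1r addrC.
  have e3 : cint `[- pi, pi] (fun th => H (s +i* (th + d))) = D s.
    apply: (@cint_periodic _ (fun th => H (s +i* th)) pi d c1 pi0 (ltW d0)) => x.
    by rewrite -[RHS]per; congr H; apply: complex_ext; rewrite ?ReD ?ImD /= ?addr0.
  have ab0 : cabs (0 +i* d) = d.
    by rewrite (_ : 0 +i* d = 'i * d%:C); [rewrite cabsM cabs_real ger0_norm ?(ltW d0)//
      /cabs/= expr0n expr1n add0r sqrtr1 mul1r|apply: complex_ext; rewrite ?ReM ?ImM /=; ring].
  have m1 := ccontM (@ccont_cst _ (0 +i* d)) (ccontB c2 c1).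
  have m2 := ccontM (@ccont_cst _ d%:C) (ccontB c3 c1).
  have : cabs (cint `[- pi, pi] (fun th =>
      (0 +i* d) * (H ((s + d) +i* th) - H (s +i* th)) -
      d%:C * (H (s +i* (th + d)) - H (s +i* th)))) <= K * (2 * d ^+ 3) * (pi - - pi).
    apply: cont_cint_abs; [exact: lpi|exact: (ccontB m1 m2)|].
    move=> th hth.
    have q1 : (s +i* (th + d)) - (s +i* th) = 0 +i* d.
      by apply: complex_ext; rewrite ?ReB ?ImB /=; ring.
    have q2 : ((s + d) +i* th) - (s +i* th) = d%:C.
      by apply: complex_ext; rewrite ?ReB ?ImB /=; ring.
    have := hK (s, th) (s +i* th) ((s + d) +i* th) (s +i* (th + d)).
    have -> : gam (s, th) = s +i* th by [].
    rewrite subrr q1 q2 cabs0 cabs_real (ger0_norm (ltW d0)) ab0 /dd_bound q1 q2.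
    rewrite cabs_real (ger0_norm (ltW d0)) ab0.
    have Qs : Q (s, th) by split; rewrite /= in_itv.
    move=> /(_ Qs r0 dr dr)[_] /le_trans; apply; rewrite ler_wpM2l//.
    rewrite (_ : 2 * d ^+ 3 = d * d * (d + d)); last by ring.
    rewrite ler_wpM2l ?mulr_ge0 ?(ltW d0)//.
    rewrite (_ : ((s + d) +i* th) - (s +i* (th + d)) = d%:C - (0 +i* d)); last first.
      by apply: complex_ext; rewrite ?ReB ?ImB /=; ring.
    by apply: le_trans (cabs_sub _ _) _; rewrite cabs_real (ger0_norm (ltW d0)) ab0.
  rewrite (cont_cintB _ _ m1 m2) (cont_cintZ _ _ _ (ccontB c2 c1)).
  rewrite (cont_cintZ _ _ _ (ccontB c3 c1)) (cont_cintB _ _ c2 c1) (cont_cintB _ _ c3 c1) e3 subrr mulr0 subr0 cabsM ab0 -/(D _).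
  move=> h; rewrite -(ler_pM2l d0); apply: le_trans h _.
  by rewrite le_eqVlt; apply/orP; left; apply/eqP; ring.
apply/eqP; rewrite -subr_eq0; apply/eqP; apply: cabs0_eq0.
apply/eqP; rewrite eq_le cabs_ge0 andbT; apply: ler_addeps => e e0.
pose L := 4 * pi * K * eta ^+ 2.
have L0 : 0 <= L by rewrite !mulr_ge0 ?(ltW eta0).
have m0 : 0 < Num.min (r / eta) (e / (L + 1)).
  by rewrite lt_min !divr_gt0//; lra.
have [n _ /(_ n (leqnn n))/=] := near_infty_natSinv_lt (PosNum m0).
rewrite /= lt_min => /andP[n1 n2].
pose d := eta / n.+1%:R.
have d0 : 0 < d by rewrite divr_gt0.
have dr : d < r by move: n1; rewrite ltr_pdivlMr// mulrC.
have nd : n.+1%:R * d = eta by rewrite /d mulrCA mulfV ?mulr1 ?pnatr_eq0.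
have ind k : (k <= n.+1)%N -> cabs (D (k%:R * d) - D 0) <= k%:R * (4 * pi * K * d ^+ 2).
  elim: k => [|k IH] hk; first by rewrite !mul0r subrr cabs0.
  have -> : k.+1%:R * d = k%:R * d + d by rewrite -natr1; ring.
  apply: le_trans (cabs_dist _ (D (k%:R * d)) _) _.
  have -> : k.+1%:R * (4 * pi * K * d ^+ 2) = 4 * pi * K * d ^+ 2 +
     k%:R * (4 * pi * K * d ^+ 2) by rewrite -natr1; ring.
  apply: lerD; last by apply: IH; exact: ltnW.
  apply: step => //; first by rewrite mulr_ge0// ltW.
  rewrite -nd (_ : k%:R * d + d = k.+1%:R * d); last by rewrite -natr1; ring.
  by rewrite ler_pM2r// ler_nat.
have := ind n.+1 (leqnn _); rewrite nd => /le_trans; apply.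
rewrite (_ : _ * _ = L * n.+1%:R^-1); last first.
  have : n.+1%:R != 0 :> R by rewrite pnatr_eq0.
  by rewrite /L -nd; move: (n.+1%:R : R) (d) => m d' m1; field.
rewrite add0r; apply: (@le_trans _ _ (L * (e / (L + 1)))).
  by rewrite ler_wpM2l// ltW.
by rewrite mulrCA ler_piMr ?(ltW e0)// ler_pdivrMr; lra.
Qed.

End contour.

Section coefficient_decay.
Context {R : realType}.
Implicit Types (f g : R[i] -> R[i]) (z w : R[i]).

(** With [z = i th] this is [cos th]; it maps vertical lines to ellipses of foci
    -1 and 1. *)
Definition ccosh z : R[i] := 2^-1 * (cexp z + cexp (- z)).

Lemma ccoshE (x y : R) : ccosh (x +i* y) =
  ((expR x + expR (- x)) / 2 * cos y) +i* ((expR x - expR (- x)) / 2 * sin y).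
Proof.
have -> : ccosh (x +i* y) = (2^-1 : R)%:C * (cexp (x +i* y) + cexp ((- x) +i* (- y))).
  by rewrite /ccosh fmorphV rmorph_nat.
apply: complex_ext; rewrite ?ReZ ?ImZ ?ReD ?ImD !cexpE /= ?cosN ?sinN; ring.
Qed.

Lemma cexp_period z : cexp (z + (0 +i* (2 * pi))) = cexp z.
Proof.
have c2 : cos (2 * pi) = 1 :> R by rewrite mulr_natl cos2pi.
have s2 : sin (2 * pi) = 0 :> R by rewrite mulr_natl mulr2n sinD sinpi mulr0 mul0r addr0.
rewrite cexpD [cexp (0 +i* _)]cexpE /= expR0 c2 s2 mulr1 mulr0.
exact: mulr1.
Qed.

Lemma cexp_nat n z : cexp (n%:R * z) = cexp z ^+ n.
Proof.
elim: n => [|n IH]; first by rewrite mul0r cexp0.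
by rewrite -natr1 mulrDl mul1r cexpD IH exprSr.
Qed.

Lemma cexp_period_nat n z : cexp (- n%:R * (z + (0 +i* (2 * pi)))) = cexp (- n%:R * z).
Proof. by rewrite !mulNr !cexpN !cexp_nat cexp_period. Qed.

Lemma ccosh_period z : ccosh (z + (0 +i* (2 * pi))) = ccosh z.
Proof. by rewrite /ccosh !cexpN cexp_period. Qed.

Lemma hol_ccosh z : hol ccosh z.
Proof.
apply: holZ; apply: holD; first exact: hol_cexp.
apply: (@hol_comp _ cexp (fun z => - z)); first exact: hol_cexp.
rewrite (_ : (fun z => - z) = fun z => -1 * z); last by apply/funext => y; rewrite mulN1r.
by apply: holZ; exact: hol_id.
Qed.

Variables (S s eta : R).
Hypotheses (S0 : 0 < S) (s0 : 0 < s) (foci : S ^+ 2 = s ^+ 2 + 1)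
  (etaE : expR eta = S + s) (Ss1 : 1 < S + s).

Lemma eta_gt0 : 0 < eta. Proof. by rewrite -expR_gt1 etaE. Qed.

(** The semiaxes are determined by [S + s = exp eta] and
    [(S + s) (S - s) = 1]. *)
Lemma semiaxes : (expR eta + expR (- eta)) / 2 = S /\
  (expR eta - expR (- eta)) / 2 = s.
Proof.
have -> : expR (- eta) = S - s.
  have p : S + s != 0 by rewrite gt_eqF ?addr_gt0.
  apply: (mulfI p); rewrite -{1}etaE -expRD subrr expR0.
  have -> : (S + s) * (S - s) = S ^+ 2 - s ^+ 2 by ring.
  by rewrite foci; ring.
by rewrite etaE; split; lra.
Qed.

Lemma ellipse_ccosh (x y : R) : 0 <= x <= eta -> ellipse S s (ccosh (x +i* y)).
Proof.
move=> /andP[x0 x1]; have [hS hs] := semiaxes.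
rewrite ccoshE /ellipse/=.
set C := (expR x + _) / 2; set D := (expR x - _) / 2.
have ex1 : 1 <= expR x by rewrite -[leLHS]expR0 ler_expR.
have exN : expR (- x) <= 1 by rewrite -[leRHS]expR0 ler_expR; lra.
have ee : expR x <= expR eta by rewrite ler_expR.
have een : expR (- eta) <= expR (- x) by rewrite ler_expR; lra.
have [ep ep'] : 0 < expR (- eta) /\ 0 < expR (- x) by rewrite !expR_gt0.
have D0 : 0 <= D by rewrite /D; lra.
have C0 : 0 <= C by rewrite /C; lra.
have Ds : D <= s by rewrite -hs /D; lra.
have CS : C <= S.
  have i1 : expR x * expR (- x) = 1 by rewrite -expRD subrr expR0.
  have i2 : expR eta * expR (- eta) = 1 by rewrite -expRD subrr expR0.
  have : 0 <= (expR eta - expR x) * (1 - expR (- eta) * expR (- x)).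
    rewrite mulr_ge0//; first by lra.
    rewrite subr_ge0 mulr_ile1 ?expR_ge0//; lra.
  have -> : (expR eta - expR x) * (1 - expR (- eta) * expR (- x)) =
     expR eta - expR x - (expR eta * expR (- eta)) * expR (- x) +
     (expR x * expR (- x)) * expR (- eta) by ring.
  rewrite i1 i2 -hS /C; lra.
have q1 : (C / S) ^+ 2 <= 1.
  by apply: exprn_ile1; rewrite ?divr_ge0 ?(ltW S0)// ler_pdivrMr// mul1r.
have q2 : (D / s) ^+ 2 <= 1.
  by apply: exprn_ile1; [rewrite divr_ge0// ltW|rewrite ler_pdivrMr// mul1r].
have -> : C * cos y / S = C / S * cos y by ring.
have -> : D * sin y / s = D / s * sin y by ring.
rewrite (exprMn 2 (C / S)) (exprMn 2 (D / s)) -[leRHS](cos2Dsin2 y).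
by apply: lerD; rewrite ler_piMl ?sqr_ge0.
Qed.

Lemma S_ge1 : 1 <= S.
Proof.
rewrite -(@ler_pXn2r _ 2) ?nnegrE ?ler01 ?(ltW S0)//.
by rewrite expr1n foci lerDr sqr_ge0.
Qed.

(** The ellipse is convex and contains -1. *)
Lemma ellipse_seg z (u : R) : 0 <= u <= 1 -> ellipse S s z ->
  ellipse S s (-1 + u%:C * (z + 1)).
Proof.
move=> /andP[u0 u1]; rewrite /ellipse/= => hz.
have -> : complex.Re (-1 + u%:C * (z + 1)) = u * complex.Re z - (1 - u).
  by rewrite ReD ReZ ReD /=; ring.
have -> : complex.Im (-1 + u%:C * (z + 1)) = u * complex.Im z.
  by rewrite ImD ImZ ImD /=; ring.
move: hz; set x := complex.Re z; set y := complex.Im z => hz.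
have iS : S^-1 ^+ 2 <= 1.
  by rewrite expr_le1// ?invr_ge0 ?(ltW S0)// invf_le1// S_ge1.
have -> : (u * x - (1 - u)) / S = u * (x / S) - (1 - u) * S^-1 by ring.
have -> : u * y / s = u * (y / s) by ring.
move: hz iS; move: S^-1 (x / S) (y / s) => r p q hz iS.
have h1 : 0 <= u * (1 - u) * ((p + r) ^+ 2 + q ^+ 2).
  by rewrite mulr_ge0 ?addr_ge0 ?sqr_ge0// mulr_ge0//; lra.
have h2 : 0 <= u * (1 - (p ^+ 2 + q ^+ 2)) by rewrite mulr_ge0//; lra.
have h3 : 0 <= (1 - u) * (1 - r ^+ 2) by rewrite mulr_ge0//; lra.
rewrite -subr_ge0 (_ : _ - _ = u * (1 - u) * ((p + r) ^+ 2 + q ^+ 2) +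
  u * (1 - (p ^+ 2 + q ^+ 2)) + (1 - u) * (1 - r ^+ 2)); first by lra.
by ring.
Qed.

Lemma ellipse_I (t : R) : Iset t -> ellipse S s t%:C.
Proof.
rewrite /Iset/= in_itv/= => /andP[t0 t1].
rewrite /ellipse/= mul0r expr0n addr0 expr_div_n ler_pdivrMr ?exprn_gt0// mul1r foci.
have : 0 <= (1 - t) * (1 + t) by rewrite mulr_ge0//; lra.
by have := sqr_ge0 s; lra.
Qed.

Lemma hol_contI f : (forall z, ellipse S s z -> hol f z) -> contI (fun t => f t%:C).
Proof.
move=> hf; apply: (@contI_eqI _ (fun t => f (clamp t)%:C)).
  by move=> t It; rewrite clamp_id.
apply: contI_cont; apply: (@hol_path _ f (fun t => (clamp t)%:C)).
  by apply: ccont_real; exact: clamp_cont.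
by move=> t; apply: hf; apply: ellipse_I; exact: clamp_I.
Qed.

Variables (a b : R[i] -> R[i]) (mu : R[i]) (AE BE delta : R).
Hypotheses (ha : forall z, ellipse S s z -> hol a z)
  (hb : forall z, ellipse S s z -> hol b z)
  (hA : forall z, ellipse S s z -> cabs (cprim a z) <= AE)
  (hB : forall z, ellipse S s z -> cabs (cprim b z) <= BE)
  (delta0 : 0 < delta) (dmu : delta <= cabs mu).

Let F z := cprim a z + mu^-1 * cprim b z.
Let H (j : nat) z := cexp (F (ccosh z)) * cexp (- j%:R * z).

Let holF z : ellipse S s z -> hol F z.
Proof.
move=> hz; apply: holD; last apply: holZ.
  by apply: hol_cprim => u hu; apply: ha; exact: ellipse_seg.
by apply: hol_cprim => u hu; apply: hb; exact: ellipse_seg.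
Qed.

Let holH j (x y : R) : 0 <= x <= eta -> hol (H j) (x +i* y).
Proof.
move=> hx; apply: holM.
  apply: (@hol_comp _ cexp (fun z => F (ccosh z))); first exact: hol_cexp.
  by apply: hol_comp; [apply: holF; exact: ellipse_ccosh|exact: hol_ccosh].
apply: (@hol_comp _ cexp (fun z => - j%:R * z)); first exact: hol_cexp.
by apply: holZ; exact: hol_id.
Qed.

Let F_bound z : ellipse S s z -> complex.Re (F z) <= AE + BE / delta.
Proof.
move=> hz; apply: le_trans (ler_norm _) _; apply: le_trans (Re_le_cabs _) _.
apply: le_trans (cabsD _ _) _; apply: lerD; first exact: hA.
have mu0 : 0 < cabs mu := lt_le_trans delta0 dmu.
rewrite cabsM cabsV mulrC; apply: ler_pM; rewrite ?cabs_ge0 ?invr_ge0 ?cabs_ge0//.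
  exact: hB.
by rewrite lef_pV2.
Qed.

(** The [j]-th Chebyshev coefficient of a function analytic in the ellipse of
    parameter [eta] is, after [t = cos th], a Fourier coefficient; shifting the
    contour by [eta] gains the factor [exp (- j eta)]. *)
Lemma coef_decay j : cabs (coefT (fun t : R => cexp (F t%:C)) j) <=
  nk j * pi * (expR (AE + BE / delta) * expR (- (j%:R * eta))).
Proof.
have cF : contI (fun t : R => cexp (F t%:C)).
  by apply: contI_cexp; apply: hol_contI; exact: holF.
have pi0 : 0 <= pi :> R by exact: pi_ge0.
have lpi : - pi <= pi :> R by lra.
have e0 := ltW eta_gt0.
have cH x : 0 <= x <= eta -> continuous ((fun th => H j (x +i* th)) : R -> R[i]^o).
  move=> hx; apply: hol_path => [|th]; last exact: holH.
  by apply/ccontP; split=> y; [exact: cvg_cst|exact: cvg_id].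
have per z : H j (z + (0 +i* (2 * pi))) = H j z.
  by rewrite /H ccosh_period cexp_period_nat.
have shift := mean_shift eta_gt0 (@holH j) per.
have h00 : 0 <= (0 : R) <= eta by rewrite lexx.
have hee : 0 <= eta <= eta by rewrite lexx andbT.
have H0 (th : R) : H j (0 +i* th) = cexp (F (cos th)%:C) * (cos (j%:R * th) +i* (- sin (j%:R * th))).
  rewrite /H ccoshE oppr0 expR0 subrr mul0r mul0r (_ : (1 + 1) / 2 = 1 :> R); last by lra.
  rewrite mul1r; congr (_ * _).
  have -> : - j%:R * (0 +i* th) = (0 : R) +i* (- (j%:R * th)).
    have -> : - j%:R = (- j%:R)%:C :> R[i] by rewrite rmorphN rmorph_nat.
    by apply: complex_ext; rewrite ?ReZ ?ImZ /= ?mulr0 ?mulNr.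
  by rewrite cexpE /= expR0 !mul1r cosN sinN.
have half : cint `[0, pi] (fun x => cexp (F (cos x)%:C) * (cos (j%:R * x))%:C) =
    2^-1 * cint `[- pi, pi] (fun th => H j (eta +i* th)).
  rewrite shift (cint_sym (cH _ h00) pi0).
  have -> : cint `[0, pi] (fun x => H j (0 +i* x) + H j (0 +i* (- x))) =
     cint `[0, pi] (fun x => 2 * (cexp (F (cos x)%:C) * (cos (j%:R * x))%:C)).
    apply: eq_cint => x _; rewrite !H0 cosN mulrN cosN sinN opprK -mulrDr mulrCA; congr (_ * _).
    by apply: complex_ext; rewrite ?ReD ?ImD ?ReM ?ImM /=; ring.
  rewrite (cont_cintZ 2 _ _ (@ccont_coef _ _ j cF)).
  by rewrite mulKf// pnatr_eq0.
rewrite coefTE// half mulrA cabsM cabsM cabs_real ger0_norm ?nk_ge0//.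
rewrite cabsV cabs_nat -!mulrA ler_wpM2l ?nk_ge0//.
rewrite -(@ler_pM2l _ 2)// mulVKf ?pnatr_eq0//.
set M := expR (AE + _) * _.
have -> : 2 * (pi * M) = M * (pi - - pi) by ring.
apply: cont_cint_abs; [exact: lpi|exact: cH|].
move=> th _; rewrite /H (cabsM (cexp _)) !cabs_cexp.
apply: ler_pM; rewrite ?expR_ge0// ler_expR.
  by apply: F_bound; exact: ellipse_ccosh.
have -> : - j%:R = (- j%:R)%:C :> R[i] by rewrite rmorphN rmorph_nat.
by rewrite ReZ /= mulNr.
Qed.

End coefficient_decay.

(** * The tail of an eigenfunction *)

Section tail.
Context {R : realType}.
Implicit Types (q h K eta M : R) (c : nat -> R[i]).

(** Removing the first term shifts [K] by one, which allows an induction on the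
    number of terms. *)
Lemma sum_sq_geo q h K n : 0 < h -> h <= 1 -> q = 1 - h -> 0 <= K ->
  \sum_(i < n) (K + i%:R) ^+ 2 * q ^+ i <= K ^+ 2 / h + 2 * K / h ^+ 2 + 2 / h ^+ 3.
Proof.
move=> h0 h1 qE; have q0 : 0 <= q by lra.
elim: n K => [|n IH] K K0.
  by rewrite big_ord0 !addr_ge0// divr_ge0 ?exprn_ge0 ?mulr_ge0// ltW.
rewrite big_ord_recl expr0 mulr1 addr0.
have -> : \sum_(i < n) (K + (lift ord0 i)%:R) ^+ 2 * q ^+ lift ord0 i =
    q * \sum_(i < n) (K + 1 + i%:R) ^+ 2 * q ^+ i.
  rewrite mulr_sumr; apply: eq_bigr => i _; rewrite lift0 (exprS q) -natr1; ring.
have K1 : 0 <= K + 1 by lra.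
apply: (@le_trans _ _ (K ^+ 2 + q * ((K + 1) ^+ 2 / h + 2 * (K + 1) / h ^+ 2 + 2 / h ^+ 3))).
  by rewrite lerD2l ler_wpM2l// IH.
rewrite -subr_ge0.
have -> : K ^+ 2 / h + 2 * K / h ^+ 2 + 2 / h ^+ 3 -
    (K ^+ 2 + q * ((K + 1) ^+ 2 / h + 2 * (K + 1) / h ^+ 2 + 2 / h ^+ 3)) =
    2 * K + 1 + h^-1 by rewrite qE; field; rewrite gt_eqF.
by rewrite !addr_ge0 ?mulr_ge0 ?invr_ge0 ?(ltW h0).
Qed.

(** If [eps < 1], then [k] cannot be small compared with [1 / h], where
    [h = 1 - exp (- 2 eta)], and the polynomial factors of the sum are absorbed
    in [k^2]. *)
Lemma eps_tail eta M (e : R) k n : 0 < eta -> 1 <= M -> (1 <= k)%N ->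
  e = 8 * (sinh eta)^-1 * M * k%:R * expR (- (k%:R * eta)) -> e < 1 ->
  \sum_(i < n) (k + i).+2%:R ^+ 2 * (6 * M ^+ 2 * expR (- (k.+1 + i)%:R * eta) ^+ 2)
  <= e ^+ 2 / 2.
Proof.
move=> eta0 M1 k1 eE e1.
pose r := expR (- eta); have r0 : 0 < r := expR_gt0 _.
have r1 : r < 1 by rewrite -expR0 ltr_expR; lra.
have rX j : expR (- j%:R * eta) = r ^+ j.
  by rewrite mulNr -mulrN expRM_natl.
pose q := r ^+ 2; pose h := 1 - q.
have q0 : 0 < q by rewrite exprn_gt0.
have q1 : q < 1 by rewrite exprn_ilt1// ltW.
have h0 : 0 < h by rewrite subr_gt0.
have hle : h <= 1 by rewrite /h; lra.
have sE : sinh eta = h / (2 * r).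
  rewrite /sinh /h /q /r -[expR eta]invrK -expRN; field.
  by rewrite gt_eqF ?expR_gt0.
have k0 : 1 <= k%:R :> R by rewrite ler1n.
have kp : 0 < k%:R :> R by lra.
have M0 : 0 < M by lra.
have eE' : e = 16 * M * k%:R * r ^+ k.+1 / h.
  rewrite eE -mulNr rX sE exprS; field.
  by rewrite !gt_eqF.
have kh : 15 / 16 < (k%:R + 1) * h.
  have b1 : 1 - (k%:R + 1) * h <= r ^+ k.+1.
    have hm : -1 <= - h by lra.
    apply: le_trans (_ : q ^+ k.+1 <= _).
      have := bernoulli_ineq k.+1 hm; rewrite mulrN -natr1.
      by rewrite [1 - h](_ : _ = q)// /h; lra.
    apply: lerXn2r; rewrite ?nnegrE ?(ltW q0) ?(ltW r0)//.
    by rewrite /q expr2 ler_piMl ?ltW.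
  have b2 : 16 * k%:R * r ^+ k.+1 < h.
    move: e1; rewrite eE' ltr_pdivrMr// mul1r; apply: le_lt_trans.
    rewrite -!mulrA ler_wpM2l// ler_peMl// mulr_ge0 ?(ltW kp)// exprn_ge0// ltW//.
  have b3 : 16 * r ^+ k.+1 <= 16 * k%:R * r ^+ k.+1.
    by rewrite ler_wpM2r ?exprn_ge0 ?(ltW r0)//; lra.
  by move: b1 b2 b3; move: (r ^+ _) (_ * h) => X Y; lra.
have hV : h^-1 <= 32 / 15 * k%:R.
  have : h^-1 <= 16 / 15 * (k%:R + 1).
    by rewrite -[h^-1]mul1r ler_pdivrMr// -(mulrA (16 / 15)); move: kh; move: (_ * h) => Y; lra.
  by lra.
have K0 : 0 <= k%:R + 2 :> R by lra.
have sum_le := sum_sq_geo n h0 hle (ltac:(rewrite /h; lra) : q = 1 - h) K0.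
have bound : (k%:R + 2) ^+ 2 / h + 2 * (k%:R + 2) / h ^+ 2 + 2 / h ^+ 3 <=
    64 / 3 * k%:R ^+ 2 / h ^+ 2.
  rewrite -subr_ge0.
  have -> : 64 / 3 * k%:R ^+ 2 / h ^+ 2 -
      ((k%:R + 2) ^+ 2 / h + 2 * (k%:R + 2) / h ^+ 2 + 2 / h ^+ 3) =
      (64 / 3 * k%:R ^+ 2 - (k%:R + 2) ^+ 2 * h - 2 * (k%:R + 2) - 2 * h^-1) / h ^+ 2.
    by field; rewrite gt_eqF.
  apply: divr_ge0; last by rewrite exprn_ge0// ltW.
  have : (k%:R + 2) ^+ 2 * h <= (k%:R + 2) ^+ 2 by rewrite ler_piMr// sqr_ge0.
  move: hV k0; move: (k%:R : R) (h^-1) ((k%:R + 2) ^+ 2 * h) => x u v ux x1 vx.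
  have : 0 <= (x - 1) ^+ 2 by exact: sqr_ge0.
  nra.
have -> : \sum_(i < n) (k + i).+2%:R ^+ 2 * (6 * M ^+ 2 * expR (- (k.+1 + i)%:R * eta) ^+ 2) =
    6 * M ^+ 2 * q ^+ k.+1 * \sum_(i < n) (k%:R + 2 + i%:R) ^+ 2 * q ^+ i.
  rewrite mulr_sumr; apply: eq_bigr => i _.
  rewrite rX -exprM mulnC exprM -/q exprD.
  rewrite (_ : (k + i).+2%:R = k%:R + 2 + i%:R :> R); first by ring.
  by rewrite -addn2 natrD natrD; ring.
apply: le_trans (ler_wpM2l _ (le_trans sum_le bound)) _.
  apply: mulr_ge0; last by apply: exprn_ge0; exact: ltW.
  by apply: mulr_ge0 => //; exact: sqr_ge0.
rewrite le_eqVlt; apply/orP; left; apply/eqP.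
have -> : q ^+ k.+1 = (r ^+ k.+1) ^+ 2 by rewrite /q -!exprM mulnC.
rewrite eE'; move: (r ^+ k.+1) => X.
by field; rewrite gt_eqF.
Qed.

Definition trunc k c (j : nat) : R[i] := if (j <= k)%N then c j else 0.
Definition tailc k c (j : nat) : R[i] := if (j <= k)%N then 0 else c j.

Lemma l2_trunc k c : l2 c -> l2 (trunc k c) /\ l2norm (trunc k c) <= l2norm c.
Proof.
move=> hc; apply: l2_le => // j; rewrite /trunc; case: ifP => // _.
by rewrite cabs0 cabs_ge0.
Qed.

Lemma l2_tail k c : l2 c -> l2 (tailc k c) /\ l2norm (tailc k c) <= l2norm c.
Proof.
move=> hc; apply: l2_le => // j; rewrite /tailc; case: ifP => // _.
by rewrite cabs0 cabs_ge0.
Qed.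

Lemma tail_bound k c (g : nat -> R) (B : R) : 0 <= B ->
  (forall j, (k < j)%N -> cabs (c j) ^+ 2 <= g j) ->
  (forall n, \sum_(i < n) g (k.+1 + i)%N <= B ^+ 2) ->
  l2norm (tailc k c) <= B.
Proof.
move=> B0 cg gB; have [] // := @l2_bound R (tailc k c) B B0 _.
move=> n; apply: le_trans (gB n).
apply: (@le_trans _ _ (series (fun j => cabs (tailc k c j) ^+ 2) (k.+1 + n)%N)).
  by apply: series_sq_nd; rewrite leq_addl.
rewrite /series/= (@big_cat_nat _ _ _ k.+1) ?leq_addr//= big_nat_cond big1; last first.
  by move=> j /andP[/andP[_ hj] _]; rewrite /tailc -ltnS hj cabs0 expr0n.
rewrite add0r -{1}[k.+1]add0n big_addn addKn big_mkord; apply: ler_sum => i _.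
rewrite addnC /tailc leqNgt ltnS leq_addr; apply: cg.
by rewrite ltnS leq_addr.
Qed.

Lemma l2_split k c : l2 c ->
  l2norm (trunc k c) ^+ 2 + l2norm (tailc k c) ^+ 2 = l2norm c ^+ 2.
Proof.
move=> hc; have [h1 _] := l2_trunc k hc; have [h2 _] := l2_tail k hc.
rewrite !l2norm_sqr// -limD//; congr (limn _); apply/funext => n /=.
rewrite /series/= /GRing.add/= -big_split/=; apply: eq_bigr => j _.
by rewrite /trunc /tailc; case: ifP; rewrite cabs0 expr0n ?addr0 ?add0r.
Qed.

End tail.

Section eigen_tail.
Context {R : realType}.
Variables (S s eta : R).
Hypotheses (S0 : 0 < S) (s0 : 0 < s) (foci : S ^+ 2 = s ^+ 2 + 1)
  (etaE : expR eta = S + s) (Ss1 : 1 < S + s).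
Variables (a b : R[i] -> R[i]) (mu : R[i]) (AE BE delta : R).
Hypotheses (ha : forall z, ellipse S s z -> hol a z)
  (hb : forall z, ellipse S s z -> hol b z)
  (hA : forall z, ellipse S s z -> cabs (cprim a z) <= AE)
  (hB : forall z, ellipse S s z -> cabs (cprim b z) <= BE)
  (delta0 : 0 < delta) (dmu : delta <= cabs mu).

(** The constant 6 in the majorant is [(3 / pi) (2 / pi) pi^2]: the first factor
    comes from the bound of [x (-1)] by the norm of [x], the others from
    [coef_decay]. *)
Lemma eigen_tail x k : H1 x -> eqI (monodromy a b x) (fun t => mu * x t) ->
  (1 <= k)%N -> eps eta AE BE delta k < 1 ->
  l2norm (tailc k (kap x)) ^+ 2 <= eps eta AE BE delta k ^+ 2 / 2 * H1norm x ^+ 2.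
Proof.
move=> hx Ux k1 e1; have cx := H1_contI hx.
have ca := hol_contI S0 foci ha; have cb := hol_contI S0 foci hb.
have mu0 : mu != 0.
  by apply/eqP => m0; move: (lt_le_trans delta0 dmu); rewrite m0 cabs0 ltxx.
pose M := expR (AE + BE / delta).
have I1 : Iset (-1 : R) by rewrite /Iset/= in_itv/=; lra.
have e_m1 := ellipse_I S0 foci I1.
have M1 : 1 <= M.
  rewrite -expR0 ler_expR addr_ge0//; first exact: le_trans (cabs_ge0 _) (hA e_m1).
  by rewrite divr_ge0 ?(ltW delta0)// (le_trans (cabs_ge0 _) (hB e_m1)).
pose X (t : R) := cexp (cprim a t%:C + mu^-1 * cprim b t%:C).
have xE : eqI x (fun t => x (-1) * X t).
  by move=> t It; rewrite (eigenfunction_exp ca cb cx mu0 Ux It) /X !cprim_prim.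
have cX : contI X.
  apply: contI_cexp; apply: (@contI_eqI _ (fun t => prim (fun s => a s%:C) t +
    mu^-1 * prim (fun s => b s%:C) t)); first by move=> t It; rewrite !cprim_prim.
  by apply: contID; [|apply: contIZ]; exact: prim_contI.
have coefx j : coefT x j = x (-1) * coefT X j.
  by rewrite (coefT_eqI j cx xE) coefTZ.
have p0 : 0 < pi :> R by exact: pi_gt0.
have x1 := H1_sup hx I1.
have x1' : cabs (x (-1)) ^+ 2 <= 3 / pi * H1norm x ^+ 2.
  have -> : 3 / pi * H1norm x ^+ 2 = (Num.sqrt (3 / pi) * H1norm x) ^+ 2.
    have d0 : 0 <= 3 / pi :> R by rewrite divr_ge0// ltW.
    by rewrite exprMn (sqr_sqrtr d0).
  by apply: lerXn2r; rewrite ?nnegrE ?mulr_ge0 ?cabs_ge0 ?sqrtr_ge0 ?H1norm_ge0.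
pose e := eps eta AE BE delta k; rewrite -/e.
have eta0 : 0 < eta := eta_gt0 etaE Ss1.
have e0 : 0 <= e.
  rewrite /e /eps !mulr_ge0 ?expR_ge0// invr_ge0 /sinh divr_ge0// subr_ge0 ler_expR; lra.
have nx0 := H1norm_ge0 x.
pose B := Num.sqrt (e ^+ 2 / 2) * H1norm x.
have B0 : 0 <= B by rewrite mulr_ge0// sqrtr_ge0.
have BE2 : B ^+ 2 = e ^+ 2 / 2 * H1norm x ^+ 2.
  have d0 : 0 <= e ^+ 2 / 2 by rewrite divr_ge0// sqr_ge0.
  by rewrite exprMn (sqr_sqrtr d0).
rewrite -BE2; apply: lerXn2r; rewrite ?nnegrE ?l2norm_ge0//.
apply: (@tail_bound _ _ _ (fun j => H1norm x ^+ 2 *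
   (j.+1%:R ^+ 2 * (6 * M ^+ 2 * expR (- j%:R * eta) ^+ 2)))) => //.
  move=> j kj; rewrite cabs_kap coefx cabsM exprMn.
  have cd := coef_decay S0 s0 foci etaE Ss1 ha hb hA hB delta0 dmu j.
  have j0 : (0 < j)%N by apply: leq_ltn_trans kj.
  have cd2 : cabs (coefT X j) ^+ 2 <= 2 * pi * (M ^+ 2 * expR (- j%:R * eta) ^+ 2).
    apply: le_trans (lerXn2r 2 _ _ cd) _; rewrite ?nnegrE ?cabs_ge0//.
      by rewrite !mulr_ge0 ?nk_ge0 ?expR_ge0// ltW.
    rewrite le_eqVlt; apply/orP; left; apply/eqP.
    rewrite !exprMn nk_sqr -/M mulNr; case: (j) j0 => // j' _ /=.
    congr (_ * _); rewrite expr2 mulrA divfK ?gt_eqF//.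
  rewrite [leRHS]mulrCA; apply: ler_wpM2l; first exact: sqr_ge0.
  apply: le_trans (ler_pM _ _ x1' cd2) _; rewrite ?sqr_ge0//.
  rewrite le_eqVlt; apply/orP; left; apply/eqP.
  move: (M ^+ 2) (expR _ ^+ 2) (H1norm x ^+ 2) (pi : R) p0 => u v w p p0.
  by field; rewrite gt_eqF.
move=> n; rewrite -mulr_sumr BE2 mulrC ler_wpM2r ?sqr_ge0//.
apply: (eps_tail n eta0 M1 k1) e1.
by [].
Qed.

End eigen_tail.

(** * Interpolation and projection *)

Section interpolation.
Context {R : realType}.
Variable N : nat.
Hypothesis N0 : (1 <= N)%N.
Implicit Types (p q : {poly R[i]}) (w : 'cV[R[i]]_N.+1).

Lemma node_inj (i j : 'I_N.+1) : node N i = node N j :> R -> i = j.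
Proof.
have Np : 0 < N%:R :> R by rewrite ltr0n.
have p0 : 0 < pi :> R by exact: pi_gt0.
have rng (k : 'I_N.+1) : pi * k%:R / N%:R \in `[0, (pi : R)].
  rewrite in_itv/= divr_ge0 ?mulr_ge0 ?(ltW p0) ?(ltW Np)//= ler_pdivrMr//.
  by rewrite ler_pM2l// ler_nat -ltnS.
move=> /(congr1 acos); rewrite /node !cosK ?rng//.
move=> /(congr1 (fun x => x * N%:R)); rewrite !divfK ?gt_eqF//.
move=> /(mulfI (lt0r_neq0 p0)) /eqP; rewrite eqr_nat => /eqP; exact: val_inj.
Qed.

Lemma node_I j : (j <= N)%N -> Iset (node N j : R).
Proof.
by move=> _; rewrite /node /Iset/= in_itv/= cos_geN1 cos_le1.
Qed.

Lemma END p q : EN N (p + q) = EN N p + EN N q :> 'cV[R[i]]_N.+1.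
Proof. by apply/matrixP => i j; rewrite !mxE /polfun hornerD. Qed.

Lemma ENZ (a : R[i]) p : EN N (a *: p) = a *: EN N p :> 'cV[R[i]]_N.+1.
Proof. by apply/matrixP => i j; rewrite !mxE /polfun hornerZ. Qed.

Let vdm : 'M[R[i]]_N.+1 := Vandermonde N.+1 (\row_j (node N j)%:C).

Let vdm_unit : vdm \in unitmx.
Proof.
rewrite unitmxE det_Vandermonde unitfE; apply/prodf_neq0 => i _.
apply/prodf_neq0 => j ij; rewrite !mxE subr_eq0; apply/eqP => /(congr1 (fun z : R[i] => complex.Re z))/=.
by move/node_inj => ji; move: ij; rewrite ji ltnn.
Qed.

Let EN_rVpoly (c : 'rV[R[i]]_N.+1) : EN N (rVpoly c) = (c *m vdm)^T.
Proof.
apply/matrixP => i j; rewrite !mxE /polfun (@horner_coef_wide _ N.+1) ?size_poly//.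
by apply: eq_bigr => k _; rewrite coef_rVpoly_ord !mxE ord1.
Qed.

Lemma EN_inj p q : polyN N p -> polyN N q -> EN N p = EN N q -> p = q.
Proof.
move=> hp hq e; rewrite -(poly_rV_K hp) -(poly_rV_K hq); congr rVpoly.
move: e; rewrite -{1}(poly_rV_K hp) -{1}(poly_rV_K hq) !EN_rVpoly => /trmx_inj.
by move/(congr1 (fun u => u *m invmx vdm)); rewrite !(mulmxK vdm_unit).
Qed.

Lemma PN_spec w : polyN N (PN w) /\ EN N (PN w) = w.
Proof.
have ex : exists p, polyN N p /\ EN N p = w.
  exists (rVpoly (w^T *m invmx vdm)); split; last by rewrite EN_rVpoly (mulmxKV vdm_unit) trmxK.
  exact: size_poly.
by rewrite /PN; have := xgetPex 0 ex.
Qed.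

Lemma PN_EN p : polyN N p -> PN (EN N p) = p.
Proof. by move=> hp; have [h1 h2] := PN_spec (EN N p); exact: EN_inj. Qed.

Lemma polyND p q : polyN N p -> polyN N q -> polyN N (p + q).
Proof.
by move=> hp hq; apply: leq_trans (size_polyD _ _) _; rewrite geq_max hp.
Qed.

Lemma polyNZ (a : R[i]) p : polyN N p -> polyN N (a *: p).
Proof. by move=> hp; exact: leq_trans (size_scale_leq _ _) _. Qed.

Lemma PND w1 w2 : PN (w1 + w2) = PN w1 + PN w2.
Proof.
have [p1 e1] := PN_spec w1; have [p2 e2] := PN_spec w2.
by rewrite -{1}e1 -{1}e2 -END PN_EN//; exact: polyND.
Qed.

Lemma PNZ (a : R[i]) w : PN (a *: w) = a *: PN w.
Proof.
by have [p1 e1] := PN_spec w; rewrite -{1}e1 -ENZ PN_EN//; exact: polyNZ.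
Qed.

Lemma PN0 : PN (0 : 'cV[R[i]]_N.+1) = 0.
Proof. by rewrite -(scale0r 0) PNZ scale0r. Qed.

Lemma PN_sum (I : finType) (F : I -> 'cV[R[i]]_N.+1) :
  PN (\sum_i F i) = \sum_i PN (F i).
Proof. by apply: (big_morph (@PN R N) PND PN0). Qed.

Lemma kap_polyN p k : polyN N p -> (N < k)%N -> kap (polfun p) k = 0.
Proof. by move=> hp hk; rewrite /kap (coefT_poly_high hp hk) mulr0. Qed.

Lemma polfun_inj p q : polyN N p -> polyN N q -> eqI (polfun p) (polfun q) -> p = q.
Proof.
move=> hp hq e; apply: EN_inj => //; apply/matrixP => i j; rewrite !mxE.
by apply: e; apply: node_I; rewrite -ltnS.
Qed.

(** A polynomial with prescribed first Chebyshev coordinates. *)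
Definition polkap (c : nat -> R[i]) : {poly R[i]} :=
  \sum_(k < N.+1) (c k * (nk k / k.+1%:R)%:C) *: chebp k.

Lemma polkap_N c : polyN N (polkap c).
Proof.
apply: leq_trans (size_sum _ _ _) _; apply/bigmax_leqP => i _.
by apply: leq_trans (size_scale_leq _ _) _; rewrite size_chebp.
Qed.

Lemma polkapE c (t : R) : Iset t -> polfun (polkap c) t = \sum_(k < N.+1) c k * Ttilde k t.
Proof.
move=> It; rewrite /polfun /polkap horner_sum; apply: eq_bigr => k _.
by rewrite hornerZ TtildeE// mulrA.
Qed.

Lemma kap_polkap c : kap (polfun (polkap c)) =1 trunc N c.
Proof.
move=> k; rewrite (kap_eqI k (contI_polfun _) (polkapE c)) kap_comb.
by rewrite /trunc ltnS.
Qed.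

Lemma H1inner_stationary (f g : R -> R[i]) n :
  (forall k, (n <= k)%N -> conjc (coefT f k) * coefT g k = 0) ->
  H1inner f g = \sum_(k < n) k.+1%:R ^+ 2 * (conjc (coefT f k) * coefT g k).
Proof.
move=> h0; set l := RHS; rewrite /H1inner; set u := (X in lim (X @ _)).
suff h : (u : nat -> R[i]^o) @ \oo --> (l : R[i]^o).
  by rewrite (cvg_lim _ h)//; exact: norm_hausdorff.
apply: cvg_near_cst; near=> m; rewrite /u /l; rewrite /series/= (@big_cat_nat _ _ _ n)//=; last by near: m; exact: nbhs_infty_ge.
rewrite [X in _ + X]big_nat_cond [X in _ + X]big1 ?addr0 ?big_mkord// => k.
by move=> /andP[/andP[hk _] _]; rewrite h0// mulr0.
Unshelve. all: by end_near. Qed.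

Lemma kap_coefT (f g : R -> R[i]) k : kap f k = kap g k -> coefT f k = coefT g k.
Proof. by apply: mulfI; rewrite pnatr_eq0. Qed.

(** Orthogonality of [f - PiN f] to the Chebyshev polynomials, one at a time,
    gives its coordinates. *)
Lemma PiN_spec (f : R -> R[i]) : H1 f -> polyN N (PiN N f) /\
  kap (polfun (PiN N f)) =1 trunc N (kap f).
Proof.
move=> hf; have cf := H1_contI hf.
have diff0 p k : coefT f k = coefT (polfun p) k ->
    coefT (fun t => f t - polfun p t) k = 0.
  by move=> e; rewrite coefTB ?e ?subrr//; exact: contI_polfun.
have ex : exists p, polyN N p /\ forall q, polyN N q ->
    H1inner (polfun q) (fun t => f t - polfun p t) = 0.
  exists (polkap (kap f)); split; first exact: polkap_N.
  move=> q hq; rewrite (@H1inner_stationary _ _ N.+1); last first.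
    by move=> k hk; rewrite (coefT_poly_high hq hk) conjc0 mul0r.
  rewrite big1// => k _; rewrite diff0 ?mulr0//.
  by apply: kap_coefT; rewrite kap_polkap /trunc -ltnS ltn_ord.
have [hp ortho] := xgetPex 0 ex; rewrite -/(PiN N f) in hp ortho.
split=> // k; rewrite /trunc; case: (leqP k N) => hk; last by rewrite kap_polyN.
have hq : polyN N (chebp k : {poly R[i]}) by rewrite /polyN/= size_chebp.
have := ortho _ hq; rewrite (@H1inner_stationary _ _ N.+1); last first.
  by move=> j hj; rewrite (coefT_poly_high hq hj) conjc0 mul0r.
have hk' : (k < N.+1)%N by rewrite ltnS.
rewrite (bigD1 (Ordinal hk')) // big1 => [|j jk]; last first.
  rewrite coefT_cheb; case: eqP => [e|_]; first by case/andP: jk => _ /eqP[]; exact: val_inj.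
  by rewrite mul0r rmorph0 ?conjc0 ?rmorph0 mul0r mulr0.
move=> h; have {h} := etrans (esym (addr0 _)) h.
have -> : nat_of_ord (Ordinal hk') = k by [].
rewrite coefT_cheb eqxx; set z := conjc _ => /eqP.
have z0 : z != 0.
  apply/eqP => /(congr1 (fun z : R[i] => complex.Re z))/= /eqP.
  by rewrite mul1r invr_eq0 gt_eqF// nk_gt0.
rewrite mulf_eq0 expf_eq0 pnatr_eq0 andbF mulf_eq0 (negPf z0) !orFb.
rewrite (coefTB k cf (contI_polfun _)).
by rewrite subr_eq0 /kap => /eqP ->.
Qed.

Lemma polyN_kap_inj p q : polyN N p -> polyN N q ->
  kap (polfun p) =1 kap (polfun q) -> p = q.
Proof.
move=> hp hq e; apply: (polfun_inj hp hq).
exact: (kap_inj (contI_polfun p) (contI_polfun q) e).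
Qed.

Lemma PiN_polfun p : polyN N p -> PiN N (polfun p) = p.
Proof.
move=> hp; have [h1 h2] := PiN_spec (H1_polfun p).
apply: (polyN_kap_inj h1 hp).
by move=> k; rewrite h2 /trunc; case: (leqP k N) => // hk; rewrite kap_polyN.
Qed.

Lemma PiN_eq (f g : R -> R[i]) : H1 f -> H1 g -> (forall k, (k <= N)%N -> kap f k = kap g k) ->
  PiN N f = PiN N g.
Proof.
move=> hf hg e; move: (PiN_spec hf) (PiN_spec hg).
move: (PiN N f) (PiN N g) => p q [f1 f2] [g1 g2].
apply: (polyN_kap_inj f1 g1).
by move=> k; rewrite f2 g2 /trunc; case: ifP => // hk; exact: e.
Qed.

Lemma PiND (f g : R -> R[i]) : H1 f -> H1 g ->
  PiN N (fun t => f t + g t) = PiN N f + PiN N g.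
Proof.
move=> hf hg; move: (PiN_spec hf) (PiN_spec hg) (PiN_spec (proj1 (H1D hf hg))).
move: (PiN N f) (PiN N g) (PiN N (fun t => f t + g t)) => p q r [p1 p2] [q1 q2] [r1 r2].
apply: (polyN_kap_inj r1 (polyND p1 q1)) => k; rewrite r2.
have -> : polfun (p + q) = fun t => polfun p t + polfun q t.
  by apply/funext => t; rewrite /polfun hornerD.
rewrite (kapD k (contI_polfun p) (contI_polfun q)) p2 q2.
rewrite /trunc (kapD k (H1_contI hf) (H1_contI hg)).
by case: (k <= N)%N; rewrite ?addr0.
Qed.

Lemma PiNZ (a : R[i]) (f : R -> R[i]) : H1 f ->
  PiN N (fun t => a * f t) = a *: PiN N f.
Proof.
move=> hf; move: (PiN_spec hf) (PiN_spec (proj1 (H1Z a hf))).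
move: (PiN N f) (PiN N (fun t => a * f t)) => p r [p1 p2] [r1 r2].
apply: (polyN_kap_inj r1 (polyNZ a p1)) => k; rewrite r2.
have -> : polfun (a *: p) = fun t => a * polfun p t.
  by apply/funext => t; rewrite /polfun hornerZ.
rewrite (kapZ a k (contI_polfun p)) p2 /trunc (kapZ a k (H1_contI hf)).
by case: (k <= N)%N; rewrite ?mulr0.
Qed.

End interpolation.

(** * The operators built from the eigenvectors *)

Section ell2_more.
Context {R : realType}.
Implicit Types (c d : nat -> R[i]).

Lemma l2norm_delta k : l2 (fun j => (k == j)%:R : R[i]) /\
  l2norm (fun j => (k == j)%:R : R[i]) = 1.
Proof.
have h j : (k.+1 <= j)%N -> (k == j)%:R = 0 :> R[i].
  by move=> hj; rewrite ltn_eqF.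
have [h1 h2] := l2_finite h; split=> //.
apply/eqP; rewrite -(@eqrXn2 _ 2)// ?l2norm_ge0// h2 expr1n.
rewrite big_ord_recr/= eqxx cabs1 expr1n big1 ?add0r// => i _.
by rewrite gtn_eqF// cabs0 expr0n.
Qed.

Lemma l2_comb n (d : nat -> nat -> R[i]) c : (forall k, l2 (d k)) ->
  l2 (fun j => \sum_(k < n) c k * d k j) /\
  l2norm (fun j => \sum_(k < n) c k * d k j) <= \sum_(k < n) cabs (c k) * l2norm (d k).
Proof.
move=> hd; elim: n => [|n [IH1 IH2]].
  have h (k : nat) : (0 <= k)%N -> (fun j : nat => \sum_(k < 0) c k * d k j) k = 0.
    by rewrite big_ord0.
  have [h1 h2] := l2_finite h; split=> //; rewrite big_ord0.
  by move: h2; rewrite big_ord0 => /eqP; rewrite sqrf_eq0 => /eqP ->.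
have [h1 h2] := l2Z (c n) (hd n); have [h3 h4] := l2D IH1 h1.
have e : (fun j => \sum_(k < n.+1) c k * d k j) =
    fun j => \sum_(k < n) c k * d k j + c n * d n j.
  by apply/funext => j; rewrite big_ord_recr.
rewrite e; split=> //; apply: le_trans h4 _.
by rewrite big_ord_recr/= h2 lerD2r.
Qed.

Lemma l2_add_parts N c : l2 c -> l2norm c <= l2norm (trunc N c) + l2norm (tailc N c).
Proof.
move=> hc; have [h1 _] := l2_trunc N hc; have [h2 _] := l2_tail N hc.
have [_] := l2D h1 h2; apply: le_trans.
rewrite (_ : (fun k => _) = c)//; apply/funext => k.
by rewrite /trunc /tailc; case: ifP; rewrite ?addr0 ?add0r.
Qed.

Lemma l2norm_trunc_le N c : l2norm (trunc N c) <= \sum_(k < N.+1) cabs (c k).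
Proof.
have [_ h] := @l2_comb N.+1 (fun k j => (k == j)%:R) c (fun k => proj1 (l2norm_delta k)).
rewrite (_ : trunc N c = fun j => \sum_(k < N.+1) c k * (k == j :> nat)%:R); last first.
  apply/funext => j; rewrite /trunc; case: (leqP j N) => hj.
    have hj' : (j < N.+1)%N by rewrite ltnS.
    rewrite (bigD1 (Ordinal hj'))//= eqxx mulr1 big1 ?addr0// => i ij.
    by case: eqP => [e|]; [case/eqP: ij; exact: val_inj|rewrite mulr0].
  rewrite big1// => i _; case: eqP => [e|]; last by rewrite mulr0.
  by move: (ltn_ord i); rewrite e ltnS leqNgt hj.
apply: le_trans h _; apply: ler_sum => k _.
by rewrite (proj2 (l2norm_delta k)) mulr1.
Qed.

Lemma tail_to0 c : l2 c -> l2norm (tailc n c) @[n --> \oo] --> (0 : R).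
Proof.
move=> hc; apply/cvgrPdist_lt => e e0.
have e20 : 0 < e ^+ 2 by rewrite exprn_gt0.
have [n0 hn] := tail_cvg0 hc e20.
near=> n; rewrite sub0r normrN ger0_norm ?l2norm_ge0//.
rewrite -(@ltr_pXn2r _ 2) ?nnegrE ?l2norm_ge0 ?(ltW e0)//.
have -> : l2norm (tailc n c) ^+ 2 = l2norm c ^+ 2 - l2norm (trunc n c) ^+ 2.
  by rewrite -(l2_split n hc) addrC addKr.
have h0 k : (n.+1 <= k)%N -> trunc n c k = 0.
  by rewrite /trunc ltnNge => /negPf ->.
have [_ ->] := l2_finite h0.
have -> : \sum_(k < n.+1) cabs (trunc n c k) ^+ 2 = series (fun k => cabs (c k) ^+ 2) n.+1.
  rewrite /series/= big_mkord; apply: eq_bigr => k _.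
  by rewrite /trunc -ltnS ltn_ord.
rewrite l2norm_sqr//; apply: le_lt_trans (ler_norm _) (hn _ _).
by apply: leq_trans (leqnSn n); near: n; exact: nbhs_infty_ge.
Unshelve. all: by end_near. Qed.

End ell2_more.

Section H1_limits.
Context {R : realType}.
Implicit Types (f g : R -> R[i]).

(** Limits in H1 are unique up to the values outside [-1, 1]. *)
Lemma H1lim_spec (u : nat -> R -> R[i]) g : (forall n, H1 (u n)) -> H1 g ->
  H1norm (fun t => u n t - g t) @[n --> \oo] --> (0 : R) ->
  H1 (H1lim u) /\ eqI (H1lim u) g.
Proof.
move=> hu hg lim.
have ex : exists g, H1 g /\ H1norm (fun t => u n t - g t) @[n --> \oo] --> (0 : R).
  by exists g.
have [hl lim'] := xgetPex (fun=> 0) ex; rewrite -/(H1lim u) in hl lim'.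
split=> //; move: (H1lim u) hl lim' => l hl lim' {ex}; have [hd _] := H1B hl hg.
suff h0 : H1norm (fun t => l t - g t) = 0.
  by move=> t It; have := H1norm_eq0 hd h0 It; move/eqP; rewrite subr_eq0 => /eqP.
apply/eqP; rewrite eq_le H1norm_ge0 andbT; apply: ler_addeps => e e0.
have e20 : 0 < e / 2 by rewrite divr_gt0.
have [n _ /(_ n (leqnn n))[/= h1 h2]] := filterI
  ((cvgrPdist_lt _ _).1 lim _ e20) ((cvgrPdist_lt _ _).1 lim' _ e20).
rewrite sub0r normrN (ger0_norm (H1norm_ge0 _)) in h1.
rewrite sub0r normrN (ger0_norm (H1norm_ge0 _)) in h2.
have [q1 _] := H1B (hu n) hg; have [q2 _] := H1B (hu n) hl.
have [_ q3] := H1B q1 q2.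
rewrite (_ : (fun t => l t - g t) =
  fun t => (u n t - g t) - (u n t - l t)).
  by rewrite add0r [e]splitr; exact: (le_trans q3 (lerD (ltW h1) (ltW h2))).
by apply/funext => t; ring.
Qed.

End H1_limits.

Section eigenvector_operators.
Context {R : realType}.
Variable N : nat.
Hypothesis N0 : (1 <= N)%N.
Variable V : 'M[R[i]]_N.+1.
Hypothesis hV : V \in unitmx.
Implicit Types (c d : nat -> R[i]) (f g : R -> R[i]).

Let p (k : 'I_N.+1) : {poly R[i]} := PN (col k V).

Definition cvec c : 'cV[R[i]]_N.+1 := \col_k c k.

Lemma mul_cvec c : V *m cvec c = \sum_(k < N.+1) c k *: col k V.
Proof.
apply/matrixP => i j; rewrite !mxE summxE; apply: eq_bigr => k _.
by rewrite !mxE mulrC.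
Qed.

Definition pcomb c : {poly R[i]} := PN (V *m cvec c).

Lemma pcombE c t : polfun (pcomb c) t = \sum_(k < N.+1) c k * polfun (PN (col k V)) t.
Proof.
rewrite /pcomb mul_cvec (PN_sum N0) /polfun horner_sum; apply: eq_bigr => k _.
by rewrite (PNZ N0) hornerZ.
Qed.

Lemma pcomb_N c : polyN N (pcomb c).
Proof. by have [] := PN_spec N0 (V *m cvec c). Qed.

(** Coordinates of [Vhat V c] in the basis of the [Ttilde k]. *)
Definition Vkap c (m : nat) : R[i] :=
  if (m <= N)%N then kap (polfun (pcomb c)) m else c m.

Lemma kap_pcomb c m : kap (polfun (pcomb c)) m =
  \sum_(k < N.+1) c k * kap (polfun (p k)) m.
Proof.
have -> : polfun (pcomb c) = fun t => \sum_(k < N.+1) c k * polfun (p k) t.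
  by apply/funext => t; exact: pcombE.
rewrite (@kap_sum _ _ _ _ (fun (k : 'I_N.+1) t => c k * polfun (p k) t)); last first.
  by move=> k; apply: contIZ; exact: contI_polfun.
by apply: eq_bigr => k _; rewrite (kapZ _ _ (contI_polfun (p k))).
Qed.

Lemma VkapE c : Vkap c = fun m => kap (polfun (pcomb c)) m + tailc N c m.
Proof.
apply/funext => m; rewrite /Vkap /tailc; case: ifP => hm; first by rewrite addr0.
by rewrite (kap_polyN (pcomb_N c)) ?add0r// ltnNge hm.
Qed.

Lemma l2_Vkap c : l2 c -> l2 (Vkap c).
Proof.
move=> hc; rewrite VkapE.
exact: (proj1 (l2D (H1_l2 (H1_polfun (pcomb c))) (proj1 (l2_tail N hc)))).
Qed.

(** The [n]-th partial sum has the coordinates of the limit up to the tail of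
    [c], which tends to 0 in l2. *)
Lemma Vhat_spec c : l2 c -> H1 (Vhat V c) /\ kap (Vhat V c) =1 Vkap c.
Proof.
move=> hc; have [F [hF kF _]] := H1_synth (l2_Vkap hc).
pose u n t := \sum_(k < N.+1) c k * polfun (PN (col k V)) t
                    + \sum_(N.+1 <= k < n) c k * Ttilde k t.
have cT n : contI (fun t : R => \sum_(N.+1 <= k < n) c k * Ttilde k t).
  by apply: contI_sum => k; apply: contIZ; exact: contI_Ttilde.
have ku n k : kap (u n) k = kap (polfun (pcomb c)) k +
   (if (k < n)%N then tailc N c k else 0).
  have -> : u n = fun t => polfun (pcomb c) t + \sum_(N.+1 <= k < n) c k * Ttilde k t.
    by apply/funext => t; rewrite /u -pcombE.
  rewrite (kapD k (contI_polfun _) (cT n)); congr (_ + _).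
  rewrite (@kap_sum _ _ _ _ (fun k t => c k * Ttilde k t)); last first.
    by move=> j; apply: contIZ; exact: contI_Ttilde.
  under eq_bigr do rewrite (kapZ _ _ (contI_Ttilde _)) kap_Ttilde.
  rewrite /tailc; case: (leqP k N) => hk.
    rewrite big_nat big1; first by case: ifP.
    by move=> j /andP[hj _]; rewrite gtn_eqF ?mulr0//; exact: leq_trans hj.
  case: ifP => kn.
    rewrite (bigD1_seq k) ?mem_index_iota ?hk ?kn ?iota_uniq//= eqxx mulr1.
    by rewrite big1 ?addr0// => j /negPf ->; rewrite mulr0.
  rewrite big_nat big1// => j /andP[_ hj]; rewrite ltn_eqF ?mulr0//.
  by rewrite (leq_trans hj)// leqNgt kn.
have lu n : l2 (kap (u n)).
  have h k : (maxn N.+1 n <= k)%N -> kap (u n) k = 0.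
    rewrite geq_max => /andP[h1 h2].
    by rewrite ku (kap_polyN (pcomb_N c) h1) ltnNge h2 addr0.
  exact: (proj1 (l2_finite h)).
have hu n : H1 (u n).
  apply/H1P; split=> //; apply: contID; last exact: cT.
  by apply: contI_sum => k; apply: contIZ; exact: contI_polfun.
have lim : H1norm (fun t => u n t - F t) @[n --> \oo] --> (0 : R).
  apply/cvgrPdist_lt => e e0.
  have /cvgrPdist_lt/(_ e e0) h := tail_to0 hc.
  have [m _ hm] := filterI h (nbhs_infty_ge N).
  exists m.+1 => // -[//|n] /hm /= [h1 h2].
  rewrite sub0r normrN ger0_norm ?H1norm_ge0//.
  rewrite sub0r normrN ger0_norm ?l2norm_ge0// in h1.
  apply: le_lt_trans h1.
  rewrite (H1normE (proj1 (H1B (hu n.+1) hF))).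
  apply: (proj2 (l2_le _ (proj1 (l2_tail n hc)))) => k.
  rewrite (kapB k (H1_contI (hu n.+1)) (H1_contI hF)) ku kF VkapE ltnS.
  rewrite /(tailc n) ; case: (leqP k n) => kn; first by rewrite subrr cabs0.
  by rewrite addr0 opprD addrA subrr sub0r cabsN /tailc leqNgt (leq_ltn_trans h2 kn).
have [h1 h2] := H1lim_spec hu hF lim.
by split=> // k; rewrite (kap_eqI k (H1_contI h1) h2) kF.
Qed.

(** A finite linear combination of the [p k], plus a part of the identity. *)
Lemma Vhat_bounded : exists2 K : R, 0 <= K &
  forall c, l2 c -> H1norm (Vhat V c) <= K * l2norm c.
Proof.
exists (\sum_(k < N.+1) l2norm (kap (polfun (p k))) + 1).
  by rewrite addr_ge0// sumr_ge0// => k _; exact: l2norm_ge0.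
move=> c hc; have [h1 h2] := Vhat_spec hc.
rewrite (H1normE h1).
have -> : kap (Vhat V c) = Vkap c by apply/funext.
rewrite VkapE mulrDl mul1r.
have [l1 l2'] := l2_tail N hc.
apply: le_trans (proj2 (l2D (H1_l2 (H1_polfun (pcomb c))) l1)) _.
apply: lerD => //.
pose d (k : nat) := if insub k is Some i then kap (polfun (p i)) else fun=> 0.
have dE (k : 'I_N.+1) : d k = kap (polfun (p k)) by rewrite /d valK.
have ld k : l2 (d k).
  rewrite /d; case: insubP => [i _ _|_]; first exact: H1_l2 (H1_polfun _).
  by have [] := l2_finite (fun (k : nat) (_ : (0 <= k)%N) => erefl (0 : R[i])).
have [_ h3] := l2_comb N.+1 c ld.
have -> : kap (polfun (pcomb c)) = fun j => \sum_(k < N.+1) c k * d k j.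
  by apply/funext => j; rewrite kap_pcomb; apply: eq_bigr => k _; rewrite dE.
apply: le_trans h3 _; rewrite mulr_suml; apply: ler_sum => k _.
by rewrite dE mulrC ler_wpM2l ?l2norm_ge0// l2_coord.
Qed.

(** The preimage of [f]: coordinates of [PiN f] in the basis of the [p k],
    then the coordinates of the remaining part. *)
Definition Vinv f (k : nat) : R[i] :=
  if (k <= N)%N then (invmx V *m EN N (PiN N f)) (inord k) 0 else kap f k.

Lemma cvec_Vinv f : cvec (Vinv f) = invmx V *m EN N (PiN N f).
Proof.
apply/matrixP => i j; rewrite mxE /Vinv -ltnS ltn_ord inord_val.
by rewrite (ord1 j).
Qed.

Lemma l2_Vinv f : H1 f -> l2 (Vinv f).
Proof.
move=> hf; have h : l2 (fun k => trunc N (Vinv f) k + tailc N (kap f) k).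
  apply: (proj1 (l2D _ (proj1 (l2_tail N (H1_l2 hf))))).
  have h k : (N.+1 <= k)%N -> trunc N (Vinv f) k = 0.
    by rewrite /trunc ltnNge => /negPf ->.
  exact: (proj1 (l2_finite h)).
apply: l2_eq h => k; rewrite /trunc /tailc /Vinv.
by case: (k <= N)%N; rewrite ?addr0 ?add0r.
Qed.

Lemma pcomb_Vinv f : H1 f -> pcomb (Vinv f) = PiN N f.
Proof.
move=> hf; rewrite /pcomb cvec_Vinv mulKVmx//.
by rewrite (PN_EN N0)//; have [] := PiN_spec N hf.
Qed.

Lemma VhatK f : H1 f -> eqI (Vhat V (Vinv f)) f.
Proof.
move=> hf; have [h1 h2] := Vhat_spec (l2_Vinv hf).
apply: (kap_inj (H1_contI h1) (H1_contI hf)) => k.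
rewrite h2 /Vkap pcomb_Vinv//.
have [_ ->] := PiN_spec N hf; rewrite /trunc /Vinv.
by case: (k <= N)%N.
Qed.

(** The coordinates beyond [N] are read off directly; the first ones are
    recovered from the values of a polynomial at the nodes, because [V] is
    invertible. *)
Lemma Vhat_inj c d : l2 c -> l2 d -> eqI (Vhat V c) (Vhat V d) -> c = d.
Proof.
move=> hc hd e; have [c1 c2] := Vhat_spec hc; have [d1 d2] := Vhat_spec hd.
have ke k : Vkap c k = Vkap d k by exact: (etrans (esym (c2 k)) (etrans (kap_eqI k (H1_contI c1) e) (d2 k))).
have pe : pcomb c = pcomb d.
  apply: (polyN_kap_inj N0 (pcomb_N c) (pcomb_N d)) => k.
  have := ke k; rewrite /Vkap; case: (leqP k N) => [hk|hk _]; first exact.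
  exact: (etrans (kap_polyN (pcomb_N c) hk) (esym (kap_polyN (pcomb_N d) hk))).
have ve : cvec c = cvec d.
  have [_ e1] := PN_spec N0 (V *m cvec c); have [_ e2] := PN_spec N0 (V *m cvec d).
  apply: (can_inj (mulKmx hV)); rewrite -e1 -e2.
  by move: pe; rewrite /pcomb => ->.
apply/funext => k; case: (leqP k N) => hk.
  have hk' : (k < N.+1)%N by rewrite ltnS.
  by have := congr1 (fun u : 'cV[R[i]]_N.+1 => u (Ordinal hk') 0) ve; rewrite !mxE.
by have := ke k; rewrite /Vkap leqNgt hk.
Qed.

Lemma Vhat_invE f : H1 f -> Vhat_inv V f = Vinv f.
Proof.
move=> hf; have ex : exists c, l2 c /\ eqI (Vhat V c) f.
  by exists (Vinv f); split; [exact: l2_Vinv|exact: VhatK].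
have [h1 h2] := xgetPex (fun=> 0) ex.
apply: (Vhat_inj h1 (l2_Vinv hf)) => t It.
exact: (etrans (h2 t It) (esym (VhatK hf It))).
Qed.

Lemma Vhat_inv_Vhat c : l2 c -> Vhat_inv V (Vhat V c) = c.
Proof.
move=> hc; have [h1 _] := Vhat_spec hc.
rewrite (Vhat_invE h1); apply: (Vhat_inj (l2_Vinv h1) hc).
exact: VhatK.
Qed.

Lemma Vhat_inv_bounded : exists2 K : R, 0 <= K &
  forall f, H1 f -> l2norm (Vhat_inv V f) <= K * H1norm f.
Proof.
pose C := \sum_(k < N.+1) \sum_(j < N.+1) cabs (invmx V k j) * Num.sqrt (3 / pi).
exists (C + 1).
  rewrite addr_ge0// sumr_ge0// => k _; rewrite sumr_ge0// => j _.
  by rewrite mulr_ge0 ?cabs_ge0 ?sqrtr_ge0.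
move=> f hf; rewrite (Vhat_invE hf) mulrDl mul1r.
apply: le_trans (l2_add_parts N (l2_Vinv hf)) _.
have [hp hk] := PiN_spec N hf.
apply: lerD.
  apply: le_trans (l2norm_trunc_le _ _) _; rewrite mulr_suml; apply: ler_sum => k _.
  rewrite /Vinv -ltnS ltn_ord inord_val mxE mulr_suml.
  apply: le_trans (cabs_sum _ _ _) _; apply: ler_sum => j _.
  rewrite cabsM -mulrA ler_wpM2l ?cabs_ge0// mxE.
  have Ij : Iset (node N j : R) by apply: node_I; rewrite -ltnS.
  apply: le_trans (H1_sup (H1_polfun _) Ij) _.
  apply: ler_wpM2l; first exact: sqrtr_ge0.
  rewrite (H1normE (H1_polfun (PiN N f))) (H1normE hf).
  have -> : kap (polfun (PiN N f)) = trunc N (kap f) by apply/funext.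
  exact: (proj2 (l2_trunc N (H1_l2 hf))).
rewrite H1normE//.
have -> : tailc N (Vinv f) = tailc N (kap f).
  by apply/funext => k; rewrite /tailc /Vinv; case: (k <= N)%N.
exact: (proj2 (l2_tail N (H1_l2 hf))).
Qed.

End eigenvector_operators.

(** * Operator norms *)

(* From here on these functions are used through their lemmas only; unfolding
   them would make unification slow. *)
#[local] Opaque H1norm kap Vhat Vhat_inv PN PiN l2norm monodromy.

Section operator_norms.
Context {R : realType}.
Implicit Types (f g : R -> R[i]) (T : (R -> R[i]) -> R -> R[i]).

(** The supremum in [opnorm] is only meaningful for bounded operators; for these
    homogeneity turns it into the usual estimate. *)
Lemma opnorm_bound (TX TY : Type) (D : set TX) (nX : TX -> R) (nY : TY -> R)
    (T : TX -> TY) (K : R) : 0 <= K ->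
  (forall x, D x -> 0 <= nX x) ->
  (forall x, D x -> nY (T x) <= K * nX x) ->
  (forall x r, D x -> 0 < r -> exists y,
     [/\ D y, nX y = r * nX x & nY (T y) = r * nY (T x)]) ->
  forall x, D x -> nY (T x) <= opnorm D nX nY T * nX x.
Proof.
move=> K0 nX0 bd hom x Dx; have [x0|x0] := eqVneq (nX x) 0.
  by have := bd x Dx; rewrite x0 !mulr0.
have xp : 0 < nX x by rewrite lt_neqAle eq_sym x0 nX0.
have rp : 0 < (nX x)^-1 by rewrite invr_gt0.
have [y [Dy y1 yE]] := hom x _ Dx rp.
rewrite -ler_pdivrMr// mulrC -yE; apply: ub_le_sup; last by exists y; rewrite //= y1 mulVf.
exists K => _ [z [/= Dz z1] <-]; apply: le_trans (bd z Dz) _.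
by rewrite ler_piMr.
Qed.

(** Linearity up to the values outside [-1, 1]. *)
Definition lin_op T := [/\ forall f, H1 f -> H1 (T f),
  forall f g, H1 f -> eqI f g -> eqI (T f) (T g),
  forall f g, H1 f -> H1 g -> eqI (T (fun t => f t + g t)) (fun t => T f t + T g t) &
  forall (a : R[i]) f, H1 f -> eqI (T (fun t => a * f t)) (fun t => a * T f t)].

Lemma lin_opB T T' : lin_op T -> lin_op T' -> lin_op (fun f t => T f t - T' f t).
Proof.
move=> [h1 h2 h3 h4] [k1 k2 k3 k4]; split.
- by move=> f hf; exact: (proj1 (H1B (h1 f hf) (k1 f hf))).
- by move=> f g hf e t It; rewrite (h2 f g hf e t It) (k2 f g hf e t It).
- by move=> f g hf hg t It; rewrite (h3 f g hf hg t It) (k3 f g hf hg t It); ring.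
- by move=> a f hf t It; rewrite (h4 a f hf t It) (k4 a f hf t It); ring.
Qed.

Lemma H1norm_subC f g : H1 f -> H1 g ->
  H1norm (fun t => f t - g t) = H1norm (fun t => g t - f t).
Proof.
move=> hf hg; have [h1 _] := H1B hf hg; have [_ h2] := H1Z (-1) h1.
rewrite cabsN cabs1 mul1r in h2; rewrite -h2; congr H1norm.
by apply/funext => t; ring.
Qed.

Lemma H1_comb (F : nat -> R -> R[i]) (c : nat -> R[i]) n : (forall k, H1 (F k)) ->
  H1 (fun t => \sum_(k < n) c k * F k t) /\
  H1norm (fun t => \sum_(k < n) c k * F k t) <= \sum_(k < n) cabs (c k) * H1norm (F k).
Proof.
move=> hF; elim: n => [|n [IH1 IH2]].
  have e : (fun t => \sum_(k < 0) c k * F k t) = (fun t => 0 * F 0%N t).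
    by apply/funext => t; rewrite big_ord0 mul0r.
  have [z1 z2] := H1Z 0 (hF 0%N).
  by rewrite e big_ord0; split=> //; rewrite z2 cabs0 mul0r.
have e : (fun t => \sum_(k < n.+1) c k * F k t) =
    fun t => \sum_(k < n) c k * F k t + c n * F n t.
  by apply/funext => t; rewrite big_ord_recr.
have [z1 z2] := H1Z (c n) (hF n); have [d1 d2] := H1D IH1 z1.
rewrite e; split; first exact: d1.
by apply: le_trans d2 _; rewrite z2 [leRHS]big_ord_recr /= lerD2r.
Qed.

Lemma lin_op_comb T (F : nat -> R -> R[i]) (c : nat -> R[i]) n :
  lin_op T -> (forall k, H1 (F k)) ->
  eqI (T (fun t => \sum_(k < n) c k * F k t)) (fun t => \sum_(k < n) c k * T (F k) t).
Proof.
move=> [h1 h2 h3 h4] hF; elim: n => [|n IH] t It.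
  have e : (fun t => \sum_(k < 0) c k * F k t) = (fun t => 0 * F 0%N t).
    by apply/funext => s; rewrite big_ord0 mul0r.
  by rewrite e (h4 0 _ (hF 0%N) t It) mul0r big_ord0.
have e : (fun t => \sum_(k < n.+1) c k * F k t) =
    fun t => \sum_(k < n) c k * F k t + c n * F n t.
  by apply/funext => s; rewrite big_ord_recr.
have [c1 _] := H1_comb c n hF; have [z1 _] := H1Z (c n) (hF n).
by rewrite e (h3 _ _ c1 z1 t It) (IH t It) (h4 _ _ (hF n) t It) big_ord_recr.
Qed.

(** Cauchy-Schwarz for an operator known on finitely many functions. *)
Lemma lin_op_CS T (F : nat -> R -> R[i]) (c : nat -> R[i]) (nu : nat -> R) n :
  lin_op T -> (forall k, H1 (F k)) -> (forall k, (k < n)%N -> H1norm (T (F k)) <= nu k) ->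
  H1norm (T (fun t => \sum_(k < n) c k * F k t)) <=
  Num.sqrt (\sum_(k < n) cabs (c k) ^+ 2) * Num.sqrt (\sum_(k < n) nu k ^+ 2).
Proof.
move=> lT hF hnu; have [h1 _ _ _] := lT.
have [c1 _] := H1_comb c n hF.
rewrite (H1norm_eqI (h1 _ c1) (lin_op_comb c n lT hF)).
have [_ c2] := H1_comb c n (fun k => h1 _ (hF k)).
apply: le_trans c2 _.
apply: (@le_trans _ _ (\sum_(k < n) cabs (c k) * nu k)).
  by apply: ler_sum => k _; apply: ler_wpM2l; [exact: cabs_ge0|exact: hnu].
rewrite -sqrtrM; last by apply: sumr_ge0 => k _; exact: sqr_ge0.
apply: le_trans (ler_norm _) _; rewrite -sqrtr_sqr; apply: ler_wsqrtr.
exact: (CS_sum (fun k => cabs (c k)) nu n).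
Qed.

Lemma lin_opnorm T (K : R) : lin_op T -> 0 <= K ->
  (forall f, H1 f -> H1norm (T f) <= K * H1norm f) ->
  forall f, H1 f -> H1norm (T f) <= H1opnorm T * H1norm f.
Proof.
move=> [h1 h2 h3 h4] K0 bd f hf.
apply: (opnorm_bound K0) => //; first by move=> g _; exact: H1norm_ge0.
move=> g r hg r0; exists (fun t => r%:C * g t).
have ac : cabs r%:C = r by rewrite cabs_real ger0_norm// ltW.
have [z1 z2] := H1Z r%:C hg; have [_ z3] := H1Z r%:C (h1 _ hg).
have z4 := H1norm_eqI (h1 _ z1) (h4 r%:C g hg).
by rewrite ac in z2 z3; split; [exact: z1|exact: z2|exact: (etrans z4 z3)].
Qed.

End operator_norms.

Section spectral.
Context {R : realType}.
Variable N : nat.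
Hypothesis N0 : (1 <= N)%N.
Variables (V : 'M[R[i]]_N.+1) (lam : 'rV[R[i]]_N.+1) (a b : R[i] -> R[i]).
Hypothesis hV : V \in unitmx.
Hypothesis hdiag : UN N a b = V *m diag_mx lam *m invmx V.
Hypothesis hlam : forall j : 'I_N.+1, cabs (lam 0 j) <= cabs (lam 0 ord0).
Implicit Types (c d : nat -> R[i]) (f g : R -> R[i]) (p : {poly R[i]}).

Let lm (k : nat) : R[i] := if (k <= N)%N then lam 0 (inord k) else 0.

Let alpha := opnorm l2 l2norm H1norm (Vhat V).
Let beta := opnorm H1 H1norm l2norm (Vhat_inv V).

Lemma pcombZ (z : R[i]) c t :
  polfun (pcomb V (fun k => z * c k)) t = z * polfun (pcomb V c) t.
Proof.
rewrite !(pcombE N0) mulr_sumr; apply: eq_bigr => k _; by rewrite mulrA.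
Qed.

Lemma VhatZ (z : R[i]) c : l2 c ->
  eqI (Vhat V (fun k => z * c k)) (fun t => z * Vhat V c t).
Proof.
move=> hc; have [l1 _] := l2Z z hc.
have [h1 k1] := Vhat_spec N0 V hc; have [h2 k2] := Vhat_spec N0 V l1.
apply: (kap_inj (H1_contI h2) (contIZ z (H1_contI h1))) => k.
rewrite k2 (kapZ z k (H1_contI h1)) k1 /Vkap; case: (k <= N)%N => //.
rewrite (_ : polfun (pcomb V (fun k => z * c k)) = fun t => z * polfun (pcomb V c) t).
  exact: (kapZ z k (contI_polfun _)).
by apply/funext => t; exact: pcombZ.
Qed.

Lemma Vhat_inv_eqI f g : H1 f -> eqI f g -> Vhat_inv V f = Vhat_inv V g.
Proof.
move=> hf e; have hg := H1_eqI hf e; rewrite (Vhat_invE N0 hV hf) (Vhat_invE N0 hV hg).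
have E : eqI (Vhat V (Vinv V f)) (Vhat V (Vinv V g)).
  move=> t It; exact: (etrans (VhatK N0 hV hf It) (etrans (e t It) (esym (VhatK N0 hV hg It)))).
exact: (Vhat_inj N0 hV (l2_Vinv (V := V) hf) (l2_Vinv (V := V) hg) E).
Qed.

Lemma Vhat_norm c : l2 c -> H1norm (Vhat V c) <= alpha * l2norm c.
Proof.
have [K K0 hK] := Vhat_bounded N0 V.
apply: (opnorm_bound K0 _ hK); first by move=> d _; exact: l2norm_ge0.
move=> d r hd r0; exists (fun k => r%:C * d k).
have ac : cabs r%:C = r by rewrite cabs_real ger0_norm// ltW.
have [z1 z2] := l2Z r%:C hd.
have [h1 _] := Vhat_spec N0 V hd; have [h2 _] := Vhat_spec N0 V z1.
have [_ z3] := H1Z r%:C h1; have z4 := H1norm_eqI h2 (VhatZ r%:C hd).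
by rewrite ac in z2 z3; split; [exact: z1|exact: z2|exact: (etrans z4 z3)].
Qed.

Lemma Vhat_inv_norm f : H1 f -> l2norm (Vhat_inv V f) <= beta * H1norm f.
Proof.
have [K K0 hK] := Vhat_inv_bounded N0 hV.
apply: (opnorm_bound K0 _ hK); first by move=> d _; exact: H1norm_ge0.
move=> g r hg r0; exists (fun t => r%:C * g t).
have ac : cabs r%:C = r by rewrite cabs_real ger0_norm// ltW.
have [z1 z2] := H1Z r%:C hg.
have lg : l2 (Vhat_inv V g) by rewrite (Vhat_invE N0 hV hg); exact: l2_Vinv.
have [l1 l2'] := l2Z r%:C lg.
have E : eqI (fun t => r%:C * g t) (Vhat V (fun k => r%:C * Vhat_inv V g k)).
  move=> t It; rewrite (VhatZ r%:C lg It) (Vhat_invE N0 hV hg).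
  by rewrite (VhatK N0 hV hg It).
have z3 : Vhat_inv V (fun t => r%:C * g t) = fun k => r%:C * Vhat_inv V g k.
  by rewrite (Vhat_inv_eqI z1 E) (Vhat_inv_Vhat N0 hV l1).
by rewrite ac in z2 l2'; split; [exact: z1|exact: z2|rewrite z3; exact: l2'].
Qed.

Lemma alpha_ge0 : 0 <= alpha.
Proof.
have [h1 h2] := l2norm_delta (R := R) 0.
by have := Vhat_norm h1; rewrite h2 mulr1; apply: le_trans; exact: H1norm_ge0.
Qed.

Lemma cond_ge1 : 1 <= condVhat V.
Proof.
have [h1 h2] := l2norm_delta (R := R) 0.
have := Vhat_inv_norm (proj1 (Vhat_spec N0 V h1)).
rewrite (Vhat_inv_Vhat N0 hV h1) h2 /condVhat -/alpha -/beta => h.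
have b0 : 0 <= beta.
  rewrite leNgt; apply/negP => b0; suff : 1 <= (0 : R) by rewrite ler10.
  by apply: le_trans h _; rewrite mulr_le0_ge0 ?H1norm_ge0// ltW.
apply: le_trans h _; rewrite mulrC; apply: ler_wpM2r => //.
by have := Vhat_norm h1; rewrite h2 mulr1.
Qed.

Lemma Vhat_finite c : (forall k, (N < k)%N -> c k = 0) ->
  l2 c /\ eqI (Vhat V c) (polfun (pcomb V c)).
Proof.
move=> c0; have [lc _] := l2_finite (N := N.+1) c0; split=> //.
have [h1 h2] := Vhat_spec N0 V lc.
apply: (kap_inj (H1_contI h1) (contI_polfun _)) => k; rewrite h2 /Vkap.
by case: (leqP k N) => // hk; rewrite c0// (kap_polyN (pcomb_N N0 V c) hk).
Qed.

Let ld d (k : nat) : R[i] := lm k * d k.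

(** The diagonalisation of [UN]: the operator multiplies the [k]-th coordinate
    in the basis of the [p k] by [lam k]. *)
Lemma UNhatE f : H1 f -> UNhat N a b f = polfun (pcomb V (ld (Vinv V f))).
Proof.
move=> hf; rewrite /UNhat /pcomb hdiag -!mulmxA; congr (polfun (PN (V *m _))).
rewrite -(cvec_Vinv V f); apply/matrixP => i j.
by rewrite mul_diag_mx !mxE /ld /lm -ltnS ltn_ord inord_val.
Qed.

Lemma lin_UNhat : lin_op (UNhat N a b).
Proof.
split.
- by move=> f _; exact: H1_polfun.
- move=> f g hf e t It; rewrite /UNhat.
  by rewrite (PiN_eq N0 hf (H1_eqI hf e) (fun k _ => kap_eqI k (H1_contI hf) e)).
- move=> f g hf hg t It; rewrite /UNhat (PiND N0 hf hg) END mulmxDr (PND N0).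
  exact: hornerD.
- move=> z f hf t It; rewrite /UNhat (PiNZ N0 z hf) ENZ -scalemxAr (PNZ N0).
  exact: hornerZ.
Qed.

Lemma UNhat_PiN f : H1 f -> UNhat N a b (polfun (PiN N f)) = UNhat N a b f.
Proof.
by move=> hf; rewrite /UNhat (PiN_polfun N0 (proj1 (PiN_spec N hf))).
Qed.

Lemma kap_UNhat f k : (N < k)%N -> kap (UNhat N a b f) k = 0.
Proof. by apply: kap_polyN; have [] := PN_spec N0 (UN N a b *m EN N (PiN N f)). Qed.

Lemma UNhat_norm f : H1 f ->
  H1norm (UNhat N a b f) <= cabs (lam 0 ord0) * condVhat V * H1norm f.
Proof.
move=> hf; have lf := l2_Vinv (V := V) hf.
have z k : (N < k)%N -> ld (Vinv V f) k = 0.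
  by move=> hk; rewrite /ld /lm leqNgt hk mul0r.
have [l1 e1] := Vhat_finite z.
rewrite (UNhatE hf) -(H1norm_eqI (proj1 (Vhat_spec N0 V l1)) e1).
apply: le_trans (Vhat_norm l1) _.
have [q1 q2] := l2Z (lam 0 ord0) lf.
have lle k : cabs (ld (Vinv V f) k) <= cabs (lam 0 ord0 * Vinv V f k).
  rewrite /ld !cabsM ler_wpM2r ?cabs_ge0// /lm; case: (k <= N)%N => //.
  by rewrite cabs0 cabs_ge0.
have [_ l3] := l2_le lle q1; rewrite q2 in l3.
apply: le_trans (ler_wpM2l alpha_ge0 l3) _.
have := Vhat_inv_norm hf; rewrite (Vhat_invE N0 hV hf) => h.
rewrite mulrCA /condVhat -/alpha -/beta -!mulrA; apply: ler_wpM2l; first exact: cabs_ge0.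
exact: (ler_wpM2l alpha_ge0 h).
Qed.

(** Bauer-Fike on the polynomials: [UNhat - mu] is diagonal in the basis of the
    [p k], with entries [lam k - mu]. *)
Lemma gap_polynomial p (mu : R[i]) (dm : R) : polyN N p -> 0 <= dm ->
  (forall j : 'I_N.+1, dm <= cabs (mu - lam 0 j)) ->
  dm * H1norm (polfun p) <=
  condVhat V * H1norm (fun t => UNhat N a b (polfun p) t - mu * polfun p t).
Proof.
move=> hp dm0 hdm; have hP := H1_polfun p; pose d := Vinv V (polfun p).
have lf := l2_Vinv (V := V) hP.
have d0 k : (N < k)%N -> d k = 0.
  by move=> hk; rewrite /d /Vinv leqNgt hk (kap_polyN hp hk).
pose e k := (lm k - mu) * d k.
have e0 k : (N < k)%N -> e k = 0 by move=> hk; rewrite /e d0// mulr0.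
have [le ee] := Vhat_finite e0.
have he := proj1 (Vhat_spec N0 V le).
have pd : pcomb V d = p by rewrite (pcomb_Vinv N0 hV hP) (PiN_polfun N0 hp).
have eE : eqI (Vhat V e) (fun t => UNhat N a b (polfun p) t - mu * polfun p t).
  move=> t It; rewrite (ee t It) (UNhatE hP) -{2}pd !(pcombE N0) mulr_sumr -sumrB.
  by apply: eq_bigr => k _; rewrite /e /ld -/d; ring.
rewrite -(H1norm_eqI he eE).
have nP : H1norm (polfun p) <= alpha * l2norm d.
  by rewrite -(H1norm_eqI (proj1 (Vhat_spec N0 V lf)) (VhatK N0 hV hP)); exact: Vhat_norm.
have nd : dm * l2norm d <= l2norm e.
  have ad : cabs dm%:C = dm by rewrite cabs_real ger0_norm.
  have [_ z2] := l2Z dm%:C lf; rewrite -{1}ad -z2.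
  apply: (proj2 (l2_le _ le)) => k; rewrite /e !cabsM ad.
  case: (leqP k N) => hk; last by rewrite -/(d k) d0// cabs0 !mulr0.
  by apply: ler_wpM2r; [exact: cabs_ge0|rewrite /lm hk cabsB; exact: hdm].
have ne : l2norm e <= beta * H1norm (Vhat V e).
  by rewrite -{1}(Vhat_inv_Vhat N0 hV le); exact: Vhat_inv_norm.
apply: le_trans (ler_wpM2l dm0 nP) _; rewrite mulrCA /condVhat -/alpha -/beta -mulrA.
exact: (ler_wpM2l alpha_ge0 (le_trans nd ne)).
Qed.

End spectral.

(** * The eigenvalue estimate *)

#[local] Opaque UNhat.

(** Turns a bound of the tail relative to the whole function into a bound
    relative to the truncation. *)
Lemma pythagoras_absorb (R : realType) (e sg tau nx : R) : 0 <= e -> e < 1 ->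
  0 <= sg -> 0 <= tau -> 0 < nx -> sg ^+ 2 + tau ^+ 2 = nx ^+ 2 ->
  tau ^+ 2 <= e ^+ 2 / 2 * nx ^+ 2 -> 0 < sg /\ tau <= e * sg.
Proof.
move=> e0 e1 sg_ge0 tau0 nx0 pyth; rewrite -pyth => tl.
have tau_le : tau <= e * sg.
  have e2 : e ^+ 2 <= 1 by apply: exprn_ile1 => //; exact: ltW.
  rewrite -(@ler_pXn2r _ 2) ?nnegrE ?mulr_ge0// exprMn.
  move: tl (sqr_ge0 tau) (sqr_ge0 sg) (sqr_ge0 e) e2.
  by move: (tau ^+ 2) (sg ^+ 2) (e ^+ 2) => T Q E; nra.
split=> //; rewrite lt_neqAle sg_ge0 andbT eq_sym; apply/eqP => sz.
have t0 : tau = 0 by apply/eqP; rewrite eq_le tau0 andbT (le_trans tau_le)// sz mulr0.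
by move: pyth; rewrite sz t0 expr0n addr0 => /esym/eqP; rewrite sqrf_eq0 gt_eqF.
Qed.

Section main_estimate.
Context {R : realType}.
Variables (N : nat) (a b : R[i] -> R[i]) (S s eta AE BE delta : R) (mu : R[i])
  (V : 'M[R[i]]_N.+1) (lam : 'rV[R[i]]_N.+1) (nu : nat -> R).
Hypotheses (N0 : (1 <= N)%N) (S0 : 0 < S) (s0 : 0 < s) (foci : S ^+ 2 = s ^+ 2 + 1)
  (etaE : expR eta = S + s) (Ss1 : 1 < S + s)
  (ha : forall z, ellipse S s z -> hol a z)
  (hb : forall z, ellipse S s z -> hol b z)
  (hA : forall z, ellipse S s z -> cabs (cprim a z) <= AE)
  (hB : forall z, ellipse S s z -> cabs (cprim b z) <= BE)
  (delta0 : 0 < delta) (dmu : delta <= cabs mu)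
  (hV : V \in unitmx)
  (hdiag : UN N a b = V *m diag_mx lam *m invmx V)
  (hlam : forall j : 'I_N.+1, cabs (lam 0 j) <= cabs (lam 0 ord0))
  (hnu : forall j : nat, (j <= N)%N ->
       H1norm (fun t => monodromy a b (Ttilde j) t - UNhat N a b (Ttilde j) t)
         <= nu j).

Let U := monodromy a b.
Let u := H1opnorm U.
Let kV := condVhat V.
Let l0 := cabs (lam 0 ord0).

Let ca := hol_contI S0 foci ha.
Let cb := hol_contI S0 foci hb.

Let lin_U : lin_op U.
Proof.
split.
- by move=> f hf; apply: (H1_monodromy ca cb); exact: H1_contI.
- by move=> f g hf e; exact: (monodromy_eqI a b (H1_contI hf) e).
- by move=> f g hf hg; apply: (monodromyD ca cb); exact: H1_contI.
- by move=> z f hf; apply: (monodromyZ ca cb); exact: H1_contI.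
Qed.

Let U_norm f : H1 f -> H1norm (U f) <= u * H1norm f.
Proof.
have [K K0 hK] := monodromy_H1 ca cb; exact: (lin_opnorm lin_U K0 hK).
Qed.

Lemma H1_Ttilde k : H1 (Ttilde k : R -> R[i]).
Proof.
apply/H1P; split; first exact: contI_Ttilde.
by apply: l2_eq (proj1 (l2norm_delta k)) => j; rewrite kap_Ttilde.
Qed.

Variables (x : R -> R[i]).
Hypotheses (hx : H1 x) (x0 : 0 < H1norm x)
  (Ux : eqI (U x) (fun t => mu * x t)).

Let mu_le : cabs mu <= u.
Proof.
have := U_norm hx; rewrite (H1norm_eqI (let: And4 h _ _ _ := lin_U in h x hx) Ux).
by have [_ ->] := H1Z mu hx; rewrite ler_pM2r.
Qed.

Let u_ge0 : 0 <= u := le_trans (cabs_ge0 mu) mu_le.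

Let kV1 : 1 <= kV := cond_ge1 N0 hV.
Let kV0 : 0 <= kV. Proof. exact: le_trans ler01 kV1. Qed.

Let xi_ge0 k : 0 <= xi nu k. Proof. exact: sqrtr_ge0. Qed.

Let eps_ge0 k : 0 <= eps eta AE BE delta k.
Proof.
have e0 := eta_gt0 etaE Ss1.
rewrite /eps !mulr_ge0 ?expR_ge0// invr_ge0 /sinh divr_ge0// subr_ge0 ler_expR; lra.
Qed.

Let factor_ge0 : 0 <= u + l0 * kV.
Proof. by rewrite addr_ge0// mulr_ge0// cabs_ge0. Qed.

(** Here [omega] is larger than the trivial bound [|mu| + |lam_1|], because
    [|mu|] is at most the norm of [U] and the condition number is at least 1. *)
Let small_case k (dm : R) : 1 <= eps eta AE BE delta k ->
  dm <= cabs (mu - lam 0 ord0) ->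
  dm <= omega a b V (lam 0 ord0) eta AE BE delta nu k * kV.
Proof.
move=> e1 /le_trans; apply; rewrite /omega -/U -/u -/kV -/l0.
set e := eps _ _ _ _ k in e1 *.
apply: le_trans (cabs_sub _ _) _; rewrite -/l0.
have h1 : cabs mu + l0 <= u + l0 * kV.
  by rewrite lerD// ler_peMr// cabs_ge0.
have h2 : u + l0 * kV <= e * (u + l0 * kV) by rewrite ler_peMl.
have h3 : 0 <= (1 + e) * xi nu k by apply: mulr_ge0 => //; lra.
apply: le_trans (le_trans h1 h2) _.
apply: (@le_trans _ _ (e * (u + l0 * kV) + (1 + e) * xi nu k)).
  by rewrite lerDl.
have e0 : 0 <= e := le_trans ler01 e1.
by rewrite ler_peMr// addr_ge0// mulr_ge0.
Qed.

Let D f t := UNhat N a b f t - U f t.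

Let lin_D : lin_op D.
Proof. exact: (lin_opB (lin_UNhat N0 a b) lin_U). Qed.

Let truncation k : (k <= N)%N -> exists xk, [/\ H1 xk, kap xk = trunc k (kap x) &
  H1norm (D xk) <= xi nu k * H1norm xk].
Proof.
move=> kN; pose xk t := \sum_(j < k.+1) kap x j * Ttilde j t.
have hxk : H1 xk := proj1 (H1_comb (kap x) k.+1 H1_Ttilde).
have kxk : kap xk = trunc k (kap x).
  by apply/funext => j; rewrite kap_comb /trunc ltnS.
exists xk; split => //.
have hn j : (j < k.+1)%N -> H1norm (D (Ttilde j)) <= nu j.
  rewrite ltnS => jk; apply: le_trans (hnu (leq_trans jk kN)).
  have [hU _ _ _] := lin_U; have [hUN _ _ _] := lin_UNhat N0 a b.
  have E : H1norm (D (Ttilde j)) =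
    H1norm (fun t => U (Ttilde j) t - UNhat N a b (Ttilde j) t).
    exact: (H1norm_subC (hUN _ (H1_Ttilde j)) (hU _ (H1_Ttilde j))).
  rewrite -/U E; exact: lexx.
have := lin_op_CS (kap x) lin_D H1_Ttilde hn; rewrite mulrC => /le_trans; apply.
apply: ler_wpM2l; first exact: sqrtr_ge0.
rewrite (H1normE hxk) kxk; have h0 j : (k.+1 <= j)%N -> trunc k (kap x) j = 0.
  by rewrite /trunc ltnNge => /negPf ->.
have [_ h2] := l2_finite h0.
have <- : \sum_(i < k.+1) cabs (trunc k (kap x) i) ^+ 2 =
    \sum_(i < k.+1) cabs (kap x i) ^+ 2.
  by apply: eq_bigr => i _; rewrite /trunc -ltnS ltn_ord.
by rewrite -h2 sqrtr_sqr ger0_norm// l2norm_ge0.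
Qed.

Let kap_Ux j : kap (U x) j = mu * kap x j.
Proof.
have [hU _ _ _] := lin_U.
by rewrite (kap_eqI j (H1_contI (hU x hx)) Ux) (kapZ mu j (H1_contI hx)).
Qed.

(** On polynomials the residual of the eigenvalue equation is the truncation of
    the discretisation error at the exact eigenfunction. *)
Let residual : H1norm (fun t => UNhat N a b (polfun (PiN N x)) t - mu * polfun (PiN N x) t)
  <= H1norm (D x).
Proof.
have [hp kp] := PiN_spec N hx; have [hU _ _ _] := lin_U.
have [hUN _ _ _] := lin_UNhat N0 a b; have [hD _ _ _] := lin_D.
have cP := contI_polfun (PiN N x); have hUNx := hUN x hx.
have cUNx := H1_contI hUNx.
rewrite (UNhat_PiN N0 a b hx).
have [h1 _] := H1Z mu (H1_polfun (PiN N x)); have [h2 _] := H1B hUNx h1.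
rewrite (H1normE h2) (H1normE (hD _ hx)).
apply: (proj2 (l2_le _ (H1_l2 (hD _ hx)))) => j.
rewrite (kapB j cUNx (H1_contI h1)) (kapZ mu j cP) kp.
rewrite (kapB j cUNx (H1_contI (hU x hx))) kap_Ux /trunc.
case: (leqP j N) => [//|jN].
by rewrite (kap_UNhat N0 a b x jN) mulr0 subrr cabs0 cabs_ge0.
Qed.

(** With [x_k] and [y] the parts of [x] of degree at most and larger than [k]:
    the residual at [x] is split along [x = y + x_k], and [y] is absorbed in
    [x_k] by the decay of the coefficients of [x]. *)
Let main_case k (dm : R) : (1 <= k)%N -> (k <= N)%N ->
  eps eta AE BE delta k < 1 -> 0 <= dm ->
  (forall j : 'I_N.+1, dm <= cabs (mu - lam 0 j)) ->
  dm <= omega a b V (lam 0 ord0) eta AE BE delta nu k * kV.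
Proof.
move=> k1 kN e1 dm0 hdm; have lx := H1_l2 hx; have cx := H1_contI hx.
set e := eps _ _ _ _ k in e1.
have e0 : 0 <= e := eps_ge0 k.
have [xk [hxk kxk Dxk]] := truncation kN.
have [hy _] := H1B hx hxk; pose y t := x t - xk t; rewrite -/y in hy.
have ky : kap y = tailc k (kap x).
  apply/funext => j; rewrite (kapB j cx (H1_contI hxk)) kxk /trunc /tailc.
  by case: (j <= k)%N; rewrite ?subrr ?subr0.
pose sg := H1norm xk; pose tau := H1norm y.
have sgE : sg = l2norm (trunc k (kap x)) by rewrite /sg (H1normE hxk) kxk.
have tauE : tau = l2norm (tailc k (kap x)) by rewrite /tau (H1normE hy) ky.
have sg_ge0 : 0 <= sg by exact: H1norm_ge0.
have tau_ge0 : 0 <= tau by exact: H1norm_ge0.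
have pyth : sg ^+ 2 + tau ^+ 2 = H1norm x ^+ 2.
  by rewrite sgE tauE (l2_split k lx) (H1normE hx).
have tl : tau ^+ 2 <= e ^+ 2 / 2 * H1norm x ^+ 2.
  rewrite tauE; exact: (eigen_tail S0 s0 foci etaE Ss1 ha hb hA hB delta0 dmu hx Ux k1 e1).
have [sg0 tau_le] := pythagoras_absorb e0 e1 sg_ge0 tau_ge0 x0 pyth tl.
have [hp kp] := PiN_spec N hx; have hP := H1_polfun (PiN N x).
have sgP : sg <= H1norm (polfun (PiN N x)).
  rewrite (H1normE hP) (funext kp) sgE.
  apply: (proj2 (l2_le _ (proj1 (l2_trunc N lx)))) => j; rewrite /trunc.
  case: (leqP j k) => jk; first by rewrite (leq_trans jk kN).
  by rewrite cabs0 cabs_ge0.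
have [hD hDe hDD _] := lin_D.
have Dx : H1norm (D x) <= (l0 * kV + u) * tau + xi nu k * sg.
  have xE : eqI x (fun t => y t + xk t) by move=> t _; rewrite /y subrK.
  have [hyk _] := H1D hy hxk.
  have E1 := H1norm_eqI (hD _ hx) (hDe _ _ hx xE).
  have E2 := H1norm_eqI (hD _ hyk) (hDD _ _ hy hxk).
  rewrite E1 E2; have [_ tri] := H1D (hD _ hy) (hD _ hxk).
  apply: le_trans tri _; apply: lerD; last exact: Dxk.
  have [hU _ _ _] := lin_U; have [hUN _ _ _] := lin_UNhat N0 a b.
  have [_ tri'] := H1B (hUN _ hy) (hU _ hy).
  apply: le_trans tri' _; rewrite mulrDl; apply: lerD.
    exact: (UNhat_norm N0 hV hdiag hlam hy).
  exact: U_norm.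
have gap := gap_polynomial N0 hV hdiag hp dm0 hdm.
have fin : dm * sg <= omega a b V (lam 0 ord0) eta AE BE delta nu k * kV * sg.
  apply: le_trans (ler_wpM2l dm0 sgP) _; apply: le_trans gap _.
  rewrite -/kV; set om := omega _ _ _ _ _ _ _ _ _ _.
  rewrite (_ : om * kV * sg = kV * (om * sg)); last by ring.
  apply: (ler_wpM2l kV0).
  apply: le_trans residual _; apply: le_trans Dx _.
  rewrite /om /omega -/U -/u -/kV -/l0 -/e [leRHS]mulrDl; apply: lerD.
    apply: le_trans (ler_wpM2l _ tau_le) _; first by rewrite addrC.
    by rewrite le_eqVlt; apply/orP; left; apply/eqP; ring.
  by apply: (ler_wpM2r sg_ge0); rewrite (ler_peMl (xi_ge0 k)) ?lerDl.
rewrite (ler_pM2r sg0) in fin; exact: fin.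
Qed.

Lemma eigenvalue_bound k (dm : R) : (1 <= k)%N -> (k <= N)%N -> 0 <= dm ->
  (forall j : 'I_N.+1, dm <= cabs (mu - lam 0 j)) ->
  dm <= omega a b V (lam 0 ord0) eta AE BE delta nu k * kV.
Proof.
move=> k1 kN dm0 hdm; case: (ltP (eps eta AE BE delta k) 1) => e1.
  exact: main_case.
exact: small_case.
Qed.

End main_estimate.

Theorem theorem14 (R : realType) (N : nat) (a b : R[i] -> R[i])
    (Om : set R[i]) (S s eta AE BE delta : R) (mu : R[i])
    (V : 'M[R[i]]_N.+1) (lam : 'rV[R[i]]_N.+1) (nu : nat -> R)
    (hN : (1 <= N)%N)
    (hOm : open (Om : set R[i]^o))
    (ha : analytic_on a Om) (hb : analytic_on b Om)
    (hS : 0 < S) (hs : 0 < s) (hfoci : S ^+ 2 = s ^+ 2 + 1)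
    (hE : ellipse S s `<=` Om)
    (heta : expR eta = S + s) (hSs : 1 < S + s)
    (hAE : is_max [set cabs (cprim a z) | z in ellipse S s] AE)
    (hBE : is_max [set cabs (cprim b z) | z in ellipse S s] BE)
    (hmu : is_eigenvalue_CI (monodromy a b) mu)
    (hdelta : 0 < delta) (hmudelta : delta <= cabs mu)
    (hinv : DNhat N - Mahat N a \in unitmx)
    (hV : V \in unitmx)
    (hdiag : UN N a b = V *m diag_mx lam *m invmx V)
    (hlam : forall i j : 'I_N.+1, (i <= j)%N ->
       cabs (lam 0 j) <= cabs (lam 0 i))
    (hnu : forall j : nat, (j <= N)%N ->
       H1norm (fun t => monodromy a b (Ttilde j) t - UNhat N a b (Ttilde j) t)
         <= nu j) :
  (\big[Num.min/cabs (mu - lam 0 ord0)]_(j < N.+1) cabs (mu - lam 0 j))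
  <= (\big[Num.min/omega a b V (lam 0 ord0) eta AE BE delta nu 1]_(1 <= k < N.+1)
        omega a b V (lam 0 ord0) eta AE BE delta nu k)
     * condVhat V.

Proof.
have hola z : ellipse S s z -> hol a z by move=> hz; apply: analytic_hol; apply: ha; exact: hE.
have holb z : ellipse S s z -> hol b z by move=> hz; apply: analytic_hol; apply: hb; exact: hE.
have hA z : ellipse S s z -> cabs (cprim a z) <= AE.
  by move=> hz; apply: (proj2 hAE); exists z.
have hB z : ellipse S s z -> cabs (cprim b z) <= BE.
  by move=> hz; apply: (proj2 hBE); exists z.
have hlam0 (j : 'I_N.+1) : cabs (lam 0 j) <= cabs (lam 0 ord0) by exact: hlam.
have ca := hol_contI hS hfoci hola; have cb := hol_contI hS hfoci holb.
have [x [cx [xn0 Ux]]] := hmu.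
have {}cx : contI x by split.
have mu0 : mu != 0.
  by apply/eqP => m0; move: (lt_le_trans hdelta hmudelta); rewrite m0 cabs0 ltxx.
have hx : H1 x.
  have hU := H1_monodromy ca cb cx; have [h1 _] := H1Z mu^-1 hU.
  by apply: (H1_eqI h1) => t It; rewrite (Ux t It) mulKf.
have x0 : 0 < H1norm x.
  rewrite lt_neqAle H1norm_ge0 andbT eq_sym; apply/eqP => z.
  exact: xn0 (H1norm_eq0 hx z).
set dm := (X in X <= _).
have dm0 : 0 <= dm by apply: le_bigmin => [|j _]; exact: cabs_ge0.
have hdm (j : 'I_N.+1) : dm <= cabs (mu - lam 0 j) by exact: bigmin_le.
have bound k : (1 <= k)%N -> (k <= N)%N ->
    dm <= omega a b V (lam 0 ord0) eta AE BE delta nu k * condVhat V.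
  move=> k1 kN; exact: (eigenvalue_bound hN hS hs hfoci heta hSs hola holb hA hB
    hdelta hmudelta hV hdiag hlam0 hnu hx x0 Ux k1 kN dm0 hdm).
rewrite big_nat; elim/big_ind : _ => [|y z hy hz|k /andP[k1 kN]].
- exact: bound.
- by rewrite /Order.min; case: ifP.
- by apply: bound.
Qed.
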